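(* Let $\bm w$ be a Markov stick-breaking weights sequence with length variables $\bm v=(v_j)_{j\ge1}$ such that almost surely $\sum_{j\ge1}w_j=1$ and $w_j>0$ for every $j\ge1$. Assume that at least one of the following holds: (A) the law of $(v_1,v_2)$ and Lebesgue measure on $[0,1]^2$ are mutually absolutely continuous; (B) the support of $(w_1,w_2)$ is convex, and there is a version $\phi$ of the conditional law $\mathbb P[v_3\in\cdot\mid v_2]$ that is left continuous with respect to the weak topology (i.e. $\phi(u_n)\to\phi(u)$ weakly whenever $u_n<u$, $u_n\to u$); (C) there exists $0<\varepsilon<1$ such that $\{(x_1,x_2)\in[0,1]^2: x_2=\varepsilon\}$ is contained in the support of $(v_1,v_2)$, and there is a version $\psi_2$ of $\mathbb P[v_3\in\cdot\mid v_2]$ that is weakly continuous, i.e. $\psi_2(u_n,\cdot)\to\psi_2(u,\cdot)$ weakly whenever $u_n\to u$ in the support of $v_2$. Then $\bm w$ is invariant under size-biased permutations if and only if the length variables are independent with $v_j\sim\mathrm{Beta}(1-\sigma,\theta+j\sigma)$ for all $j\ge1$, for some $\sigma\in[0,1)$ and $\theta>-\sigma$.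
   Context: Length variables $\bm v=(v_j)_{j\ge1}$ are $[0,1]$-valued random variables defining stick-breaking weights $w_1=v_1$, $w_j=v_j\prod_{i<j}(1-v_i)$; $\bm w$ is a Markov stick-breaking weights sequence if $\bm v$ is a Markov chain. For weights with $\sum_jw_j=1$, a size-biased permutation is $(w_{\varrho_j})_{j\ge1}$ where the random permutation $\bm\varrho$ satisfies $\mathbb P[\varrho_1=j\mid\bm w]=w_j$ and $\mathbb P[\varrho_{k+1}=j\mid\bm w,\varrho_1,\dots,\varrho_k]=\frac{w_j}{1-\sum_{i=1}^k w_{\varrho_i}}\mathbb 1\{j\notin\{\varrho_1,\dots,\varrho_k\}\}$ on the event $\sum_{i\le k}w_{\varrho_i}<1$ (otherwise $\varrho_{k+1}$ is the smallest positive integer not in $\{\varrho_1,\dots,\varrho_k\}$). $\bm w$ is invariant under size-biased permutations if $(w_{\varrho_j})_{j\ge1}$ has the same law as $(w_j)_{j\ge1}$. *)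

(* Defs.v *)
From HB Require Import structures.
From mathcomp Require Import all_boot all_order all_algebra.
From mathcomp Require Import all_classical all_reals all_analysis.
From mathcomp Require Import measurable_realfun.

Set Implicit Arguments.
Unset Strict Implicit.
Unset Printing Implicit Defensive.

Import Order.TTheory GRing.Theory Num.Theory.
Import numFieldNormedType.Exports.

Local Open Scope classical_set_scope.
Local Open Scope ring_scope.

(* Indexing convention: the paper's v_1, v_2, ... are v 0, v 1, ...
   (and similarly w_j is sb_weights v (j-1)). *)

Section defs.
Context {R : realType}.

Definition sb_weights {T : Type} (v : nat -> T -> R) (j : nat) (o : T) : R :=
  v j o * \prod_(i < j) (1 - v i o).

(** Two sequences of real random variables (possibly on different spaces)
    have the same law on R^N: equality on the generating pi-system of
    finite-dimensional cylinder rectangles. *)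
Definition same_law {d d' : measure_display}
  {T : measurableType d} {T' : measurableType d'}
  (P : probability T R) (X : nat -> T -> R)
  (Q : probability T' R) (Y : nat -> T' -> R) : Prop :=
  forall (n : nat) (A : nat -> set R), (forall i, measurable (A i)) ->
    P [set o | forall i, (i < n)%N -> A i (X i o)] =
    Q [set o | forall i, (i < n)%N -> A i (Y i o)].

(** Least natural number not occurring among r 0, ..., r (k-1)
    (0-indexed version of "smallest positive integer not in {rho_1..rho_k}"). *)
Definition first_free (r : nat -> nat) (k : nat) : nat :=
  let s := [seq r l | l <- iota 0 k] in
  find (fun n => n \notin s) (iota 0 k.+1).

(** P[rho_{k+1} = j | w, rho_1..rho_k] as prescribed by a size-biased
    permutation, evaluated at weights x and previous picks r 0..r (k-1). *)
Definition sb_cond (x : nat -> R) (r : nat -> nat) (k j : nat) : R :=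
  let S := \sum_(l < k) x (r l) in
  if S < 1 then
    (if j \in [seq r l | l <- iota 0 k] then 0 else x j / (1 - S))
  else (if j == first_free r k then 1 else 0).

(** rho is a size-biased permutation of the weights w' (on the space of Q):
    for every k, j and every event E of the generating pi-system of
    sigma(w', rho_1, ..., rho_k), Q(E /\ rho_{k+1} = j) = E_Q[1_E * sb_cond]. *)
Definition size_biased_perm {d : measure_display} {T : measurableType d}
  (Q : probability T R) (w : nat -> T -> R) (rho : nat -> T -> nat) : Prop :=
  forall (k j n : nat) (A : nat -> set R) (idx : nat -> nat),
    (forall i, measurable (A i)) ->
    let E := [set o | (forall i, (i < n)%N -> A i (w i o)) /\
                      (forall l, (l < k)%N -> rho l o = idx l)] in
    Q (E `&` [set o | rho k o = j]) =
    (\int[Q]_(o in E) (sb_cond (fun i => w i o) (fun l => rho l o) k j)%:E)%E.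

Definition sbp_invariant {d : measure_display} {T : measurableType d}
  (P : probability T R) (w : nat -> T -> R) : Prop :=
  forall (d' : measure_display) (T' : measurableType d')
    (Q : probability T' R) (w' : nat -> T' -> R) (rho : nat -> T' -> nat),
    (forall j, measurable_fun setT (w' j)) ->
    (forall k i, measurable (rho k @^-1` [set i])) ->
    same_law P w Q w' ->
    size_biased_perm Q w' rho ->
    same_law Q (fun j o => w' (rho j o) o) P w.

Definition cond_law_version {d : measure_display} {T : measurableType d}
  (P : probability T R) (X Y : T -> R) (phi : R -> probability R R) : Prop :=
  (forall B : set R, measurable B -> measurable_fun [set: R] (fun u : R => (phi u B : \bar R))) /\
  (forall A B : set R, measurable A -> measurable B ->
     P (X @^-1` A `&` Y @^-1` B) = (\int[P]_(o in X @^-1` A) phi (X o) B)%E).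

Definition markov_chain {d : measure_display} {T : measurableType d}
  (P : probability T R) (v : nat -> T -> R) : Prop :=
  forall n : nat, exists kappa : R -> probability R R,
    (forall B : set R, measurable B -> measurable_fun [set: R] (fun u : R => (kappa u B : \bar R))) /\
    (forall (A : nat -> set R) (B : set R), (forall i, measurable (A i)) ->
       measurable B ->
       let E := [set o | forall i, (i <= n)%N -> A i (v i o)] in
       P (E `&` v n.+1 @^-1` B) = (\int[P]_(o in E) kappa (v n o) B)%E).

(** Mutual independence of the family (v_j): product rule on every finite
    initial family (unused coordinates may be taken with A i = setT). *)
Definition mutually_independent {d : measure_display} {T : measurableType d}
  (P : probability T R) (v : nat -> T -> R) : Prop :=
  forall (n : nat) (A : nat -> set R), (forall i, measurable (A i)) ->
    P [set o | forall i, (i < n)%N -> A i (v i o)] =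
    (\prod_(i < n) P (v i @^-1` A i))%E.

Definition beta_dens (a b x : R) : R := (x `^ (a - 1)) * ((1 - x) `^ (b - 1)).

Definition beta_law {d : measure_display} {T : measurableType d}
  (P : probability T R) (X : T -> R) (a b : R) : Prop :=
  forall A : set R, measurable A ->
    P (X @^-1` A) =
    ((\int[lebesgue_measure]_(x in A `&` `]0%R, 1%R[) (beta_dens a b x)%:E) *
     (\int[lebesgue_measure]_(x in `]0%R, 1%R[) (beta_dens a b x)%:E)^-1)%E.

Definition support2 {d : measure_display} {T : measurableType d}
  (P : probability T R) (X1 X2 : T -> R) : set (R * R) :=
  [set x | forall e : R, 0 < e ->
     (0 < P [set o | (`|X1 o - x.1| < e)%R /\ (`|X2 o - x.2| < e)%R])%E].

Definition support1 {d : measure_display} {T : measurableType d}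
  (P : probability T R) (X : T -> R) : set R :=
  [set x | forall e : R, 0 < e -> (0 < P [set o | (`|X o - x| < e)%R])%E].

Definition convex2 (S : set (R * R)) : Prop :=
  forall x y t, S x -> S y -> 0 <= t <= 1 ->
    S (t * x.1 + (1 - t) * y.1, t * x.2 + (1 - t) * y.2).

Definition weak_cvg (m : nat -> probability R R) (mu : probability R R) : Prop :=
  forall f : R -> R, continuous f -> (exists M : R, forall x, `|f x| <= M) ->
    (fun n => \int[m n]_x (f x)%:E)%E @ \oo --> (\int[mu]_x (f x)%:E)%E.

Definition condA {d : measure_display} {T : measurableType d}
  (P : probability T R) (v : nat -> T -> R) : Prop :=
  forall A : set (R * R), measurable A ->
    (P [set o | A (v 0%N o, v 1%N o)] = 0%E <->
     ((@lebesgue_measure R) \x (@lebesgue_measure R))%E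
        (A `&` (`[0, 1] `*` `[0, 1])) = 0%E).

Definition condB {d : measure_display} {T : measurableType d}
  (P : probability T R) (v : nat -> T -> R) : Prop :=
  convex2 (support2 P (sb_weights v 0%N) (sb_weights v 1%N)) /\
  exists phi : R -> probability R R,
    cond_law_version P (v 1%N) (v 2%N) phi /\
    forall (u : nat -> R) (u0 : R),
      (forall n, u n < u0) -> u @ \oo --> u0 ->
      weak_cvg (fun n => phi (u n)) (phi u0).

Definition condC {d : measure_display} {T : measurableType d}
  (P : probability T R) (v : nat -> T -> R) : Prop :=
  (exists eps : R, 0 < eps < 1 /\
     [set x : R * R | 0 <= x.1 <= 1 /\ x.2 = eps]
       `<=` support2 P (v 0%N) (v 1%N)) /\
  exists psi : R -> probability R R,
    cond_law_version P (v 1%N) (v 2%N) psi /\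
    forall (u : nat -> R) (u0 : R),
      (forall n, support1 P (v 1%N) (u n)) -> support1 P (v 1%N) u0 ->
      u @ \oo --> u0 ->
      weak_cvg (fun n => psi (u n)) (psi u0).

End defs.

(* Main.v *)
(* A weight sequence is invariant under size-biased permutations if and only if,
   for every k, its law reweighted by 1 - w_0 - ... - w_k is invariant under the
   exchange of w_k and w_{k+1}: the conditional probability of a list of picks is
   symmetric in two consecutive picks except for one factor, and conversely the
   iterated exchanges bring every w_i to the front with the density w_i.
   In the length variables the exchange acts on the pair (v_k, v_{k+1}) only, under
   the density 1 - v_k, and for independent beta variables it is the symmetry
   of a density in the coordinates v_k and (1 - v_k) v_{k+1}.

   Conversely, write E[(1 - v_{k+2})^l | v_k, v_{k+1}] = g(v_{k+1}) by the Markov property.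
   The exchange forces g(v_{k+1}) = g(v_k / (1 - (1 - v_k) v_{k+1})) almost surely, which
   makes g(v_1) constant under each of the three conditions, so that v_2 is
   independent of (v_0, v_1). Moment identities then give the independence of v_0
   and v_1, and they put 1 / (1 - r_l), r_l = E(1 - v_0)^{l+1} / E(1 - v_0)^l, in
   arithmetic progression, which are the moments of a beta law. The law of
   (v_k, v_{k+1}) is now equivalent to the Lebesgue measure and the argument
   propagates to all k by induction. *)

Require Import Defs.
From HB Require Import structures.
From mathcomp Require Import all_boot all_order all_algebra.
From mathcomp Require Import all_classical all_reals all_analysis.
From mathcomp Require Import measurable_realfun giry.
From mathcomp Require Import ring lra zify.

Set Implicit Arguments.
Unset Strict Implicit.
Unset Printing Implicit Defensive.

Import Order.TTheory GRing.Theory Num.Theory.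
Import numFieldNormedType.Exports.

Local Open Scope classical_set_scope.
Local Open Scope ring_scope.

(** * Positive functionals *)

(** Invariance is stated for every space that carries a size-biased permutation, so it gives
    information only once such a space is built: an independent uniform variable selects nested
    subintervals of [0, 1) whose lengths are the probabilities of the lists of picks. Integrating
    the permutation out leaves an identity on the weights alone. The obstacle in the converse is
    that the identity for g holds only almost surely, while each condition offers a different
    regularity. Under (A), a Moebius change of variable spreads one null section over all values.
    Under (B), convexity fills a whole rectangle below every support point, and its points can be
    approached strictly from below. Under (C), the same Moebius map reaches every value from the
    line at height epsilon. Conditional laws are never compared directly: they enter through the
    moments of 1 - x, which determine a law on [0, 1]. Two signs are invisible in the moment
    identities: b > 0 comes from the divergence of the beta integral when b <= 0, and sigma >= 0
    from b + n (1 - a) > 0 for all n. *)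

Section posfun.
Local Open Scope ereal_scope.
Context d (T : measurableType d) (R : realType).
Implicit Types (Phi Psi : (T -> \bar R) -> \bar R) (f g : T -> \bar R).

(* An integral, seen only as a functional on nonnegative measurable functions:
   changes of variables, densities and kernels then compose without constructing
   image measures. *)
Structure posfun Phi : Prop := PosFun {
  posfun_ge0 : forall f, (forall x, 0 <= f x) -> measurable_fun setT f ->
    0 <= Phi f ;
  posfunD : forall f g, (forall x, 0 <= f x) -> measurable_fun setT f ->
    (forall x, 0 <= g x) -> measurable_fun setT g ->
    Phi (fun x => f x + g x) = Phi f + Phi g ;
  posfunZ : forall (k : R) f, (0 <= k)%R -> (forall x, 0 <= f x) ->
    measurable_fun setT f -> Phi (fun x => k%:E * f x) = k%:E * Phi f ;
  posfun_cvg : forall (f_ : nat -> T -> \bar R) f,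
    (forall n x, 0 <= f_ n x) -> (forall n, measurable_fun setT (f_ n)) ->
    (forall x, nondecreasing_seq (f_ ^~ x)) ->
    (forall x, f_ ^~ x @ \oo --> f x) ->
    (Phi (f_ n)) @[n --> \oo] --> Phi f }.

Lemma measurable_indicE (A : set T) : measurable A ->
  measurable_fun setT (fun x => (\1_A x)%:E : \bar R).
Proof. by move=> mA; apply/measurable_EFinP; exact: measurable_indic. Qed.

Lemma posfun0 Phi : posfun Phi -> Phi (fun=> 0) = 0.
Proof.
move=> h; rewrite -[in LHS](mul0e (0 : \bar R)).
by rewrite (posfunZ h (k := 0%R) (f := fun=> 0)) ?mul0e// => *; exact: measurable_cst.
Qed.

Lemma posfun_sum Phi (f : nat -> T -> \bar R) n :
  posfun Phi -> (forall n x, 0 <= f n x) ->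
  (forall n, measurable_fun setT (f n)) ->
  Phi (fun x => \sum_(i < n) f i x) = \sum_(i < n) Phi (f i).
Proof.
move=> h f0 mf; elim: n => [|n IHn].
  rewrite big_ord0 -[RHS](posfun0 h); congr Phi; apply/funext => x.
  by rewrite big_ord0.
rewrite big_ord_recr/= -IHn -posfunD//; last 2 first.
- by move=> x; rewrite sume_ge0.
- exact: emeasurable_sum.
by congr Phi; apply/funext => x; rewrite big_ord_recr.
Qed.

(** Turns the functional back into a measure, so that the uniqueness theorem for measures on a
    pi-system applies to it. Nonmeasurable sets get the default value 0. *)
Definition posfun_measure Phi (h : posfun Phi) (A : set T) : \bar R :=
  if `[< measurable A >] then Phi (fun x => (\1_A x)%:E) else 0.

Section measure.
Variables (Phi : (T -> \bar R) -> \bar R) (h : posfun Phi).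

Let m0 : posfun_measure h set0 = 0.
Proof.
rewrite /posfun_measure; case: ifP => // _; rewrite -[RHS](posfun0 h).
by congr Phi; apply/funext => x; rewrite indic0.
Qed.

Let m_ge0 A : 0 <= posfun_measure h A.
Proof.
rewrite /posfun_measure; case: ifPn => // /asboolP mA.
apply: (posfun_ge0 h); last exact: measurable_indicE.
by move=> x; rewrite lee_fin.
Qed.

Let m_sigma : semi_sigma_additive (posfun_measure h).
Proof.
move=> F mF tF mUF; rewrite /posfun_measure asboolT//.
have mI n := measurable_indicE (mF n).
have I0 n x : 0 <= (\1_(F n) x)%:E :> \bar R by rewrite lee_fin.
rewrite (_ : (fun _ => _) =
    fun n => Phi (fun x => \sum_(i < n) (\1_(F i) x)%:E)); last first.
  apply/funext => n; rewrite (posfun_sum (f := fun i x => (\1_(F i) x)%:E) n h)//.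
  by rewrite big_mkord; apply: eq_bigr => i _; rewrite asboolT.
apply: (posfun_cvg h) => //.
- by move=> n x; rewrite sume_ge0.
- by move=> n; exact: emeasurable_sum.
- move=> x; apply/nondecreasing_seqP => n.
  by rewrite big_ord_recr/= leeDl.
move=> x; rewrite indic_bigcup//; under eq_fun do rewrite -(big_mkord xpredT (fun i => (\1_(F i) x)%:E)).
by apply: is_cvg_nneseries => n _ _; exact: I0.
Qed.

HB.instance Definition _ := isMeasure.Build _ _ _ (posfun_measure h)
  m0 m_ge0 m_sigma.

Lemma posfun_measureE (A : set T) : measurable A ->
  posfun_measure h A = Phi (fun x => (\1_A x)%:E).
Proof. by move=> mA; rewrite /posfun_measure asboolT. Qed.

End measure.

Import HBNNSimple.

(** Indicators give simple functions by linearity, and increasing approximation by simple functions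
    gives the rest. *)
Lemma posfun_ext Phi Psi (hPhi : posfun Phi) (hPsi : posfun Psi) :
  (forall A, measurable A ->
    Phi (fun x => (\1_A x)%:E) = Psi (fun x => (\1_A x)%:E)) ->
  forall f, (forall x, 0 <= f x) -> measurable_fun setT f -> Phi f = Psi f.
Proof.
move=> PhiPsi f f0 mf.
pose f_ := nnsfun_approx measurableT mf.
have fP n : Phi (fun x => (f_ n x)%:E) = Psi (fun x => (f_ n x)%:E).
  set g := f_ n; pose s := finmap.enum_fset (fset_set (range g)).
  pose h i x := (s`_i * \1_(g @^-1` [set s`_i]) x)%:E.
  have gE : (fun x => (g x)%:E) = fun x => \sum_(i < size s) h i x.
    by apply/funext => x; rewrite fimfunEord// -sumEFin.
  have s0 i : (0 <= s`_i)%R.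
    have [is_|is_] := ltnP i (size s); last by rewrite nth_default.
    have := mem_nth 0%R is_; rewrite (in_fset_set (fimfunP g)) inE => -[x _ <-].
    exact: fun_ge0.
  have ms i : measurable (g @^-1` [set s`_i]) by [].
  have h0 i x : 0 <= h i x by rewrite lee_fin mulr_ge0.
  have mh i : measurable_fun setT (h i).
    by apply/measurable_EFinP; apply: measurable_funM => //; exact: measurable_indic.
  rewrite gE !posfun_sum//; apply: eq_bigr => i _.
  rewrite (_ : h i = fun x => (s`_i)%:E * (\1_(g @^-1` [set s`_i]) x)%:E)//.
  by rewrite !posfunZ ?PhiPsi//; exact: measurable_indicE.
have f_0 n x : 0 <= (f_ n x)%:E by rewrite lee_fin.
have mf_ n : measurable_fun setT (fun x => (f_ n x)%:E) by exact/measurable_EFinP.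
have f_nd x : nondecreasing_seq (fun n => (f_ n x)%:E).
  by move=> m n mn; rewrite lee_fin; exact/lefP/nd_nnsfun_approx.
have f_f x : (f_ n x)%:E @[n --> \oo] --> f x by exact: cvg_nnsfun_approx.
have /cvg_lim <- // := posfun_cvg hPhi f_0 mf_ f_nd f_f.
have /cvg_lim <- // := posfun_cvg hPsi f_0 mf_ f_nd f_f.
by apply: congr_lim; apply/funext => n; exact: fP.
Qed.

(** Uniqueness of measures on a pi-system, read for functionals. The finite value at the constant 1
    lets the whole space serve as the finite cover. *)
Lemma posfun_unique (G : set (set T)) Phi Psi :
  posfun Phi -> posfun Psi ->
  @measurable _ T = <<s G >> -> setI_closed G -> G setT ->
  Phi (fun=> 1) < +oo ->
  (forall A, G A -> Phi (fun x => (\1_A x)%:E) = Psi (fun x => (\1_A x)%:E)) ->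
  forall f, (forall x, 0 <= f x) -> measurable_fun setT f -> Phi f = Psi f.
Proof.
move=> hPhi hPsi mG GI GT Phi1 PhiPsi; apply: posfun_ext => // A mA.
have Gm : G `<=` measurable by rewrite mG; exact: sub_sigma_algebra.
rewrite -(posfun_measureE hPhi mA) -(posfun_measureE hPsi mA).
apply: (@g_sigma_algebra_measure_unique _ _ _ G Gm (fun=> setT)) => //.
- by rewrite bigcup_const.
- move=> B GB; rewrite [LHS](posfun_measureE hPhi); last exact: Gm.
  by rewrite [RHS](posfun_measureE hPsi) ?PhiPsi//; exact: Gm.
- move=> _; rewrite [ltLHS](posfun_measureE hPhi)//.
  by under eq_fun do rewrite indicT.
- by rewrite -mG.
Qed.

Lemma posfun_integral (mu : {measure set T -> \bar R}) (D : set T) :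
  measurable D -> posfun (fun f => \int[mu]_(x in D) f x).
Proof.
move=> mD; split => //.
- by move=> f f0 mf; exact: integral_ge0.
- move=> f g f0 mf g0 mg; apply: ge0_integralD => //; exact: measurable_funTS.
- move=> k f k0 f0 mf; apply: ge0_integralZl_EFin => //; exact: measurable_funTS.
- move=> f_ f f0 mf nd cf.
  have -> : \int[mu]_(x in D) f x = \int[mu]_(x in D) limn (f_ ^~ x).
    by apply: eq_integral => x _; apply/esym/cvg_lim => //; exact: cf.
  apply: cvg_monotone_convergence => // n; exact: measurable_funTS.
Qed.

End posfun.

Section posfun_integral.
Local Open Scope ereal_scope.
Context d d' (T : measurableType d) (S : measurableType d') (R : realType).

Lemma posfun_comp (Phi : (T -> \bar R) -> \bar R) (X : T -> S) (g : T -> R) :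
  posfun Phi -> measurable_fun setT X -> (forall x, (0 <= g x)%R) ->
  measurable_fun setT g ->
  posfun (fun f : S -> \bar R => Phi (fun x => (g x)%:E * f (X x))).
Proof.
move=> h mX g0 mg.
have mgf (f : S -> \bar R) : measurable_fun setT f ->
    measurable_fun setT (fun x => (g x)%:E * f (X x)).
  move=> mf; apply: emeasurable_funM; first exact/measurable_EFinP.
  exact: measurableT_comp.
have gf0 (f : S -> \bar R) : (forall x, 0 <= f x) -> forall x, 0 <= (g x)%:E * f (X x).
  by move=> f0 x; apply: mule_ge0 => //; rewrite lee_fin.
split.
- by move=> f f0 mf; apply: (posfun_ge0 h); [exact: gf0|exact: mgf].
- move=> f1 f2 f10 mf1 f20 mf2; rewrite -(posfunD h); [|exact: gf0|exact: mgf|exact: gf0|exact: mgf].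
  by congr Phi; apply/funext => x; rewrite ge0_muleDr.
- move=> k f k0 f0 mf; rewrite -(posfunZ h)//; [|exact: gf0|exact: mgf].
  by congr Phi; apply/funext => x; rewrite muleCA.
- move=> f_ f f0 mf nd cf; apply: (posfun_cvg h).
  + by move=> n; exact: gf0.
  + by move=> n; exact: mgf.
  + by move=> x m n mn; apply: lee_wpmul2l; [rewrite lee_fin|exact: nd].
  + by move=> x; apply: cvgeZl.
Qed.

Lemma posfun_pull (Phi : (T -> \bar R) -> \bar R) (X : T -> S) :
  posfun Phi -> measurable_fun setT X ->
  posfun (fun f : S -> \bar R => Phi (fun x => f (X x))).
Proof.
move=> h mX.
have := posfun_comp h mX (g := fun=> 1%R) (fun=> ler01) (measurable_cst _).
congr posfun; apply/funext => f; congr Phi; apply/funext => x.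
by rewrite mul1e.
Qed.

Lemma integral_indic_prob (P : probability T R) (A : set T) : measurable A ->
  \int[P]_x (\1_A x)%:E = P A.
Proof. by move=> mA; rewrite integral_indic// setIT. Qed.

Lemma measurable_kernel_integral (kappa : T -> probability S R) (f : S -> \bar R) :
  (forall B, measurable B -> measurable_fun setT (fun u => kappa u B : \bar R)) ->
  (forall x, 0 <= f x) -> measurable_fun setT f ->
  measurable_fun setT (fun u => \int[kappa u]_y f y).
Proof.
move=> mk f0 mf.
have mk' : measurable_fun setT (kappa : T -> giry S R).
  exact: measurable_giry_codensity.
exact: (measurableT_comp (measurable_giry_int mf f0) mk').
Qed.

Lemma posfun_kernel (Phi : (T -> \bar R) -> \bar R) (kappa : T -> probability S R) :
  posfun Phi ->
  (forall B, measurable B -> measurable_fun setT (fun u => kappa u B : \bar R)) ->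
  posfun (fun f : S -> \bar R => Phi (fun x => \int[kappa x]_y f y)).
Proof.
move=> h mk; have K x := posfun_integral (kappa x) measurableT.
split.
- move=> f f0 mf; apply: (posfun_ge0 h); first by move=> x; exact: integral_ge0.
  exact: measurable_kernel_integral.
- move=> f1 f2 f10 mf1 f20 mf2; rewrite -(posfunD h); last first.
  + exact: measurable_kernel_integral.
  + by move=> x; exact: integral_ge0.
  + exact: measurable_kernel_integral.
  + by move=> x; exact: integral_ge0.
  by congr Phi; apply/funext => x; rewrite (posfunD (K x)).
- move=> k f k0 f0 mf; rewrite -(posfunZ h)//; last first.
  + exact: measurable_kernel_integral.
  + by move=> x; exact: integral_ge0.
  by congr Phi; apply/funext => x; rewrite (posfunZ (K x)).
- move=> f_ f f0 mf nd cf; apply: (posfun_cvg h).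
  + by move=> n x; exact: integral_ge0.
  + by move=> n; exact: measurable_kernel_integral.
  + by move=> x m n mn; apply: ge0_le_integral => // y _; exact: nd y _ _ mn.
  + by move=> x; exact: (posfun_cvg (K x)).
Qed.

End posfun_integral.

(* [R] and [measurableTypeR R] have the same measurable sets but distinct displays. *)
Lemma posfun_lebesgue (R : realType) (D : set R) : measurable D ->
  posfun (fun f : R -> \bar R => \int[lebesgue_measure]_(x in D) f x)%E.
Proof.
move=> mD; have mD' : measurable (D : set (measurableTypeR R)) by [].
have [h1 h2 h3 h4] := @posfun_integral _ _ R (@lebesgue_measure R) D mD'.
by split; [exact: h1|exact: h2|exact: h3|exact: h4].
Qed.

Lemma measurable_invr (R : realType) : measurable_fun setT (fun x : R => x^-1).
Proof.
(* The inverse is expressed through a measurable power function; at x = 0 both sides vanish, since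
   the inverse of 0 is 0. *)
rewrite (_ : (fun _ => _) = fun x : R => x * (`|x| `^ (- 1)) ^+ 2).
  apply: measurable_funM => //; apply: measurable_funX.
  by apply: (measurableT_comp (measurable_powR _)).
apply/funext => x; rewrite powR_inv1// exprVn real_normK ?num_real//.
have [->|x0] := eqVneq x 0; first by rewrite mul0r invr0.
by rewrite expr2 invfM mulrA divff// mul1r.
Qed.

Lemma measurable_lt_set d (T : measurableType d) (R : realType) (f g : T -> R) :
  measurable_fun setT f -> measurable_fun setT g -> measurable [set x | f x < g x].
Proof.
move=> mf mg; rewrite (_ : [set x | _] = setT `&` (fun x => g x - f x) @^-1` `]0, +oo[).
  by apply: (measurable_funB mg mf) => //; exact: measurable_itv.
by apply/seteqP; split => x /=; rewrite in_itv/= andbT subr_gt0// => -[].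
Qed.

Lemma measurable_le_set d (T : measurableType d) (R : realType) (f g : T -> R) :
  measurable_fun setT f -> measurable_fun setT g -> measurable [set x | f x <= g x].
Proof.
move=> mf mg; rewrite (_ : [set x | _] = ~` [set x | g x < f x]).
  by apply: measurableC; exact: measurable_lt_set.
by apply/seteqP; split => x /=; rewrite leNgt => /negP.
Qed.

(** * Sequences with the cylinder sigma-algebra *)

Section sequences.
Context {R : realType}.

Definition cylinder (n : nat) (A : nat -> set R) : set (nat -> R) :=
  [set x | forall i, (i < n)%N -> A i (x i)].

Definition cylinders : set (set (nat -> R)) :=
  [set C | exists n A, (forall i, measurable (A i)) /\ C = cylinder n A].

(** The generating cylinders are exactly the events compared in [same_law], and they form a
    pi-system. *)
Definition seqR : Type := g_sigma_algebraType cylinders.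
HB.instance Definition _ := Measurable.on seqR.

Lemma measurable_seqRE : @measurable _ seqR = <<s cylinders >>.
Proof. by []. Qed.

Lemma cylinders_setI : setI_closed cylinders.
Proof.
move=> _ _ [n [A [mA ->]]] [m [B [mB ->]]].
exists (maxn n m), (fun i => (if (i < n)%N then A i else setT) `&`
  (if (i < m)%N then B i else setT)); split.
  by move=> i; apply: measurableI; case: ifP.
apply/seteqP; split => x /=.
  by move=> [Ax Bx] i _; split; case: ifP => // ?; [exact: Ax|exact: Bx].
move=> h; split=> i im.
  by have := h i; rewrite leq_max im => /(_ isT)[].
by have := h i; rewrite leq_max im orbT => /(_ isT)[].
Qed.

Lemma cylinders_setT : cylinders setT.
Proof. by exists 0%N, (fun=> setT); split => //; apply/seteqP; split. Qed.

Lemma measurable_cylinder n A : (forall i, measurable (A i)) ->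
  measurable (cylinder n A : set seqR).
Proof. by move=> mA; apply: sub_sigma_algebra; exists n, A. Qed.

Lemma measurable_coord j : measurable_fun setT (fun x : seqR => x j).
Proof.
move=> _ B mB; rewrite setTI.
rewrite (_ : _ @^-1` _ = cylinder j.+1 (fun i => if i == j then B else setT)).
  by apply: measurable_cylinder => i; case: ifP.
apply/seteqP; split => x /=; first by move=> Bx i _; case: eqP => // ->.
by move=> /(_ j (ltnSn j)); rewrite eqxx.
Qed.

Lemma measurable_seqR d (T : measurableType d) (X : T -> seqR) :
  (forall j, measurable_fun setT (fun o => X o j)) -> measurable_fun setT X.
Proof.
move=> mX; apply: (@measurability _ _ T seqR setT X cylinders measurable_seqRE) => _ [_ [n [A [mA ->]]] <-].
rewrite setTI (_ : _ @^-1` _ =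
    \bigcap_(i in `I_n) ((fun o => X o i) @^-1` A i)); last first.
  by apply/seteqP; split.
apply: bigcap_measurableType => // i _.
by rewrite -[X in measurable X]setTI; exact: mX.
Qed.

Lemma seqR_unique (Phi Psi : (seqR -> \bar R) -> \bar R) :
  posfun Phi -> posfun Psi -> (Phi (fun=> 1%E) < +oo)%E ->
  (forall n A, (forall i, measurable (A i)) ->
    Phi (fun x => (\1_(cylinder n A) x)%:E) =
    Psi (fun x => (\1_(cylinder n A) x)%:E)) ->
  forall f, (forall x, 0 <= f x)%E -> measurable_fun setT f -> Phi f = Psi f.
Proof.
move=> hPhi hPsi Phi1 h; apply: (posfun_unique hPhi hPsi measurable_seqRE) => //.
- exact: cylinders_setI.
- exact: cylinders_setT.
- by move=> _ [n [A [mA ->]]]; exact: h.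
Qed.

End sequences.
Arguments seqR R : clear implicits.

(** * Determination by moments *)

Section moments.
Context {R : realType}.

(** The projection of the line onto [0, 1], written with absolute values so that continuity and the
    Lipschitz bound are immediate. It makes the moments of every law on the line well defined and
    bounded. *)
Definition clamp (x : R) : R := (1 + `|x| - `|x - 1|) / 2.

Lemma clamp_ge0 x : 0 <= clamp x.
Proof. by rewrite /clamp; case: (ger0P x) => ?; case: (ger0P (x - 1)) => ?; lra. Qed.

Lemma clamp_le1 x : clamp x <= 1.
Proof. by rewrite /clamp; case: (ger0P x) => ?; case: (ger0P (x - 1)) => ?; lra. Qed.

Lemma clamp_id x : 0 <= x <= 1 -> clamp x = x.
Proof. by move=> /andP[? ?]; rewrite /clamp; case: (ger0P x) => ?; case: (ger0P (x - 1)) => ?; lra. Qed.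

Lemma clamp_eq0 x : x <= 0 -> clamp x = 0.
Proof. by move=> ?; rewrite /clamp; case: (ger0P x) => ?; case: (ger0P (x - 1)) => ?; lra. Qed.

Lemma clamp_eq1 x : 1 <= x -> clamp x = 1.
Proof. by move=> ?; rewrite /clamp; case: (ger0P x) => ?; case: (ger0P (x - 1)) => ?; lra. Qed.

Lemma clamp_le x y : x <= y -> clamp x <= clamp y.
Proof.
by move=> xy; rewrite /clamp; case: (ger0P x) => ?; case: (ger0P (x - 1)) => ?;
  case: (ger0P y) => ?; case: (ger0P (y - 1)) => ?; lra.
Qed.

Lemma clamp_lipschitz x y : `|clamp x - clamp y| <= `|x - y|.
Proof.
rewrite /clamp; have := ler_dist_dist x y.
have := ler_dist_dist (x - 1) (y - 1); rewrite (_ : x - 1 - (y - 1) = x - y); last by ring.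
rewrite !ler_norml => /andP[? ?] /andP[? ?]; apply/andP; split; lra.
Qed.

Lemma clamp_continuous : continuous clamp.
Proof.
move=> x; apply: cvgM; last exact: cvg_cst.
apply: cvgB; first by apply: cvgD; [exact: cvg_cst|exact: cvg_norm].
by apply: cvg_norm; apply: cvgB; [exact: cvg_id|exact: cvg_cst].
Qed.

Lemma measurable_clamp : measurable_fun setT clamp.
Proof. exact: continuous_measurable_fun clamp_continuous. Qed.

(* The expectation of [g] under the binomial law of size [n] and parameter [x];
   as a function of [x], a Bernstein polynomial. *)
Fixpoint bernstein n (g : nat -> R) (x : R) : R :=
  if n is n'.+1 then x * bernstein n' (g \o S) x + (1 - x) * bernstein n' g x
  else g 0%N.

Lemma bernstein_affine n (a b : R) g x :
  bernstein n (fun k => a + b * g k) x = a + b * bernstein n g x.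
Proof. by elim: n g => [//|n IHn] g /=; rewrite /comp !IHn /comp; ring. Qed.

Lemma bernstein_le n g h x : 0 <= x <= 1 -> (forall k, g k <= h k) ->
  bernstein n g x <= bernstein n h x.
Proof.
move=> /andP[x0 x1]; elim: n g h => [|n IHn] g h gh //=.
by apply: lerD; apply: ler_wpM2l; rewrite ?subr_ge0//; apply: IHn => k /=.
Qed.

Lemma bernstein_ge0 n g x : 0 <= x <= 1 -> (forall k, 0 <= g k) ->
  0 <= bernstein n g x.
Proof.
move=> /andP[x0 x1]; elim: n g => [|n IHn] g g0 //=.
by apply: addr_ge0; apply: mulr_ge0; rewrite ?subr_ge0//; apply: IHn => k /=.
Qed.

Lemma measurable_bernstein n g :
  measurable_fun setT (fun x => bernstein n g (clamp x)).
Proof.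
elim: n g => [|n IH] g; first exact: measurable_cst.
apply: measurable_funD; apply: measurable_funM => //; first exact: measurable_clamp.
by apply: measurable_funB => //; exact: measurable_clamp.
Qed.

(** Variance plus squared bias of a binomial variable about the point y. *)
Lemma bernstein_sqr n (y x : R) :
  bernstein n (fun k => (k%:R - y) ^+ 2) x = n%:R * x * (1 - x) + (n%:R * x - y) ^+ 2.
Proof.
elim: n y => [|n IHn] y /=; first by ring.
rewrite IHn (_ : _ \o S = fun k => (k%:R - (y - 1)) ^+ 2) ?IHn; last first.
  by apply/funext => k /=; rewrite -natr1; ring.
by rewrite -natr1; ring.
Qed.

Lemma bernstein_approx (f : R -> R) (L e x : R) n : 0 < L -> 0 < e ->
  (forall x y, `|f x - f y| <= L * `|x - y|) -> 0 <= x <= 1 ->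
  (L / e) ^+ 2 <= n.+1%:R ->
  `|bernstein n.+1 (fun k => f (k%:R / n.+1%:R)) x - f x| <= e.
Proof.
move=> L0 e0 fL x01 Ln; set N := n.+1%:R in Ln *.
have N0 : 0 < N by rewrite /N ltr0n.
(* [b] is L^2 / (2 e N^2), so that L |k/N - x| <= e/2 + b (k - N x)^2 by the inequality of means.
   The binomial variance N x (1 - x) then makes the second term at most e/2 as soon as N >=
   (L/e)^2. *)
pose b := L / (2 * N ^+ 2 * (e / L)).
have b0 : 0 < b.
  apply: divr_gt0 => //; apply: mulr_gt0; last exact: divr_gt0.
  by apply: mulr_gt0 => //; exact: exprn_gt0.
have key k : `|f (k%:R / N) - f x| <= e / 2 + b * (k%:R - N * x) ^+ 2.
  apply: (le_trans (fL _ _)).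
  set y := `|_|; have y2 : y ^+ 2 = (k%:R - N * x) ^+ 2 / N ^+ 2.
    rewrite /y real_normK ?num_real//; field; exact: lt0r_neq0.
  have -> : b * (k%:R - N * x) ^+ 2 = L ^+ 2 / (2 * e) * y ^+ 2.
    by rewrite y2 /b; field; rewrite !lt0r_neq0.
  have : 0 <= (L * y - e) ^+ 2 / (2 * e).
    by rewrite divr_ge0 ?sqr_ge0 ?mulr_ge0 ?ltW.
  have -> : (L * y - e) ^+ 2 / (2 * e) = L ^+ 2 / (2 * e) * y ^+ 2 - L * y + e / 2.
    by field; rewrite lt0r_neq0.
  by move=> ?; lra.
have bE : b * (N * x * (1 - x)) <= e / 2.
  have xx : x * (1 - x) <= 1 by case/andP: x01 => ? ?; nra.
  have xx0 : 0 <= x * (1 - x) by case/andP: x01 => ? ?; nra.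
  apply: (@le_trans _ _ (b * N)).
    rewrite -mulrA ler_wpM2l// ?(ltW b0)// ler_piMr// ltW//.
  have -> : b * N = (L / e) ^+ 2 * (e / 2) / N.
    by rewrite /b; field; rewrite !lt0r_neq0.
  by rewrite ler_pdivrMr// mulrC ler_wpM2l// divr_ge0// ltW.
have sq : bernstein n.+1 (fun k => (k%:R - N * x) ^+ 2) x = N * x * (1 - x).
  by rewrite bernstein_sqr subrr expr0n addr0.
have up := @bernstein_le n.+1 (fun k => f (k%:R / N))
  (fun k => (f x + e / 2) + b * (k%:R - N * x) ^+ 2) x x01.
have lo := @bernstein_le n.+1 
  (fun k => (f x - e / 2) + (- b) * (k%:R - N * x) ^+ 2) (fun k => f (k%:R / N)) x x01.
rewrite !bernstein_affine !sq in up lo.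
have {}up : bernstein n.+1 (fun k => f (k%:R / N)) x <= f x + e / 2 + b * (N * x * (1 - x)).
  by apply: up => k; have := key k; rewrite ler_norml => /andP[? ?]; lra.
have {}lo : f x - e / 2 + - b * (N * x * (1 - x)) <= bernstein n.+1 (fun k => f (k%:R / N)) x.
  by apply: lo => k; have := key k; rewrite ler_norml => /andP[? ?]; lra.
by rewrite ler_norml; apply/andP; split; lra.
Qed.

End moments.

Section moments_unique.
Local Open Scope ereal_scope.
Context {R : realType}.

Lemma posfun_le d (T : measurableType d) (Phi : (T -> \bar R) -> \bar R)
    (f g : T -> R) : posfun Phi ->
  measurable_fun setT f -> measurable_fun setT g ->
  (forall x, 0 <= f x <= g x)%R ->
  Phi (fun x => (f x)%:E) <= Phi (fun x => (g x)%:E).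
Proof.
move=> h mf mg fg.
have f0 x : (0 <= f x)%R by have /andP[] := fg x.
have gf0 x : (0 <= g x - f x)%R by rewrite subr_ge0; have /andP[] := fg x.
rewrite (_ : (fun x => (g x)%:E) = fun x => (f x)%:E + (g x - f x)%:E); last first.
  by apply/funext => x; rewrite -EFinD addrC subrK.
have mfE : measurable_fun setT (fun x => (f x)%:E) by exact/measurable_EFinP.
have mgfE : measurable_fun setT (fun x => (g x - f x)%:E).
  by apply/measurable_EFinP; exact: measurable_funB.
rewrite posfunD// leeDl//.
by apply: (posfun_ge0 h).
Qed.

(** Open rays are stable under intersection and generate the Borel sets; the whole line is not a
    ray, hence the separate comparison of the total masses. *)
Lemma posfun_unique_ray (Phi Psi : (R -> \bar R) -> \bar R) :
  posfun Phi -> posfun Psi -> Phi (fun=> 1) < +oo -> Phi (fun=> 1) = Psi (fun=> 1) ->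
  (forall t, Phi (fun x => (\1_(`]t, +oo[%classic : set R) x)%:E) =
             Psi (fun x => (\1_(`]t, +oo[%classic : set R) x)%:E)) ->
  forall f, (forall x, 0 <= f x) -> measurable_fun setT f -> Phi f = Psi f.
Proof.
move=> hPhi hPsi Phi1 PP1 PP.
pose G : set (set R) := [set A | A = setT \/ exists t, A = `]t, +oo[%classic].
apply: (posfun_unique (G := G) hPhi hPsi) => //.
- rewrite [LHS]RGenOInfty.measurableE; apply/seteqP; split.
    by apply: sub_smallest2r; [exact: smallest_sigma_algebra|move=> _ [t ->]; right; exists t].
  apply: smallest_sub; first exact: smallest_sigma_algebra.
  move=> _ [->|[t ->]]; first exact: (@measurableT _ (g_sigma_algebraType (RGenOInfty.G (R:=R)))).
  by apply: sub_sigma_algebra; exists t.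
- move=> A B [->|[t ->]] [->|[u ->]]; rewrite ?setIT ?setTI; [by left|by right; exists u|by right; exists t|].
  right; exists (Num.max t u); apply/seteqP; split => x /=; rewrite !in_itv/= !andbT gt_max.
    by move=> [-> ->].
  by move=> /andP[].
- by left.
by move=> _ [->|[t ->//]]; under eq_fun do rewrite indicT.
Qed.

Variables Phi Psi : (R -> \bar R) -> \bar R.
Hypotheses (hPhi : posfun Phi) (hPsi : posfun Psi).
Hypothesis Phi1 : Phi (fun=> 1) < +oo.
Hypothesis mom : forall l,
  Phi (fun x => ((1 - clamp x) ^+ l)%:E) = Psi (fun x => ((1 - clamp x) ^+ l)%:E).

Let m i j (x : R) : R := ((clamp x) ^+ i * (1 - clamp x) ^+ j)%R.

Let mm i j : measurable_fun setT (m i j).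
Proof.
apply: measurable_funM; apply: measurable_funX; first exact: measurable_clamp.
by apply: measurable_funB => //; exact: measurable_clamp.
Qed.

Let c01 (x : R) : (0 <= clamp x)%R /\ (0 <= 1 - clamp x)%R.
Proof. by rewrite subr_ge0 clamp_ge0 clamp_le1. Qed.

Let m01 i j x : (0 <= m i j x <= 1)%R.
Proof.
have [x0 x1] := c01 x.
rewrite mulr_ge0 ?exprn_ge0//= mulr_ile1 ?exprn_ge0//; apply: exprn_ile1 => //.
  exact: clamp_le1.
by rewrite gerBl.
Qed.

Let Psi1 : Psi (fun=> 1) < +oo.
Proof.
have := mom 0; rewrite (_ : (fun _ => _) = fun=> 1); last first.
  by apply/funext => x; rewrite expr0.
by move=> <-.
Qed.

Let fin (P : (R -> \bar R) -> \bar R) (f : R -> R) : posfun P -> P (fun=> 1) < +oo ->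
  measurable_fun setT f -> (forall x, (0 <= f x <= 1)%R) ->
  P (fun x => (f x)%:E) \is a fin_num.
Proof.
move=> hP P1 mf f01; rewrite ge0_fin_numE.
  by apply: le_lt_trans P1; exact: posfun_le.
apply: (posfun_ge0 hP); last exact/measurable_EFinP.
by move=> x; rewrite lee_fin; have /andP[] := f01 x.
Qed.

(** With y = 1 - x, the relation x^i y^j = x^(i+1) y^j + x^i y^(j+1) raises the exponent of x by
    one; finiteness of the moments allows the cancellation. *)
Lemma mixed_moments i j :
  Phi (fun x => ((clamp x) ^+ i * (1 - clamp x) ^+ j)%:E) =
  Psi (fun x => ((clamp x) ^+ i * (1 - clamp x) ^+ j)%:E).
Proof.
elim: i j => [|i IHi] j.
  by under eq_fun do rewrite expr0 mul1r; rewrite mom.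
have E (P : (R -> \bar R) -> \bar R) : posfun P ->
    P (fun x => (m i j x)%:E) = P (fun x => (m i.+1 j x)%:E) + P (fun x => (m i j.+1 x)%:E).
  move=> hP; rewrite -(posfunD hP); last 4 first.
  - by move=> x; rewrite lee_fin; have /andP[] := m01 i.+1 j x.
  - exact/measurable_EFinP.
  - by move=> x; rewrite lee_fin; have /andP[] := m01 i j.+1 x.
  - exact/measurable_EFinP.
  by congr P; apply/funext => x; rewrite -EFinD /m !exprS; congr EFin; ring.
have Phif := fin hPhi Phi1 (mm i j.+1) (m01 i j.+1).
have := IHi j; rewrite -/(m i j) (E _ hPhi) (E _ hPsi).
rewrite -[Psi (fun x => (m i j.+1 x)%:E)](IHi j.+1) -/(m i j.+1).
move=> /(congr1 (fun z => z - Phi (fun x => (m i j.+1 x)%:E))).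
by rewrite !addeK.
Qed.

(** The factor x^i (1 - x)^j strengthens the induction: each unfolding of [bernstein] produces one
    more x or 1 - x. *)
Lemma bernstein_moments n (g : nat -> R) i j : (forall k, 0 <= g k)%R ->
  Phi (fun x => ((clamp x) ^+ i * (1 - clamp x) ^+ j * bernstein n g (clamp x))%:E) =
  Psi (fun x => ((clamp x) ^+ i * (1 - clamp x) ^+ j * bernstein n g (clamp x))%:E).
Proof.
elim: n g i j => [|n IHn] g i j g0 /=.
  have E (P : (R -> \bar R) -> \bar R) : posfun P ->
      P (fun x => (m i j x * g 0%N)%:E) = (g 0%N)%:E * P (fun x => (m i j x)%:E).
    move=> hP; rewrite -(posfunZ hP)//; last 2 first.
    - by move=> x; rewrite lee_fin; have /andP[] := m01 i j x.
    - exact/measurable_EFinP.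
    by congr P; apply/funext => x; rewrite -EFinM mulrC.
  by rewrite (E _ hPhi) (E _ hPsi); congr (_ * _); exact: mixed_moments.
have b0 g' x : (forall k, 0 <= g' k)%R -> (0 <= bernstein n g' (clamp x))%R.
  by move=> g'0; apply: bernstein_ge0 => //; rewrite clamp_ge0 clamp_le1.
have mb := measurable_bernstein n.
have E (P : (R -> \bar R) -> \bar R) : posfun P ->
    P (fun x => (m i j x * (clamp x * bernstein n (g \o S) (clamp x) +
                    (1 - clamp x) * bernstein n g (clamp x)))%:E) =
    P (fun x => (m i.+1 j x * bernstein n (g \o S) (clamp x))%:E) +
    P (fun x => (m i j.+1 x * bernstein n g (clamp x))%:E).
  move=> hP; rewrite -(posfunD hP).
  - by congr P; apply/funext => x; rewrite -EFinD /m !exprS; congr EFin; ring.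
  - move=> x; rewrite lee_fin mulr_ge0//; first by have /andP[] := m01 i.+1 j x.
    by apply: b0 => k /=.
  - by apply/measurable_EFinP; apply: measurable_funM; [exact: mm|exact: mb].
  - move=> x; rewrite lee_fin mulr_ge0//; first by have /andP[] := m01 i j.+1 x.
    exact: b0.
  - by apply/measurable_EFinP; apply: measurable_funM; [exact: mm|exact: mb].
by rewrite (E _ hPhi) (E _ hPsi) IHn ?IHn// => k /=.
Qed.

Let Phi1E : Phi (fun=> 1) = Psi (fun=> 1).
Proof.
by have := mom 0; rewrite (_ : (fun _ => _) = fun=> 1)//; apply/funext => x; rewrite expr0.
Qed.

Let moments_lipschitz_le (P Q : (R -> \bar R) -> \bar R) (f : R -> R) (L : R) :
  posfun P -> posfun Q -> P (fun=> 1) < +oo -> P (fun=> 1) = Q (fun=> 1) ->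
  (forall n (g : nat -> R), (forall k, 0 <= g k)%R ->
    P (fun x => (bernstein n g (clamp x))%:E) = Q (fun x => (bernstein n g (clamp x))%:E)) ->
  (0 < L)%R -> measurable_fun setT f ->
  (forall x y, `|f x - f y| <= L * `|x - y|)%R -> (forall x, 0 <= f x)%R ->
  P (fun x => (f (clamp x))%:E) <= Q (fun x => (f (clamp x))%:E).
Proof.
move=> hP hQ P1 PQ1 PQ L0 mf fL f0.
have m1 : measurable_fun [set: R] (fun=> 1 : \bar R) by exact: measurable_cst.
have P1f : P (fun=> 1) \is a fin_num by rewrite ge0_fin_numE//; exact: (posfun_ge0 hP).
set M := fine (P (fun=> 1)); have PM : P (fun=> 1) = M%:E by rewrite /M fineK.
have M0 : (0 <= M)%R by rewrite -lee_fin -PM; exact: (posfun_ge0 hP).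
suff : forall e : R, (0 < e)%R ->
    P (fun x => (f (clamp x))%:E) <= Q (fun x => (f (clamp x))%:E) + e%:E.
  by move=> h; apply/lee_addgt0Pr.
(* The Bernstein error is paid twice against a total mass [M], so the loss is 2 M e'; the added 1
   covers M = 0. *)
move=> e e0; pose e' := (e / (2 * M + 1))%R.
have e'0 : (0 < e')%R by rewrite divr_gt0//; lra.
have [n nL] : exists n, ((L / e') ^+ 2 <= n.+1%:R)%R.
  exists (Num.truncn ((L / e') ^+ 2)); apply: ltW; exact: truncnS_gt.
pose g k := f (k%:R / n.+1%:R)%R.
pose B x := bernstein n.+1 g (clamp x).
have c01' (x : R) : (0 <= clamp x <= 1)%R by rewrite clamp_ge0 clamp_le1.
have BE x : (`|B x - f (clamp x)| <= e')%R by exact: (bernstein_approx L0 e'0 fL (c01' x) nL).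
have B0 x : (0 <= B x)%R by apply: bernstein_ge0 => // k; exact: f0.
have mB : measurable_fun setT B by exact: measurable_bernstein.
have mfc : measurable_fun setT (f \o clamp) by exact: measurableT_comp mf measurable_clamp.
have cst (Z : (R -> \bar R) -> \bar R) (h : R -> R) : posfun Z -> Z (fun=> 1) = M%:E ->
    measurable_fun setT h -> (forall x, 0 <= h x)%R ->
    Z (fun x => (h x + e')%:E) = Z (fun x => (h x)%:E) + (e' * M)%:E.
  move=> hZ ZM mh h0; rewrite EFinM -ZM -(posfunZ hZ (ltW e'0) (fun=> lee01) m1) -(posfunD hZ)//.
  - by congr Z; apply/funext => x; rewrite mule1.
  - exact/measurable_EFinP.
  - by move=> x; rewrite mule1 lee_fin ltW.
apply: (@le_trans _ _ (P (fun x => (B x + e')%:E))).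
  apply: (posfun_le hP) => //; first by apply: measurable_funD.
  by move=> x; rewrite f0/=; have := BE x; rewrite ler_norml => /andP[? ?]; lra.
rewrite cst// PQ; last by move=> k; exact: f0.
apply: (@le_trans _ _ (Q (fun x => (f (clamp x) + e')%:E) + (e' * M)%:E)).
  apply: leeD => //; apply: (posfun_le hQ) => //; first by apply: measurable_funD.
  move=> x; apply/andP; split; first exact: B0.
  by rewrite -[leLHS]/(B x); have := BE x; rewrite ler_norml => /andP[? ?]; lra.
have QM : Q (fun=> 1) = M%:E by rewrite -PQ1.
rewrite (cst Q (f \o clamp) hQ QM mfc (fun x => f0 _)).
rewrite -addeA leeD2l// -EFinD lee_fin.
rewrite (_ : _ + _ = e' * (2 * M))%R; last by ring.
rewrite -[leRHS](divfK (x := (2 * M + 1)%R)); last by apply/eqP; lra.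
by rewrite ler_wpM2l// ?ltW//; lra.
Qed.

Lemma moments_lipschitz (f : R -> R) (L : R) : (0 < L)%R -> measurable_fun setT f ->
  (forall x y, `|f x - f y| <= L * `|x - y|)%R -> (forall x, 0 <= f x)%R ->
  Phi (fun x => (f (clamp x))%:E) = Psi (fun x => (f (clamp x))%:E).
Proof.
move=> L0 mf fL f0.
have PQ n (g : nat -> R) : (forall k, 0 <= g k)%R ->
    Phi (fun x => (bernstein n g (clamp x))%:E) = Psi (fun x => (bernstein n g (clamp x))%:E).
  move=> g0; have := bernstein_moments n 0 0 g0.
  by under eq_fun do rewrite !expr0 !mul1r.
apply/eqP; rewrite eq_le; apply/andP; split.
  exact: (moments_lipschitz_le hPhi hPsi Phi1 Phi1E PQ L0 mf fL f0).
apply: (moments_lipschitz_le hPsi hPhi Psi1 (esym Phi1E) _ L0 mf fL f0).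
by move=> n g g0; rewrite PQ.
Qed.

(** The conclusion composes [f] with [clamp] because the moments only see the image of each
    functional on [0, 1]. *)
Lemma moments_unique (f : R -> \bar R) : (forall x, 0 <= f x) ->
  measurable_fun setT f ->
  Phi (fun x => f (clamp x)) = Psi (fun x => f (clamp x)).
Proof.
move=> f0 mf.
have cE (P : (R -> \bar R) -> \bar R) : posfun P -> posfun (fun f => P (fun x => f (clamp x))).
  move=> hP; have := posfun_comp hP measurable_clamp (g := fun=> 1%R) (fun=> ler01) (measurable_cst _).
  by under eq_fun do under eq_fun do rewrite mul1e.
apply: (posfun_unique_ray (cE _ hPhi) (cE _ hPsi)) f0 mf => // t.
(* Ramps of slope n + 1 that increase to the indicator of the open ray, the Lipschitz case being
   settled. *)
pose h n x := clamp (n.+1%:R * (x - t)).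
have mh n : measurable_fun setT (h n).
  apply: (measurableT_comp measurable_clamp); apply: measurable_funM => //.
  exact: measurable_funB.
have E (P : (R -> \bar R) -> \bar R) : posfun P ->
    P (fun x => (h n (clamp x))%:E) @[n --> \oo] --> P (fun x => (\1_(`]t, +oo[) (clamp x))%:E).
  move=> hP; apply: (posfun_cvg hP).
  - by move=> n x; rewrite lee_fin clamp_ge0.
  - by move=> n; apply/measurable_EFinP; exact: measurableT_comp (mh n) measurable_clamp.
  - move=> x a b ab; rewrite lee_fin; have [xt|xt] := leP (clamp x) t.
      by rewrite /h !(@clamp_eq0 _ (_ * _))%R//; apply: mulr_ge0_le0; rewrite ?subr_le0.
    by apply: clamp_le; rewrite ler_wpM2r// ?ler_nat// subr_ge0 ltW.
  move=> x; apply: cvg_EFin; first by apply: nearW.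
  have [xt|xt] := leP (clamp x) t.
    rewrite indicE memNset; last by rewrite /= in_itv/= andbT ltNge xt.
    rewrite (_ : _ \o _ = fun=> 0%R); first exact: cvg_cst.
    by apply/funext => n /=; rewrite /h (@clamp_eq0 _ (_ * _))%R//; apply: mulr_ge0_le0; rewrite ?subr_le0.
  rewrite indicE mem_set/=; last by rewrite in_itv/= andbT.
  apply: cvg_near_cst.
  exists (Num.truncn (1 / (clamp x - t))%R) => // n /= nt.
  apply: clamp_eq1; rewrite -ler_pdivrMr ?subr_gt0//.
  apply: (le_trans (ltW (truncnS_gt _))); by rewrite ler_nat.
have /cvg_lim <- // := E _ hPhi; have /cvg_lim <- // := E _ hPsi.
apply: congr_lim; apply/funext => n.
apply: (@moments_lipschitz (h n) n.+1%:R) => //.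
  move=> x y; apply: (le_trans (clamp_lipschitz _ _)).
  rewrite -mulrBr normrM ger0_norm//; rewrite ler_wpM2l//.
  by rewrite (_ : x - t - (y - t) = x - y)%R//; ring.
by move=> x; exact: clamp_ge0.
Qed.

End moments_unique.

(** * Beta integrals *)

Section beta_integral.
Context {R : realType}.
Local Notation mu := (@lebesgue_measure R).
Implicit Types a b x : R.

Lemma is_derive_powR p x : 0 < x ->
  is_derive x 1 (fun y => y `^ p) (p * x `^ (p - 1)).
Proof.
move=> x0; have x0' : x \in `]0, +oo[ by rewrite in_itv/= x0.
apply: DeriveDef; first exact: derivable_powR.
by rewrite -derive1E powR_derive1.
Qed.

Lemma is_derive_powR_onem p x : x < 1 ->
  is_derive x 1 (fun y => (1 - y) `^ p) (- (p * (1 - x) `^ (p - 1))).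
Proof.
move=> x1; have d1 : is_derive x 1 (fun y : R => 1 - y) (- 1).
  by rewrite -[X in is_derive _ _ _ X]add0r; apply: is_deriveD.
have x1' : 0 < 1 - x by rewrite subr_gt0.
have := @is_derive1_comp R (fun y => y `^ p) (fun y => 1 - y) x _ _ (is_derive_powR p x1') d1.
by rewrite mulrN1.
Qed.

Lemma is_derive_beta a b x : 0 < x < 1 ->
  is_derive x 1 (fun y => y `^ a * (1 - y) `^ b)
    (a * (x `^ (a - 1) * (1 - x) `^ b) - b * (x `^ a * (1 - x) `^ (b - 1))).
Proof.
move=> /andP[x0 x1].
have := is_deriveM (is_derive_powR a x0) (is_derive_powR_onem b x1).
congr is_derive; rewrite /GRing.scale/=; ring.
Qed.

Lemma beta_dens_ge0 a b x : 0 <= beta_dens a b x.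
Proof. by rewrite mulr_ge0// powR_ge0. Qed.

Lemma beta_dens_gt0 a b x : 0 < x < 1 -> 0 < beta_dens a b x.
Proof. by move=> /andP[x0 x1]; rewrite mulr_gt0// powR_gt0// subr_gt0. Qed.

Lemma measurable_beta_dens a b : measurable_fun setT (beta_dens a b).
Proof.
apply: measurable_funM; first exact: measurable_powR.
apply: (measurableT_comp (measurable_powR _)) => //.
exact: measurable_funB.
Qed.

Lemma beta_dens_Sl a b x : 0 < x -> beta_dens (a + 1) b x = x * beta_dens a b x.
Proof.
move=> x0; rewrite /beta_dens (_ : a + 1 - 1 = (a - 1) + 1); last by ring.
by rewrite powRD ?lt0r_neq0 ?implybT// powRr1 ?ltW// -mulrA mulrCA.
Qed.

Lemma beta_dens_Sr a b x : x < 1 ->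
  beta_dens a (b + 1) x = (1 - x) * beta_dens a b x.
Proof.
move=> x1; have x1' : 0 < 1 - x by rewrite subr_gt0.
rewrite /beta_dens (_ : b + 1 - 1 = (b - 1) + 1); last by ring.
by rewrite [(1 - x) `^ _]powRD ?lt0r_neq0 ?implybT// powRr1 ?ltW//; ring.
Qed.

Definition beta_int a b : \bar R := (\int[mu]_(x in `]0%R, 1%R[) (beta_dens a b x)%:E)%E.

Lemma beta_int_ge0 a b : (0 <= beta_int a b)%E.
Proof. by apply: integral_ge0 => x _; rewrite lee_fin beta_dens_ge0. Qed.

Let mE a b D : measurable D -> measurable_fun D (fun x => (beta_dens a b x)%:E).
Proof.
by move=> mD; apply/measurable_EFinP; apply: measurable_funTS; exact: measurable_beta_dens.
Qed.

Lemma beta_int_gt0 a b : (0 < beta_int a b)%E.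
Proof.
rewrite lt_neqAle beta_int_ge0 andbT; apply/eqP => I0.
have /ae_eq_integral_abs : measurable (`]0%R, 1%R[ : set (measurableTypeR R)).
  exact: measurable_itv.
move=> /(_ R lebesgue_measure (fun x => (beta_dens a b x)%:E) (mE a b (measurable_itv _))) [h _].
have {}h : ae_eq mu `]0, 1[%classic (fun x => (beta_dens a b x)%:E) (cst 0%E).
  apply: h; rewrite [RHS]I0; apply: eq_integral => x _.
  by rewrite gee0_abs// lee_fin beta_dens_ge0.
case: h => N [mN N0 sN].
have : (mu `]0%R, 1%R[ <= mu N)%E.
  apply: le_measure; rewrite ?inE//.
  move=> x x01; apply: sN => /= /(_ x01) [].
  apply/eqP; rewrite gt_eqF//; apply: beta_dens_gt0.
  by move: x01; rewrite /= in_itv.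
by rewrite N0 lebesgue_measure_itv/= lte_fin ltr01 oppr0 adde0 lee_fin ler10.
Qed.

Lemma beta_int_split a b :
  beta_int a b = (beta_int (a + 1) b + beta_int a (b + 1))%E.
Proof.
rewrite /beta_int -ge0_integralD//; last 4 first.
- by move=> x _; rewrite lee_fin beta_dens_ge0.
- by apply: mE; exact: measurable_itv.
- by move=> x _; rewrite lee_fin beta_dens_ge0.
- by apply: mE; exact: measurable_itv.
apply: eq_integral => x; rewrite inE/= in_itv/= => /andP[x0 x1].
by rewrite beta_dens_Sl// beta_dens_Sr// -EFinD; congr EFin; ring.
Qed.

Lemma beta_int_pos_ub a b : 0 < a -> 0 < b -> (beta_int (a + 1) (b + 1) < +oo)%E.
Proof.
move=> a0 b0; apply: (@le_lt_trans _ _ (\int[mu]_(x in `]0%R, 1%R[) cst 1 x)%E).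
  apply: ge0_le_integral => //.
  - by move=> x _; rewrite lee_fin beta_dens_ge0.
  - by apply: mE; exact: measurable_itv.
  - move=> x; rewrite /= in_itv/= => /andP[x0 x1].
    rewrite lee_fin /beta_dens !addrK mulr_ile1 ?powR_ge0//.
      rewrite -[leRHS](_ : 1 `^ a = 1); last by rewrite powR1.
      by apply: ge0_ler_powR; rewrite ?nnegrE ?ler01//; exact: ltW.
    rewrite -[leRHS](_ : 1 `^ b = 1); last by rewrite powR1.
    by apply: ge0_ler_powR; rewrite ?nnegrE ?ler01// ?subr_ge0 ?gerBl; exact: ltW.
rewrite [ltLHS](_ : _ = (1 * mu `]0%R, 1%R[)%E); last first.
  by apply: integral_cst; exact: measurable_itv.
by rewrite [X in (_ * X)%E]lebesgue_measure_itv/= lte_fin ltr01 oppr0 adde0 mul1e ltry.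
Qed.

(** Integration by parts for the primitive x^a (1 - x)^b, away from the singular endpoints; the
    terms are distributed over both sides so that no infinite values are subtracted. *)
Lemma beta_int_itv a b (e : R) : 0 < e -> e < 1 / 2 ->
  (a%:E * \int[mu]_(x in `[e, (1 - e)%R]) (beta_dens a (b + 1) x)%:E +
    (e `^ a * (1 - e) `^ b)%:E =
  b%:E * \int[mu]_(x in `[e, (1 - e)%R]) (beta_dens (a + 1) b x)%:E +
    ((1 - e) `^ a * e `^ b)%:E)%E.
Proof.
move=> e0 e1; have ee : e < 1 - e by lra.
pose F x := x `^ a * (1 - x) `^ b.
have xe x : x \in `[e, 1 - e] -> 0 < x < 1.
  by rewrite in_itv/= => /andP[? ?]; apply/andP; split; lra.
have Fd x : x \in `[e, 1 - e] -> is_derive x 1 F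
    (a * beta_dens a (b + 1) x - b * beta_dens (a + 1) b x).
  by move=> /xe x01; rewrite /beta_dens !addrK; exact: is_derive_beta.
have Fc x : x \in `[e, 1 - e] -> {for x, continuous F}.
  by move=> /Fd [dF _]; apply/differentiable_continuous; apply/derivable1_diffP.
have cb' p q x : x \in `[e, 1 - e] -> {for x, continuous (beta_dens p q)}.
  move=> /xe x01; apply/differentiable_continuous/derivable1_diffP.
  by have [] := @is_derive_beta (p - 1) (q - 1) x x01.
have cb p q : {within `[e, 1 - e], continuous (beta_dens p q)}.
  by apply: continuous_in_subspaceT => x; rewrite inE/=; exact: cb'.
have ib p q : mu.-integrable `[e, 1 - e] (EFin \o beta_dens p q).
  apply: continuous_compact_integrable; last exact: cb.
  exact: segment_compact.
have mI : measurable (`[e, 1 - e]%classic : set (measurableTypeR R)) by exact: measurable_itv.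
have fin p q : (\int[mu]_(x in `[e, (1 - e)%R]) (beta_dens p q x)%:E)%E \is a fin_num.
  by apply: integrable_fin_num => //; exact: ib.
have := @continuous_FTC2 R (fun x => a * beta_dens a (b + 1) x - b * beta_dens (a + 1) b x) F e (1 - e) ee.
have -> : F (1 - e) = (1 - e) `^ a * e `^ b by rewrite /F subKr.
rewrite -/(F e) => FTC.
have {FTC} : (\int[mu]_(x in `[e, (1 - e)%R]) (a * beta_dens a (b + 1) x - b * beta_dens (a + 1) b x)%:E = ((1 - e) `^ a * e `^ b)%:E - (F e)%:E)%E.
  apply: FTC.
  - apply: continuous_in_subspaceT => x; rewrite inE/= => xI.
    by apply: cvgB; apply: cvgM; [exact: cvg_cst|exact: cb'|exact: cvg_cst|exact: cb'].
  - split.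
    + move=> x xI; suff /Fd[] : x \in `[e, 1 - e] by [].
      exact: subset_itv_oo_cc xI.
    + by apply: cvg_at_right_filter; apply: Fc; rewrite in_itv/= lexx ltW.
    + by apply: cvg_at_left_filter; apply: Fc; rewrite in_itv/= lexx ltW.
  - move=> x xI; have /Fd[_] : x \in `[e, 1 - e] by exact: subset_itv_oo_cc xI.
    by rewrite derive1E.
under eq_integral do rewrite EFinB.
rewrite integralB_EFin//=; last 2 first.
- by have := integrableZl mI a (ib a (b + 1)); apply: eq_integrable => // x _.
- by have := integrableZl mI b (ib (a + 1) b); apply: eq_integrable => // x _.
under eq_integral do rewrite EFinM.
under [X in (_ - X)%E]eq_integral do rewrite EFinM.
rewrite !integralZl//; [|exact: ib|exact: ib].
rewrite -(fineK (fin a (b + 1))) -(fineK (fin (a + 1) b)) -!EFinM -!EFinD.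
by move=> -[h]; congr EFin; lra.
Qed.

Lemma beta_int_rec a b : 0 < a -> 0 < b ->
  (a%:E * beta_int a (b + 1) = b%:E * beta_int (a + 1) b)%E.
Proof.
(* The shift by 3 keeps [e n] below 1/2, as [beta_int_itv] requires. *)
move=> a0 b0; pose e (n : nat) : R := n.+3%:R^-1.
have e0 n : 0 < e n by rewrite invr_gt0.
have e1 n : e n < 1 / 2.
  by rewrite /e div1r ltf_pV2 ?posrE// ltr_nat.
have ecvg : e n @[n --> \oo] --> 0^'+.
  have c0 : e n @[n --> \oo] --> (0 : R).
    have := @cvg_harmonic R; rewrite -(cvg_shiftn 2); apply: cvg_trans.
    by apply: near_eq_cvg; apply: nearW => n; rewrite /e/= addn2.
  move=> A hA; have : \forall n \near \oo, 0 < e n -> A (e n) := c0 _ hA.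
  by apply: filterS => n; apply; exact: e0.
have cvgI p q : (\int[mu]_(x in `[e n, (1 - e n)%R]) (beta_dens p q x)%:E)%E @[n --> \oo] -->
    beta_int p q.
  rewrite /beta_int.
  have -> : `]0%R, 1%R[%classic = \bigcup_n `[e n, 1 - e n]%classic.
    apply/seteqP; split => x /=.
      rewrite in_itv/= => /andP[x0 x1].
      have m0 : 0 < Num.min x (1 - x) by rewrite lt_min x0 subr_gt0.
      have [n nm] : exists n : nat, (Num.min x (1 - x))^-1 < n.+3%:R.
        exists (Num.truncn (Num.min x (1 - x))^-1).
        by apply: (lt_trans (truncnS_gt _)); rewrite ltr_nat.
      exists n => //=; have : e n < Num.min x (1 - x).
        by rewrite /e -[ltRHS]invrK ltf_pV2// posrE// invr_gt0.
      by rewrite lt_min in_itv/= => /andP[? ?]; apply/andP; split; lra.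
    move=> [n _] /=; rewrite !in_itv/= => /andP[h1 h2].
    by have := e0 n => ?; apply/andP; split; lra.
  apply: ge0_nondecreasing_set_cvg_integral => //.
  - move=> m n mn; apply/subsetPset => x /=; rewrite !in_itv/= => /andP[h1 h2].
    have : e n <= e m by rewrite /e lef_pV2 ?posrE// ler_nat.
    by move=> ?; apply/andP; split; lra.
  - by move=> n; apply: mE; exact: measurable_itv.
  - by move=> n x _; rewrite lee_fin beta_dens_ge0.
have pw p : 0 < p -> e n `^ p @[n --> \oo] --> 0.
  by move=> p0; apply: (cvg_comp _ _ ecvg (powR_cvg0 p0)).
have pw2 p q : 0 < p -> 0 < q -> (1 - e n) `^ p * e n `^ q @[n --> \oo] --> 0.
  move=> p0 q0; apply: (squeeze_cvgr _ (cvg_cst _) (pw q q0)).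
  apply: nearW => n; have := e0 n; have := e1 n => ? ?.
  rewrite mulr_ge0 ?powR_ge0//= ler_piMl ?powR_ge0//.
  rewrite -[leRHS](_ : 1 `^ p = 1); last by rewrite powR1.
      apply: ge0_ler_powR; rewrite ?nnegrE//; lra.
have L : (a%:E * \int[mu]_(x in `[e n, (1 - e n)%R]) (beta_dens a (b + 1) x)%:E +
    (e n `^ a * (1 - e n) `^ b)%:E)%E @[n --> \oo] --> (a%:E * beta_int a (b + 1))%E.
  rewrite -[X in _ --> X]adde0; apply: cvgeD; [by rewrite fin_num_adde_defl|by apply: cvgeZl|].
  apply: cvg_EFin; first exact: nearW.
  by under eq_fun do rewrite /= mulrC; exact: pw2.
have Rt : (b%:E * \int[mu]_(x in `[e n, (1 - e n)%R]) (beta_dens (a + 1) b x)%:E +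
    ((1 - e n) `^ a * e n `^ b)%:E)%E @[n --> \oo] --> (b%:E * beta_int (a + 1) b)%E.
  rewrite -[X in _ --> X]adde0; apply: cvgeD; [by rewrite fin_num_adde_defl|by apply: cvgeZl|].
  by apply: cvg_EFin; [exact: nearW|exact: pw2].
rewrite -(cvg_lim (@ereal_hausdorff R) L) -(cvg_lim (@ereal_hausdorff R) Rt).
by apply: congr_lim; apply/funext => n; exact: beta_int_itv.
Qed.

(** The density may be unbounded at both ends. With both exponents raised by one it is bounded, and
    [beta_int_rec] with [beta_int_split] lower them again one at a time. *)
Lemma beta_int_fin a b : 0 < a -> 0 < b -> (beta_int a b < +oo)%E.
Proof.
move=> a0 b0.
have fin (p : R) (q : \bar R) : (0 < p)%R -> (p%:E * q < +oo)%E -> (q < +oo)%E.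
  by move=> p0; case: q => [r _||//]; [rewrite ltry|rewrite gt0_muley// lte_fin].
have h1 : (beta_int (a + 1) b < +oo)%E.
  rewrite beta_int_split; apply: lte_add_pinfty; last exact: beta_int_pos_ub.
  apply: (fin b) => //; rewrite -beta_int_rec//; last by rewrite addr_gt0.
  apply: lte_mul_pinfty; rewrite ?lee_fin ?addr_ge0 ?ltW//; exact: beta_int_pos_ub.
rewrite beta_int_split; apply: lte_add_pinfty => //.
apply: (fin a) => //; rewrite beta_int_rec//.
by apply: lte_mul_pinfty; rewrite ?lee_fin ?ltW.
Qed.

Fact betaR_key : unit. Proof. by []. Qed.
Definition betaR a b : R := locked_with betaR_key (fine (beta_int a b)).

Lemma betaRE a b : 0 < a -> 0 < b -> beta_int a b = (betaR a b)%:E.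
Proof.
move=> a0 b0; rewrite /betaR unlock fineK// ge0_fin_numE ?beta_int_ge0//.
exact: beta_int_fin.
Qed.

Lemma betaR_gt0 a b : 0 < a -> 0 < b -> 0 < betaR a b.
Proof. by move=> a0 b0; rewrite -lte_fin -betaRE// beta_int_gt0. Qed.

Lemma betaR_rec a b : 0 < a -> 0 < b -> (a + b) * betaR a (b + 1) = b * betaR a b.
Proof.
move=> a0 b0; have a1 : 0 < a + 1 by rewrite addr_gt0.
have b1 : 0 < b + 1 by rewrite addr_gt0.
have := beta_int_rec a0 b0; have := beta_int_split a b.
rewrite (betaRE a0 b0) (betaRE a1 b0) (betaRE a0 b1) -!EFinM.
by move=> -[->] [h]; rewrite mulrDl h mulrDr.
Qed.

(** A finite value would bound B(a, p) uniformly over 0 < p <= 1, against p B(a, p) = (a + p) B(a, p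
    + 1) >= a B(a, 2) as p tends to 0. *)
Lemma beta_int_oo a b : 0 < a -> b <= 0 -> beta_int a b = +oo%E.
Proof.
move=> a0 b0; apply/eqP; rewrite -leye_eq leNgt; apply/negP => fin.
have [M M0 IM] : exists2 M, 0 <= M & beta_int a b = M%:E.
  exists (fine (beta_int a b)); first by rewrite fine_ge0// beta_int_ge0.
  by rewrite fineK// ge0_fin_numE// beta_int_ge0.
have mono p q : p <= q -> (beta_int a q <= beta_int a p)%E.
  move=> pq; apply: ge0_le_integral => //.
  - by move=> x _; rewrite lee_fin beta_dens_ge0.
  - by apply: mE; exact: measurable_itv.
  - by apply: mE; exact: measurable_itv.
  move=> x; rewrite /= in_itv/= => /andP[x0 x1]; rewrite lee_fin.
  apply: ler_wpM2l; first exact: powR_ge0.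
  apply: ger_powR; last by rewrite lerD2r.
  by rewrite subr_gt0 x1 gerBl ltW.
have [c c0 cE] : exists2 c : R, 0 < c & beta_int a 2 = c%:E.
  by exists (betaR a 2); [exact: betaR_gt0|exact: betaRE].
(* Small enough that p M < a c, where [M] is the supposed bound and c = B(a, 2), and at most 1 so
   that B(a, p + 1) >= c. *)
pose p := Num.min 1 (a * c / (2 * (M + 1))).
have M1 : 0 < 2 * (M + 1) by rewrite mulr_gt0// ltr_wpDl.
have p0 : 0 < p by rewrite lt_min ltr01/= divr_gt0// mulr_gt0.
have p1 : p <= 1 by rewrite ge_min lexx.
have pM : p * (2 * (M + 1)) <= a * c.
  by rewrite -ler_pdivlMr// ge_min lexx orbT.
have p10 : 0 < p + 1 by rewrite addr_gt0.
have h1 : betaR a p <= M.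
  by rewrite -lee_fin -(betaRE a0 p0) -IM; apply: mono; rewrite (le_trans b0)// ltW.
have h2 : c <= betaR a (p + 1).
  rewrite -lee_fin -(betaRE a0 p10) -cE; apply: mono.
  by rewrite -[2]/(1 + 1) lerD2r.
have := betaR_rec a0 p0.
move: (betaR a (p + 1)) (betaR a p) h1 h2 => K H h1 h2 E.
have t1 : a * c <= a * K by rewrite ler_pM2l.
have t2 : 0 <= p * K by apply: mulr_ge0; [exact: ltW|exact: le_trans (ltW c0) h2].
have t3 : p * H <= p * M by rewrite ler_pM2l.
have t4 : 0 <= p * M by apply: mulr_ge0 => //; exact: ltW.
move: E pM; rewrite mulrDl mulrCA mulrDr mulr1 => E pM.
by lra.
Qed.

End beta_integral.

(** * Size-biased picks *)

Section size_bias.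
Local Open Scope ereal_scope.
Context {R : realType}.
Implicit Types (x : nat -> R) (s t : seq nat) (f g : seq nat -> \bar R).

Definition good x : Prop :=
  (forall j, 0 < x j)%R /\ ((fun n => \sum_(j < n) x j)%R @ \oo --> (1%R : R)).

Definition psum x n : R := (\sum_(i < n) x i)%R.

Lemma psumS x n : psum x n.+1 = (psum x n + x n)%R.
Proof. by rewrite /psum big_ord_recr. Qed.

Lemma good_psum_lt1 x n : good x -> (psum x n < 1)%R.
Proof.
move=> [x0 x1]; apply: (@lt_le_trans _ _ (psum x n.+1)).
  by rewrite psumS ltrDl.
have nd : nondecreasing_seq (psum x).
  by apply/nondecreasing_seqP => m; rewrite psumS lerDl ltW.
have := nondecreasing_cvgn_le nd (cvgP _ x1) n.+1.
by rewrite (cvg_lim _ x1).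
Qed.

Definition wsum x s : R := (\sum_(l <- s) x l)%R.

Lemma good_wsum_lt1 x s : good x -> uniq s -> (wsum x s < 1)%R.
Proof.
move=> gx us; apply: le_lt_trans (good_psum_lt1 (\max_(i <- s) i).+1 gx).
set N := (\max_(i <- s) i)%N; rewrite /psum -(big_mkord xpredT x).
have sub l : l \in s -> l \in iota 0 N.+1.
  by move=> ls; rewrite mem_iota add0n ltnS/= /N; exact: leq_bigmax_seq.
rewrite /index_iota subn0 /wsum.
have pe : perm_eq (iota 0 N.+1) (s ++ [seq i <- iota 0 N.+1 | i \notin s]).
  rewrite uniq_perm ?iota_uniq ?cat_uniq ?us ?filter_uniq ?iota_uniq ?andbT//.
    by apply/hasPn => i; rewrite mem_filter => /andP[].
  move=> i; rewrite mem_cat mem_filter; case: (boolP (i \in s)) => //= /sub.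
  by rewrite mem_iota.
rewrite (perm_big _ pe) big_cat/= lerDl; apply: sumr_ge0 => i _; exact: ltW (gx.1 i).
Qed.

(** The absolute value makes this conditional probability nonnegative for every sequence, so that
    series in the extended reals behave without side conditions; on good weights and lists without
    repetition it changes nothing. *)
Definition sbc x s j : R :=
  if j \in s then 0%R else `|x j / (1 - wsum x s)|%R.

Lemma sbc_ge0 x s j : (0 <= sbc x s j)%R.
Proof. by rewrite /sbc; case: ifP. Qed.

Lemma sbc_good x s j : good x -> uniq s -> j \notin s ->
  sbc x s j = (x j / (1 - wsum x s))%R.
Proof.
move=> gx us js; rewrite /sbc (negbTE js) ger0_norm// divr_ge0 ?(ltW (gx.1 j))//.
by rewrite subr_ge0 ltW// good_wsum_lt1.
Qed.

Lemma sb_cond_list x (r : nat -> nat) s j :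
  (forall l, (l < size s)%N -> r l = nth 0%N s l) ->
  sb_cond x r (size s) j = if (wsum x s < 1)%R then
      (if j \in s then 0 else x j / (1 - wsum x s))%R
    else (if j == first_free (nth 0%N s) (size s) then 1 else 0)%R.
Proof.
move=> rs; have mE : [seq r l | l <- iota 0 (size s)] = s.
  apply: (@eq_from_nth _ 0%N); rewrite size_map size_iota// => i si.
  by rewrite (nth_map 0%N) ?size_iota// nth_iota// rs.
have mE' : [seq nth 0%N s l | l <- iota 0 (size s)] = s by rewrite map_nth_iota0// take_size.
rewrite /sb_cond /first_free mE mE'.
have -> : (\sum_(l < size s) x (r l) = wsum x s)%R.
  rewrite -(big_mkord xpredT (fun l => x (r l))) /index_iota subn0.
  by rewrite /wsum -{2}mE big_map.
by [].
Qed.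

(* Conditional expectation of [f], evaluated at the list of the first
   [size s + m] size-biased picks, given that the first picks are [s]. *)
Fixpoint picks m x s f : \bar R :=
  if m is m'.+1 then \sum_(j <oo) (sbc x s j)%:E * picks m' x (rcons s j) f
  else f s.

Lemma picks_ge0 m x s f : (forall t, 0 <= f t) -> 0 <= picks m x s f.
Proof.
move=> f0; elim: m s => [|m IHm] s //=.
by apply: nneseries_ge0 => j _ _; rewrite mule_ge0// lee_fin sbc_ge0.
Qed.

Lemma sbc_picks_ge0 m x s j f : (forall t, 0 <= f t) ->
  0 <= (sbc x s j)%:E * picks m x (rcons s j) f.
Proof. by move=> f0; rewrite mule_ge0 ?picks_ge0// lee_fin sbc_ge0. Qed.

Lemma eq_picks m x s f g : (forall t, size t = (size s + m)%N -> f t = g t) ->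
  picks m x s f = picks m x s g.
Proof.
elim: m s => [|m IHm] s fg /=; first by apply: fg; rewrite addn0.
apply: eq_eseriesr => j _; congr (_ * _); apply: IHm => t.
by rewrite size_rcons addSnnS; exact: fg.
Qed.

Lemma eq_nneseries_bij (a : nat -> \bar R) (p : nat -> nat) :
  (forall n, 0 <= a n) -> bijective p ->
  \sum_(j <oo) a j = \sum_(j <oo) a (p j).
Proof.
move=> a0 [q pq qp]; rewrite !nneseries_esumT//.
apply: reindex_esum; split => //.
- by move=> i j _ _; exact: (can_inj pq).
- by move=> i _; exists (q i).
Qed.

Lemma picks_bij m x s f (p : nat -> nat) : (forall t, 0 <= f t) -> bijective p ->
  picks m (x \o p) s (f \o map p) = picks m x (map p s) f.
Proof.
move=> f0 bp; elim: m s => [//|m IHm] s /=.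
rewrite [RHS](eq_nneseries_bij _ bp); last by move=> j; exact: sbc_picks_ge0.
apply: eq_eseriesr => j _; rewrite IHm map_rcons; congr (_%:E * _).
rewrite /sbc mem_map; last exact: bij_inj bp.
by rewrite /wsum big_map.
Qed.

Lemma eq_sbc_perm x s t j : perm_eq s t -> sbc x s j = sbc x t j.
Proof. by move=> st; rewrite /sbc (perm_mem st) /wsum (perm_big _ st). Qed.

(** The future picks depend on the past ones only through their set. *)
Lemma picks_perm m x s s' f f' : perm_eq s s' ->
  (forall r, f (s ++ r) = f' (s' ++ r)) -> picks m x s f = picks m x s' f'.
Proof.
elim: m s s' => [|m IHm] s s' ss' ff' /=; first by have := ff' [::]; rewrite !cats0.
apply: eq_eseriesr => j _; rewrite (eq_sbc_perm _ _ ss'); congr (_ * _).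
apply: IHm; first by rewrite -!cats1 perm_cat2r.
by move=> r; rewrite !cat_rcons.
Qed.

Lemma picksZ m x s f g (c : R) : (forall t, 0 <= g t) ->
  (forall r, f (s ++ r) = c%:E * g (s ++ r)) ->
  picks m x s f = c%:E * picks m x s g.
Proof.
move=> g0; elim: m s => [|m IHm] s fg /=; first by have := fg [::]; rewrite cats0.
rewrite -nneseriesZl; last by move=> j _; exact: sbc_picks_ge0.
apply: eq_eseriesr => j _; rewrite muleCA -IHm// => r.
by rewrite !cat_rcons.
Qed.

Definition transp k : nat -> nat :=
  fun i => if i == k then k.+1 else if i == k.+1 then k else i.

Lemma transpK k : involutive (transp k).
Proof.
move=> i; rewrite /transp; have [->|ik] := eqVneq i k.
  by rewrite eqxx -[X in (X == _)]addn1 -[X in (_ == X)]addn0 eqn_add2l.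
have [->|ik1] := eqVneq i k.+1; first by rewrite eqxx.
by rewrite (negbTE ik) (negbTE ik1).
Qed.

Definition swap_list k t : seq nat := mkseq (fun i => nth 0%N t (transp k i)) (size t).

Lemma swap_list_cat s i j r :
  swap_list (size s) (s ++ i :: j :: r) = s ++ j :: i :: r.
Proof.
have sz : size (s ++ i :: j :: r) = size (s ++ j :: i :: r) by rewrite !size_cat.
apply: (@eq_from_nth _ 0%N); first by rewrite size_mkseq.
rewrite size_mkseq => l lsz; rewrite nth_mkseq// /transp.
have [->|ls] := eqVneq l (size s).
  by rewrite !nth_cat ltnn subnn ltnNge leqnSn/= subSnn.
have [->|ls1] := eqVneq l (size s).+1.
  by rewrite !nth_cat ltnn subnn ltnNge leqnSn/= subSnn.
rewrite !nth_cat; case: ltnP => // sl.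
have [m ->] : exists m, l = (size s + m.+2)%N.
  exists (l - size s).-2; have : (size s < l)%N by rewrite ltn_neqAle eq_sym ls.
  rewrite leq_eqVlt eq_sym (negbTE ls1)/= => h.
  by lia.
by rewrite addKn.
Qed.

(* The factor [1 - wsum x (take k.+1 t)] cancels the only factor of the
   probability of [t] that is not symmetric in the picks [k] and [k.+1]. *)
Lemma picks_swap m x s p k f : good x -> uniq s -> (size s + p)%N = k ->
  (forall t, 0 <= f t) ->
  picks (p + m.+2) x s (fun t => (`|1 - wsum x (take k.+1 t)|)%:E * f t) =
  picks (p + m.+2) x s (fun t => (`|1 - wsum x (take k.+1 t)|)%:E * f (swap_list k t)).
Proof.
move=> gx + + f0; elim: p s => [|p IHp] s us sk; last first.
  rewrite addSn /=; apply: eq_eseriesr => j _.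
  have [js|js] := boolP (j \in s); first by rewrite /sbc js !mul0e.
  by congr (_ * _); apply: IHp; rewrite ?rcons_uniq ?js// size_rcons addSnnS.
rewrite add0n; rewrite addn0 in sk; subst k.
have takeS i r : take (size s).+1 (s ++ i :: r) = rcons s i.
  by rewrite -cat_rcons -(size_rcons s i) take_size_cat.
pose c i := `|1 - wsum x (rcons s i)|%R.
(* For distinct i, j outside [s] this is x_i x_j / (1 - wsum x s), whence the symmetry [WC];
   otherwise some factor [sbc] vanishes. *)
pose W i j := (sbc x s i * sbc x (rcons s i) j * c i)%R.
have E g : (forall t, 0 <= g t) ->
    picks m.+2 x s (fun t => (`|1 - wsum x (take (size s).+1 t)|)%:E * g t) =
    \sum_(i <oo) \sum_(j <oo) (W i j)%:E * picks m x (rcons (rcons s i) j) g.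
  move=> g0 /=; apply: eq_eseriesr => i _; rewrite -nneseriesZl; last first.
    by move=> j _; apply: sbc_picks_ge0 => t; rewrite mule_ge0// lee_fin.
  apply: eq_eseriesr => j _.
  rewrite (@picksZ _ _ _ _ g (c i))//; last first.
    by move=> r; rewrite !cat_rcons takeS.
  by rewrite !muleA -!EFinM.
have W0 i j : (0 <= W i j)%R by rewrite /W !mulr_ge0 ?sbc_ge0 /c.
have WC i j : W i j = W j i.
  rewrite /W; have [->//|ij] := eqVneq i j.
  have [is_|is_] := boolP (i \in s).
    by rewrite /sbc is_ !mul0r mem_rcons in_cons is_ orbT mulr0 mul0r.
  have [js|js] := boolP (j \in s).
    by rewrite /sbc js !mul0r mem_rcons in_cons js orbT mulr0 mul0r.
  have lt1 l : l \notin s -> (0 < 1 - wsum x (rcons s l))%R.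
    by move=> ls; rewrite subr_gt0; apply: good_wsum_lt1 => //; rewrite rcons_uniq ls.
  have lt0 : (0 < 1 - wsum x s)%R by rewrite subr_gt0 good_wsum_lt1.
  rewrite !sbc_good ?rcons_uniq ?is_ ?js//; last 2 first.
  - by rewrite mem_rcons in_cons negb_or ij is_.
  - by rewrite mem_rcons in_cons negb_or eq_sym ij js.
  rewrite /c !gtr0_norm ?lt1//; field.
  by rewrite !lt0r_neq0// ?lt1.
rewrite (E f f0) (E (fun t => f (swap_list (size s) t)) (fun t => f0 _)).
rewrite nneseries_interchange; last first.
  by move=> i j; rewrite mule_ge0 ?picks_ge0// lee_fin.
apply: eq_eseriesr => j _; apply: eq_eseriesr => i _.
rewrite WC; congr (_ * _); apply: picks_perm.
  by rewrite -!cats1 -!catA perm_cat2l; exact: (permEl (perm_catC [:: _] [:: _])).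
by move=> r; rewrite !cat_rcons swap_list_cat.
Qed.

End size_bias.

(** * The law of the reordered weights in terms of the weights alone *)

Section size_biased_law.
Local Open Scope ereal_scope.
Context {R : realType}.
Implicit Types (s t : seq nat) (n m k i j : nat).

Lemma measurable_psum n : measurable_fun setT (fun x : seqR R => psum x n).
Proof. by apply: measurable_sum => i; exact: measurable_coord. Qed.

Lemma measurable_wsum s : measurable_fun setT (fun x : seqR R => wsum x s).
Proof. by apply: measurable_sum => i; exact: measurable_coord. Qed.

Lemma measurable_onem_wsum s : measurable_fun setT (fun x : seqR R => 1 - wsum x s)%R.
Proof. by apply: measurable_funB => //; exact: measurable_wsum. Qed.

Lemma measurable_sbc s j : measurable_fun setT (fun x : seqR R => sbc x s j).
Proof.
rewrite (_ : (fun _ => _) = if j \in s then fun=> 0%R else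
    fun x : seqR R => `|x j / (1 - wsum x s)|%R); last first.
  by apply/funext => x; rewrite /sbc; case: ifP.
case: ifP => _; first exact: measurable_cst.
apply: measurableT_comp => //; apply: measurable_funM; first exact: measurable_coord.
exact: measurableT_comp (@measurable_invr R) (measurable_onem_wsum s).
Qed.

(** Past the end of [t] the entry is [x 0]; this default is harmless for functions that depend only
    on the first [size t] coordinates. *)
Definition sub (x : nat -> R) t : nat -> R := fun i => x (nth 0%N t i).

Definition depends n (F : (nat -> R) -> \bar R) : Prop :=
  forall x y : nat -> R, (forall i, (i < n)%N -> x i = y i) -> F x = F y.

Lemma measurable_picks m s (F : seqR R -> \bar R) : (forall x, 0 <= F x) ->
  measurable_fun setT F ->
  measurable_fun setT (fun x : seqR R => picks m x s (fun t => F (sub x t))).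
Proof.
move=> F0 mF; elim: m s => [|m IHm] s /=.
  apply: (measurableT_comp mF); apply: measurable_seqR => j; exact: measurable_coord.
apply: ge0_emeasurable_sum => [k x _ _|k _]; first exact: sbc_picks_ge0.
apply: emeasurable_funM; last exact: IHm.
by apply/measurable_EFinP; exact: measurable_sbc.
Qed.

(** Partial sums of positive terms increase, so convergence to 1 becomes a countable combination of
    inequalities between partial sums, which makes the event measurable. *)
Lemma goodP (x : nat -> R) : good x <->
  [/\ (forall j, 0 < x j)%R, (forall n, psum x n < 1)%R &
      (forall m, exists n, 1 - m.+1%:R^-1 < psum x n)%R].
Proof.
split=> [gx|[x0 x1 xm]].
  split; [exact: gx.1|by move=> n; exact: good_psum_lt1|move=> m].
  have lt1 : (1 - m.+1%:R^-1 < 1 :> R)%R by rewrite gtrBl invr_gt0.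
  have : \forall n \near \oo, (1 - m.+1%:R^-1 < psum x n)%R := cvgr_gt _ gx.2 _ lt1.
  by move=> [n _ /(_ n (leqnn n))]; exists n.
split=> //.
have nd : nondecreasing_seq (psum x).
  by apply/nondecreasing_seqP => m; rewrite psumS lerDl ltW.
apply/cvgrPdist_lt => e e0; have [m me] : exists m, (m.+1%:R^-1 < e)%R.
  exists (Num.truncn e^-1); rewrite -[ltRHS]invrK ltf_pV2 ?posrE ?invr_gt0//.
  exact: truncnS_gt.
have [n nm] := xm m; exists n => // p /= np.
rewrite -/(psum x p) gtr0_norm ?subr_gt0; last exact: x1.
by apply: lt_trans me; rewrite ltrBlDr -ltrBlDl; exact: lt_le_trans nm (nd _ _ np).
Qed.

Lemma measurable_good : measurable ([set x | good x] : set (seqR R)).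
Proof.
rewrite (_ : [set x | good x] =
  (\bigcap_j [set x : seqR R | 0 < x j]%R) `&`
  ((\bigcap_n [set x : seqR R | psum x n < 1]%R) `&`
   (\bigcap_m \bigcup_n [set x : seqR R | 1 - m.+1%:R^-1 < psum x n]%R))); last first.
  apply/seteqP; split => x /=.
    move=> /goodP[h1 h2 h3]; split=> [j _|]; [exact: h1|split=> [n _|m _]; [exact: h2|]].
    by have [n nm] := h3 m; exists n.
  move=> [h1 [h2 h3]]; apply/goodP; split=> [j|n|m].
  - exact: (h1 j).
  - exact: (h2 n).
  - by have [n _ nm] := h3 m Logic.I; exists n.
apply: measurableI.
  by apply: bigcapT_measurable => j; apply: measurable_lt_set => //; exact: measurable_coord.
apply: measurableI.
  by apply: bigcapT_measurable => j; apply: measurable_lt_set => //; exact: measurable_psum.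
apply: bigcapT_measurable => m; apply: bigcupT_measurable => n.
by apply: measurable_lt_set => //; exact: measurable_psum.
Qed.

Definition path (T : Type) (X : nat -> T -> R) (o : T) : seqR R := fun j => X j o.

Section law.
Context d (T : measurableType d) (P : probability T R).

Lemma measurable_path (X : nat -> T -> R) :
  (forall j, measurable_fun setT (X j)) -> measurable_fun setT (path X).
Proof. by move=> mX; apply: measurable_seqR => j; exact: mX. Qed.

Lemma eq_integral_ae (D : set T) (f g : T -> \bar R) :
  {ae P, forall o, D o} -> (forall o, 0 <= f o) -> (forall o, 0 <= g o) ->
  measurable_fun setT f -> measurable_fun setT g ->
  (forall o, D o -> f o = g o) -> \int[P]_o f o = \int[P]_o g o.
Proof.
move=> aeD f0 g0 mf mg fg; apply: ge0_ae_eq_integral => //.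
by apply: filterS aeD => o Do _; exact: fg.
Qed.

Lemma integral_indic_mul (A : set T) (f : T -> \bar R) : measurable A ->
  \int[P]_o ((\1_A o)%:E * f o) = \int[P]_(o in A) f o.
Proof.
move=> mA; rewrite [RHS]integral_mkcond; apply: eq_integral => o _.
by rewrite patchE indicE; case: ifP => _; rewrite ?mul1e ?mul0e.
Qed.

End law.

Lemma same_law_integral d d' (T : measurableType d) (T' : measurableType d')
  (P : probability T R) (Q : probability T' R) (X : nat -> T -> R) (Y : nat -> T' -> R) :
  (forall j, measurable_fun setT (X j)) -> (forall j, measurable_fun setT (Y j)) ->
  same_law P X Q Y ->
  forall F : seqR R -> \bar R, (forall x, 0 <= F x) -> measurable_fun setT F ->
    \int[P]_o F (path X o) = \int[Q]_o F (path Y o).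
Proof.
move=> mX mY XY F F0 mF.
have pf d1 (T1 : measurableType d1) (P1 : probability T1 R) (Z : nat -> T1 -> R) :
    (forall j, measurable_fun setT (Z j)) ->
    posfun (fun F : seqR R -> \bar R => \int[P1]_o F (path Z o)).
  by move=> mZ; exact: (posfun_pull (posfun_integral P1 measurableT) (measurable_path mZ)).
apply: (seqR_unique (pf _ _ _ _ mX) (pf _ _ _ _ mY)) F0 mF.
  rewrite /= (integral_cst P measurableT 1%E) mul1e.
  exact: le_lt_trans (probability_le1 P measurableT) (ltry _).
have cE d1 (T1 : measurableType d1) (P1 : probability T1 R) (Z : nat -> T1 -> R) n A :
    (forall j, measurable_fun setT (Z j)) -> (forall i, measurable (A i)) ->
    \int[P1]_o (\1_(cylinder n A) (path Z o))%:E =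
    P1 [set o | forall i, (i < n)%N -> A i (Z i o)].
  move=> mZ mA; have mC : measurable (path Z @^-1` cylinder n A).
    rewrite -[X in measurable X]setTI.
    exact: (measurable_path mZ measurableT (measurable_cylinder n mA)).
  by rewrite -(integral_indic_prob P1 mC); apply: eq_integral => o _; rewrite !indicE.
by move=> n A mA; rewrite !cE//; exact: XY.
Qed.

Lemma same_law_ae d d' (T : measurableType d) (T' : measurableType d')
  (P : probability T R) (Q : probability T' R) (X : nat -> T -> R) (Y : nat -> T' -> R)
  (D : set (seqR R)) :
  (forall j, measurable_fun setT (X j)) -> (forall j, measurable_fun setT (Y j)) ->
  same_law P X Q Y -> measurable D ->
  {ae P, forall o, D (path X o)} -> {ae Q, forall o, D (path Y o)}.
Proof.
move=> mX mY XY mD aeD.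
have mDC : measurable (~` D) by exact: measurableC.
have nE d1 (T1 : measurableType d1) (P1 : probability T1 R) (Z : nat -> T1 -> R) :
    (forall j, measurable_fun setT (Z j)) ->
    measurable (path Z @^-1` (~` D)) /\
    \int[P1]_o (\1_(~` D) (path Z o))%:E = P1 (path Z @^-1` (~` D)).
  move=> mZ; have m : measurable (path Z @^-1` (~` D)).
    by rewrite -[X in measurable X]setTI; exact: (measurable_path mZ).
  by split=> //; rewrite -integral_indic_prob.
have [mP PE] := nE _ _ P X mX; have [mQ QE] := nE _ _ Q Y mY.
exists (path Y @^-1` (~` D)); split => //.
rewrite -QE -(same_law_integral mX mY XY (F := fun x => (\1_(~` D) x)%:E)) ?PE//.
- case: aeD => N [mN N0 sN]; apply: (subset_measure0 mP mN) => //.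
exact: measurable_indicE.
Qed.

Section picks_formula.
Context d (T : measurableType d) (Q : probability T R).
Variables (w : nat -> T -> R) (rho : nat -> T -> nat).
Hypothesis mw : forall j, measurable_fun setT (w j).
Hypothesis mrho : forall k i, measurable (rho k @^-1` [set i]).
Hypothesis aegood : {ae Q, forall o, good (path w o)}.
Hypothesis sb : size_biased_perm Q w rho.

Definition starts s : set T := [set o | forall l, (l < size s)%N -> rho l o = nth 0%N s l].

Lemma measurable_starts s : measurable (starts s).
Proof.
rewrite (_ : starts s = \bigcap_(l in `I_(size s)) (rho l @^-1` [set nth 0%N s l])).
  by apply: bigcap_measurableType => l _; exact: mrho.
by apply/seteqP; split.
Qed.

Lemma starts_rcons s j : starts (rcons s j) = starts s `&` rho (size s) @^-1` [set j].
Proof.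
apply/seteqP; split => o /=.
  move=> so; split=> [l ls|].
    by rewrite so ?size_rcons ?ltnS 1?ltnW// nth_rcons ls.
  by rewrite so ?size_rcons// nth_rcons ltnn eqxx.
move=> [so sj] l; rewrite size_rcons ltnS nth_rcons leq_eqVlt.
by case: ltngtP => //= [ls _|-> _]; [exact: so|].
Qed.

(** The defining identity of a size-biased permutation, extended from cylinder events to functions
    of the whole weight sequence. The branch of [sb_cond] for exhausted mass occurs only on the null
    set where the weights are not good. *)
Lemma picks_step s j (H : seqR R -> \bar R) : uniq s ->
  (forall x, 0 <= H x) -> measurable_fun setT H ->
  \int[Q]_o ((\1_(starts (rcons s j)) o)%:E * H (path w o)) =
  \int[Q]_o ((\1_(starts s) o * sbc (path w o) s j)%:E * H (path w o)).
Proof.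
move=> us H0 mH; have mp := measurable_path mw.
have msb : measurable_fun setT (fun o => \1_(starts s) o * sbc (path w o) s j)%R.
  apply: measurable_funM; first by apply: measurable_indic; exact: measurable_starts.
  exact: measurableT_comp (measurable_sbc s j) mp.
have pf1 : posfun (fun H : seqR R -> \bar R =>
    \int[Q]_o ((\1_(starts (rcons s j)) o)%:E * H (path w o))).
  apply: (posfun_comp (posfun_integral Q measurableT) mp) => //.
  by apply: measurable_indic; exact: measurable_starts.
have pf2 : posfun (fun H : seqR R -> \bar R =>
    \int[Q]_o ((\1_(starts s) o * sbc (path w o) s j)%:E * H (path w o))).
  apply: (posfun_comp (posfun_integral Q measurableT) mp) => //.
  by move=> o; rewrite mulr_ge0// sbc_ge0.
apply: (seqR_unique pf1 pf2) H0 mH.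
  under eq_integral do rewrite mule1.
  rewrite integral_indic_prob; last exact: measurable_starts.
  by apply: le_lt_trans (probability_le1 _ _) (ltry _); exact: measurable_starts.
move=> n A mA.
pose C := [set o | forall i, (i < n)%N -> A i (w i o)].
have mC : measurable C.
  rewrite -[X in measurable X]setTI; exact: (mp _ _ (measurable_cylinder n mA)).
have CE o : \1_(cylinder n A) (path w o) = \1_C o :> R by rewrite !indicE.
have := @sb (size s) j n A (nth 0%N s) mA => /=.
rewrite [X in Q (X `&` _)](_ : _ = C `&` starts s)// => sbE.
transitivity (Q ((C `&` starts s) `&` [set o | rho (size s) o = j])).
  rewrite -setIA -starts_rcons -integral_indic_prob; last first.
    by apply: measurableI => //; exact: measurable_starts.
  by apply: eq_integral => o _; rewrite CE -EFinM indicI/= mulrC.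
rewrite {}sbE [X in \int[Q]_(o in X) _](_ : _ = C `&` starts s)//.
have mCs : measurable (C `&` starts s) by apply: measurableI => //; exact: measurable_starts.
pose h (x : seqR R) : R := if (wsum x s < 1)%R then
  (if j \in s then 0 else x j / (1 - wsum x s))%R
  else (if j == first_free (nth 0%N s) (size s) then 1 else 0)%R.
have mh : measurable_fun setT h.
  apply: measurable_fun_ifT.
  - by apply: measurable_fun_ltr => //; exact: measurable_wsum.
  - case: (j \in s); first exact: measurable_cst.
    apply: measurable_funM; first exact: measurable_coord.
    exact: measurableT_comp (@measurable_invr R) (measurable_onem_wsum s).
  - exact: measurable_cst.
transitivity (\int[Q]_(o in C `&` starts s) (h (path w o))%:E).
  apply: eq_integral => o; rewrite inE => -[_ so]; congr EFin.
  exact: sb_cond_list.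
rewrite -integral_indic_mul//; apply: ae_eq_integral => //.
- apply: emeasurable_funM; first exact: measurable_indicE.
  by apply/measurable_EFinP; exact: measurableT_comp mh mp.
- apply: emeasurable_funM; first by apply/measurable_EFinP.
  by under eq_fun do rewrite CE; exact: measurable_indicE.
apply: filterS aegood => o go _; rewrite CE -!EFinM indicI/=; congr EFin.
rewrite /h good_wsum_lt1//; have [js|js] := boolP (j \in s).
  by rewrite /sbc js !(mulr0, mul0r).
by rewrite sbc_good//; ring.
Qed.

Lemma measurable_reordered : forall j, measurable_fun setT (fun o => w (rho j o) o).
Proof.
move=> j _ B mB; rewrite setTI.
rewrite (_ : _ @^-1` _ = \bigcup_i (rho j @^-1` [set i] `&` w i @^-1` B)).
  apply: bigcupT_measurable => i; apply: measurableI => //.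
  by rewrite -[X in measurable X]setTI; exact: mw.
apply/seteqP; split => o /=; first by move=> Bo; exists (rho j o).
by move=> [i _ [/= -> ?]].
Qed.

Lemma eseries_single (a : nat -> \bar R) r : (forall j, 0 <= a j) ->
  (forall j, j != r -> a j = 0) -> \sum_(j <oo) a j = a r.
Proof.
move=> a0 ar; rewrite (@nneseriesD1 _ _ r)// eseries0 ?adde0// => j _ /= jr.
exact: ar.
Qed.

Lemma picks_formula n (F : seqR R -> \bar R) : (forall x, 0 <= F x) ->
  measurable_fun setT F -> depends n F ->
  \int[Q]_o F (path (fun j o => w (rho j o) o) o) =
  \int[Q]_o picks n (path w o) [::] (fun t => F (sub (path w o) t)).
Proof.
move=> F0 mF dF; set Fr := fun o => F (path (fun j o => w (rho j o) o) o).
have mFr : measurable_fun setT Fr.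
  by apply: (measurableT_comp mF); apply: measurable_path; exact: measurable_reordered.
have mp := measurable_path mw.
have mI s : measurable_fun setT (fun o => (\1_(starts s) o)%:E : \bar R).
  by apply: measurable_indicE; exact: measurable_starts.
(* Generalised to the event that the first picks are [s], for an induction on the number of picks
   still to be made. *)
suff H m s : uniq s -> (size s + m = n)%N ->
    \int[Q]_o ((\1_(starts s) o)%:E * Fr o) = \int[Q]_o ((\1_(starts s) o)%:E *
      picks m (path w o) s (fun t => F (sub (path w o) t))).
  have := H n [::] isT (add0n n).
  by rewrite (_ : starts [::] = setT)?indicT//; [under eq_integral do rewrite mul1e;
     under [RHS]eq_integral do rewrite mul1e|apply/seteqP; split].
elim: m s => [|m IHm] s us sn.
  rewrite addn0 in sn; apply: eq_integral => o _; rewrite indicE.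
  have [|_] := boolP (o \in starts s); last by rewrite !mul0e.
  rewrite inE => so; congr (_ * _); apply: dF => i i_n /=.
  by rewrite /path /sub so ?sn.
have pickm m' t : measurable_fun setT (fun o =>
    picks m' (path w o) t (fun t => F (sub (path w o) t))).
  exact: (measurableT_comp (measurable_picks m' t F0 mF) mp).
have pick0 m' t o : 0 <= picks m' (path w o) t (fun t => F (sub (path w o) t)).
  by apply: picks_ge0.
transitivity (\sum_(j <oo) \int[Q]_o ((\1_(starts (rcons s j)) o)%:E * Fr o)).
  rewrite -integral_nneseries//; last 2 first.
  - by move=> j; exact: emeasurable_funM.
  - by move=> j o _; rewrite mule_ge0 ?F0// lee_fin.
  apply: eq_integral => o _; rewrite (eseries_single (r := rho (size s) o)).
  - rewrite starts_rcons indicI/= [X in (_ * X)%R]indicE mem_set ?mulr1//.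
  - by move=> j; rewrite mule_ge0 ?F0// lee_fin.
  - move=> j jr; rewrite starts_rcons indicI/= [X in (_ * X)%R]indicE memNset ?mulr0 ?mul0e//=.
    by move=> rj; rewrite rj eqxx in jr.
transitivity (\sum_(j <oo) \int[Q]_o ((\1_(starts s) o * sbc (path w o) s j)%:E *
    picks m (path w o) (rcons s j) (fun t => F (sub (path w o) t)))).
  apply: eq_eseriesr => j _; have [js|js] := boolP (j \in s).
    (* A repeated index has probability zero: [picks_step] with the constant 1 shows that the event
       on the left is null. *)
    rewrite [RHS]integral0_eq; last by move=> o _; rewrite /sbc js mulr0 mul0e.
    have := picks_step j us (H := fun=> 1) (fun=> lee01) (measurable_cst _).
    rewrite [X in _ = X]integral0_eq; last by move=> o _; rewrite /sbc js mulr0 mul0e.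
    under eq_integral do rewrite mule1.
    rewrite integral_indic_prob; last exact: measurable_starts.
    move=> Q0; rewrite integral_indic_mul; last exact: measurable_starts.
    apply: null_set_integral => //; first exact: measurable_starts.
    exact: measurable_funTS.
  rewrite IHm ?rcons_uniq ?js//; last by rewrite size_rcons addSnnS.
  exact: (picks_step j us (H := fun x => picks m x (rcons s j) (fun t => F (sub x t)))
    (fun x => picks_ge0 _ _ _ (fun t => F0 _)) (measurable_picks m (rcons s j) F0 mF)).
have msb j : measurable_fun setT (fun o => sbc (path w o) s j).
  exact: measurableT_comp (measurable_sbc s j) mp.
rewrite -integral_nneseries//; last 2 first.
- move=> j; apply: emeasurable_funM => //; apply/measurable_EFinP.
  by apply: measurable_funM => //; apply: measurable_indic; exact: measurable_starts.
- by move=> j o _; rewrite mule_ge0// lee_fin mulr_ge0// sbc_ge0.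
apply: eq_integral => o _ /=; rewrite -nneseriesZl//; last first.
  by move=> j _; apply: sbc_picks_ge0.
by apply: eq_eseriesr => j _; rewrite EFinM muleA.
Qed.

End picks_formula.

End size_biased_law.

(** * Exchange of consecutive weights *)

Section swap.
Local Open Scope ereal_scope.
Context {R : realType}.
Implicit Types (x : nat -> R) (s t : seq nat) (n m k i j : nat).

Lemma wsum_iota x k : wsum x (iota 0 k) = psum x k.
Proof. by rewrite /wsum /psum -(big_mkord xpredT x) /index_iota subn0. Qed.

Lemma sbc_sum x s n : good x -> uniq s -> (forall l, l \in s -> (l < n)%N) ->
  (\sum_(j < n) sbc x s j = (psum x n - wsum x s) / (1 - wsum x s))%R.
Proof.
move=> gx us sn.
have -> : (\sum_(j < n) sbc x s j =
    \sum_(j < n) ((x j - if (j : nat) \in s then x j else 0) / (1 - wsum x s)))%R.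
  apply: eq_bigr => j _; have [js|js] := boolP ((j : nat) \in s).
    by rewrite /sbc js subrr mul0r.
  by rewrite sbc_good// subr0.
rewrite -mulr_suml sumrB; congr ((_ - _) / _)%R.
rewrite -(big_mkord xpredT (fun j => if j \in s then x j else 0%R)).
rewrite -big_mkcond/= /wsum -big_filter; apply: perm_big.
apply: uniq_perm; rewrite ?filter_uniq ?iota_uniq// => l.
rewrite mem_filter mem_index_iota/=; case: (boolP (l \in s)) => //= ls.
by rewrite sn.
Qed.

Lemma nneseries_sbc x s : good x -> uniq s -> \sum_(j <oo) (sbc x s j)%:E = 1.
Proof.
move=> gx us; apply: cvg_lim => //.
have lt0 : (0 < 1 - wsum x s)%R by rewrite subr_gt0 good_wsum_lt1.
have c : ((psum x n - wsum x s) / (1 - wsum x s))%R @[n --> \oo] --> (1%R : R).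
  rewrite -[X in _ --> X](divff (lt0r_neq0 lt0)).
  by apply: cvgM; [apply: cvgB; [exact: gx.2|exact: cvg_cst]|exact: cvg_cst].
have cE : ((psum x n - wsum x s) / (1 - wsum x s))%:E @[n --> \oo] --> 1.
  by apply: cvg_EFin c; exact: nearW.
apply: cvg_trans cE; apply: near_eq_cvg; exists (\max_(l <- s) l).+1 => // n /= sn.
rewrite sumEFin big_mkord sbc_sum// => l ls.
by apply: leq_ltn_trans sn; exact: leq_bigmax_seq.
Qed.

Lemma picks_le1 x m s (f : seq nat -> \bar R) : good x -> uniq s ->
  (forall t, 0 <= f t <= 1) -> picks m x s f <= 1.
Proof.
move=> gx + f1; elim: m s => [|m IHm] s us /=; first by have /andP[] := f1 s.
rewrite -(nneseries_sbc gx us); apply: lee_nneseries => [j _ _|j _].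
  by apply: sbc_picks_ge0 => t; have /andP[] := f1 t.
have [js|js] := boolP (j \in s); first by rewrite /sbc js mul0e.
rewrite -[leRHS]mule1; apply: lee_wpmul2l; first by rewrite lee_fin sbc_ge0.
by apply: IHm; rewrite rcons_uniq js.
Qed.

Lemma transp_lt k l : (l < k)%N -> transp k l = l.
Proof. by move=> lk; rewrite /transp !ifF//; apply/eqP; lia. Qed.

Lemma transp_ltn k n l : (k.+1 < n)%N -> (l < n)%N -> (transp k l < n)%N.
Proof. by rewrite /transp; case: ifP => _; [|case: ifP => _]; lia. Qed.

Lemma psum_transp x k n : (n <= k)%N -> psum (x \o transp k) n = psum x n.
Proof.
by move=> nk; apply: eq_bigr => i _ /=; rewrite transp_lt// (leq_trans (ltn_ord i)).
Qed.

Lemma psum_transp_ge x k n : (k.+1 < n)%N -> psum (x \o transp k) n = psum x n.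
Proof.
move=> kn; have [m ->] : exists m, n = (k.+2 + m)%N by exists (n - k.+2)%N; lia.
elim: m => [|m IHm]; last first.
  by rewrite addnS psumS IHm ?psumS/= /transp ?ifF//; apply/eqP; lia.
rewrite addn0 !psumS psum_transp//= /transp eqxx ifF; last by apply/eqP; lia.
by rewrite eqxx addrAC.
Qed.

Lemma good_transp x k : good x -> good (x \o transp k).
Proof.
move=> [x0 x1]; split=> [j|]; first exact: x0.
apply: cvg_trans x1; apply: near_eq_cvg; exists k.+2 => // n /= kn.
by rewrite -/(psum _ _) -[LHS](psum_transp_ge x kn).
Qed.

(* [cyc k d] moves the entry of index [k + d] to position [k]. *)
Fixpoint cyc k d : nat -> nat :=
  if d is d'.+1 then transp (k + d')%N \o cyc k d' else id.

Lemma cyc_bij k d : bijective (cyc k d).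
Proof.
elim: d => [|d IHd] /=; first by exists id.
by apply: bij_comp => //; exists (transp (k + d)%N); exact: transpK.
Qed.

Lemma good_cyc x k d : good x -> good (x \o cyc k d).
Proof.
elim: d x => [//|d IHd] x gx /=.
exact: (IHd (x \o transp (k + d)%N) (good_transp _ gx)).
Qed.

Lemma map_cyc k d : map (cyc k d) (iota 0 k.+1) = rcons (iota 0 k) (k + d)%N.
Proof.
elim: d => [|d IHd].
  by rewrite -[cyc k 0]/(@id nat) map_id addn0 -cats1 -addn1 iotaD.
rewrite -[cyc k d.+1]/(transp (k + d)%N \o cyc k d) map_comp IHd map_rcons; congr rcons.
  rewrite -[RHS]map_id; apply/eq_in_map => l; rewrite mem_iota => /andP[_ lk].
  by rewrite transp_lt//; lia.
by rewrite /transp eqxx addnS.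
Qed.

Lemma measurable_reindex (p : nat -> nat) :
  measurable_fun setT (fun x : seqR R => (x \o p : seqR R)).
Proof. by apply: measurable_seqR => j; exact: measurable_coord. Qed.

Lemma measurable_onem_psum n : measurable_fun setT (fun x : seqR R => `|1 - psum x n|%R).
Proof.
by apply: measurableT_comp => //; apply: measurable_funB => //; exact: measurable_psum.
Qed.

Section fixed_law.
Context d (T : measurableType d) (P : probability T R).
Variable w : nat -> T -> R.
Hypothesis mw : forall j, measurable_fun setT (w j).
Hypothesis aegood : {ae P, forall o, good (path w o)}.

Let mp := measurable_path mw.

(* The law of [w], reweighted by [1 - w_0 - ... - w_k], is invariant under the
   exchange of [w_k] and [w_{k+1}]. *)
Definition swap_invariant : Prop := forall k (F : seqR R -> \bar R),
  (forall x, 0 <= F x) -> measurable_fun setT F ->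
  \int[P]_o ((`|1 - psum (path w o) k.+1|)%:E * F (path w o)) =
  \int[P]_o ((`|1 - psum (path w o) k.+1|)%:E * F (path w o \o transp k)).

(** Invariance with the permutation integrated out: [picks] is a function of the weights, so no
    auxiliary probability space appears. *)
Definition picks_invariant : Prop := forall n (F : seqR R -> \bar R),
  (forall x, 0 <= F x) -> measurable_fun setT F -> depends n F ->
  \int[P]_o F (path w o) =
  \int[P]_o picks n (path w o) [::] (fun t => F (sub (path w o) t)).

Lemma picks_swap_invariant : picks_invariant -> swap_invariant.
Proof.
move=> inv k F F0 mF.
have mpt : measurable_fun setT (fun o => (path w o \o transp k : seqR R)).
  exact: measurableT_comp (measurable_reindex (transp k)) mp.
have mnorm : measurable_fun setT (fun o => `|1 - psum (path w o) k.+1|%R).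
  exact: measurableT_comp (measurable_onem_psum k.+1) mp.
have pf1 := posfun_comp (posfun_integral P measurableT) mp
  (fun o => normr_ge0 (1 - psum (path w o) k.+1)%R) mnorm.
have pf2 := posfun_comp (posfun_integral P measurableT) mpt
  (fun o => normr_ge0 (1 - psum (path w o) k.+1)%R) mnorm.
apply: (seqR_unique pf1 pf2) F0 mF => {F}.
  apply: (@le_lt_trans _ _ (\int[P]_o cst 1 o)); last first.
    by rewrite (integral_cst P measurableT 1%E) mul1e; exact: le_lt_trans (probability_le1 P measurableT) (ltry _).
  under eq_integral do rewrite mule1.
  apply: ae_ge0_le_integral => //; first exact/measurable_EFinP.
  apply: filterS aegood => o go _; rewrite lee_fin ger0_norm; last first.
    by rewrite subr_ge0 ltW// good_psum_lt1.
  rewrite lerBlDr lerDl; apply: sumr_ge0 => i _; exact: ltW (go.1 i).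
move=> n0 A0 mA0.
(* The cylinder is lengthened by unconstrained coordinates until the picks k and k + 1 are both
   among the first n. *)
pose n := (n0 + k.+2)%N; pose A i := if (i < n0)%N then A0 i else setT.
have mA i : measurable (A i) by rewrite /A; case: ifP.
have -> : cylinder n0 A0 = cylinder n A.
  apply/seteqP; split => x /= h i.
    by rewrite /A => _; case: ifP => // i0; exact: h.
  by move=> i0; have := h i; rewrite /A i0; apply; rewrite /n; lia.
pose F (x : seqR R) : \bar R := (\1_(cylinder n A) x)%:E.
have F0 x : 0 <= F x by rewrite lee_fin.
have mF : measurable_fun setT F by apply: measurable_indicE; exact: (measurable_cylinder n mA).
have dF : depends n F.
  move=> x y xy; rewrite /F !indicE; congr ((_ : bool)%:R%:E).
  by apply/idP/idP; rewrite !inE => h i i_n; have := h i i_n; rewrite xy.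
have kn : (k.+1 < n)%N by rewrite /n; lia.
have dp x y : (forall i, (i < n)%N -> x i = y i) -> psum x k.+1 = psum y k.+1 :> R.
  move=> xy; apply: eq_bigr => i _; apply: xy; have := ltn_ord i; lia.
have N0 x (G : seqR R -> \bar R) : (forall x, 0 <= G x) ->
    0 <= (`|1 - psum x k.+1|)%:E * G x by move=> G0; rewrite mule_ge0.
have mN (G : seqR R -> \bar R) : measurable_fun setT G ->
    measurable_fun setT (fun x : seqR R => (`|1 - psum x k.+1|)%:E * G x).
  move=> mG; apply: emeasurable_funM => //.
  by apply/measurable_EFinP; exact: measurable_onem_psum.
rewrite [LHS](inv n (fun x => (`|1 - psum x k.+1|)%:E * F x)); last 3 first.
- by move=> x; exact: N0.
- exact: mN.
- by move=> x y xy; rewrite (dp x y xy) (dF x y xy).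
rewrite [RHS](inv n (fun x => (`|1 - psum x k.+1|)%:E * F (x \o transp k))); last 3 first.
- by move=> x; apply: (N0 x (fun x => F (x \o transp k))) => y; exact: F0.
- exact: (mN (fun x => F (x \o transp k)) (measurableT_comp mF (measurable_reindex (transp k)))).
- move=> x y xy; rewrite (dp x y xy) (dF (x \o transp k) (y \o transp k))// => i i_n.
  by apply: xy; exact: transp_ltn.
have mpk (G : seqR R -> \bar R) : (forall x, 0 <= G x) -> measurable_fun setT G ->
    measurable_fun setT (fun o => picks n (path w o) [::] (fun t => G (sub (path w o) t))).
  by move=> G0 mG; exact: (measurableT_comp (measurable_picks n [::] G0 mG) mp).
apply: (eq_integral_ae aegood).
- by move=> o; apply: picks_ge0 => t; exact: N0.
- by move=> o; apply: picks_ge0 => t; rewrite mule_ge0 ?F0.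
- by apply: (mpk (fun x => (`|1 - psum x k.+1|)%:E * F x)); [move=> x; exact: N0|exact: mN].
- apply: (mpk (fun x => (`|1 - psum x k.+1|)%:E * F (x \o transp k))).
    by move=> x; rewrite mule_ge0 ?F0.
  exact: (mN (fun x => F (x \o transp k)) (measurableT_comp mF (measurable_reindex (transp k)))).
move=> o go; set x := path w o.
have ps t : size t = n -> psum (sub x t) k.+1 = wsum x (take k.+1 t).
  move=> tn; rewrite -wsum_iota /wsum.
  have -> : take k.+1 t = [seq nth 0%N t i | i <- iota 0 k.+1].
    by rewrite map_nth_iota0 ?tn//; exact: ltnW.
  by rewrite [RHS]big_map.
have -> : n = (k + (n0).+2)%N by rewrite /n; lia.
transitivity (picks (k + n0.+2) x [::]
    (fun t => (`|1 - wsum x (take k.+1 t)|)%:E * F (sub x t))).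
  by apply: eq_picks => t tn; rewrite ps// tn /n/=; lia.
rewrite (picks_swap _ (k := k))//; apply: eq_picks => t tn.
have {}tn : size t = n by rewrite tn /n/=; lia.
rewrite ps//; congr (_ * _); apply: dF => i i_n.
by rewrite /sub/= nth_mkseq// tn.
Qed.

End fixed_law.

End swap.

Section swap_picks.
Local Open Scope ereal_scope.
Context {R : realType}.
Implicit Types (x : nat -> R) (s t : seq nat) (n m k i j : nat).
Context d (T : measurableType d) (P : probability T R).
Variable w : nat -> T -> R.
Hypothesis mw : forall j, measurable_fun setT (w j).
Hypothesis aegood : {ae P, forall o, good (path w o)}.
Hypothesis swap : swap_invariant P w.

Let mp := measurable_path mw.

(** Given that the first k picks were the indices below k, these are the probabilities that the next
    one is k + i, respectively at least k + i. *)
Let pick_prob k i x : R := `|x (k + i)%N / (1 - psum x k)|%R.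
Let tail_prob k i x : R := `|(1 - psum x (k + i)%N) / (1 - psum x k)|%R.

Let m_inv k : measurable_fun setT (fun x : seqR R => (1 - psum x k)^-1)%R.
Proof.
apply: (measurableT_comp (@measurable_invr R)).
by apply: measurable_funB => //; exact: measurable_psum.
Qed.

Let m_pick k i : measurable_fun setT (fun x : seqR R => pick_prob k i x).
Proof.
rewrite /pick_prob; apply: measurableT_comp => //; apply: measurable_funM => //.
exact: measurable_coord.
Qed.

Let m_tail k i : measurable_fun setT (fun x : seqR R => tail_prob k i x).
Proof.
rewrite /tail_prob; apply: measurableT_comp => //; apply: measurable_funM => //.
by apply: measurable_funB => //; exact: measurable_psum.
Qed.

Let m_cyc (F : seqR R -> \bar R) k i : measurable_fun setT F ->
  measurable_fun setT (fun x : seqR R => F (x \o cyc k i)).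
Proof. by move=> mF; exact: measurableT_comp mF (measurable_reindex (cyc k i)). Qed.

Let m_path (F : seqR R -> \bar R) : measurable_fun setT F ->
  measurable_fun setT (fun o => F (path w o)).
Proof. by move=> mF; exact: measurableT_comp mF mp. Qed.

Let m_gF (g : seqR R -> R) (F : seqR R -> \bar R) k i :
  measurable_fun setT g -> measurable_fun setT F ->
  measurable_fun setT (fun o => (g (path w o))%:E * F (path w o \o cyc k i)).
Proof.
move=> mg mF; apply: (m_path (F := fun x => (g x)%:E * F (x \o cyc k i))).
by apply: emeasurable_funM; [exact/measurable_EFinP|exact: m_cyc].
Qed.

Let pick0 k i x : 0 <= (pick_prob k i x)%:E.
Proof. by rewrite lee_fin normr_ge0. Qed.

Let tail0 k i x : 0 <= (tail_prob k i x)%:E.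
Proof. by rewrite lee_fin normr_ge0. Qed.

Let psum_cyc x k i : psum (x \o transp (k + i)%N) k = psum x k.
Proof. by rewrite psum_transp// leq_addr. Qed.

(* One step: [1 - S_{k+i} = w_{k+i} + (1 - S_{k+i+1})], then swap [k+i], [k+i+1]. *)
Let tail_step k i (F : seqR R -> \bar R) : (forall x, 0 <= F x) ->
  measurable_fun setT F ->
  \int[P]_o ((tail_prob k i (path w o))%:E * F (path w o \o cyc k i)) =
  \int[P]_o ((pick_prob k i (path w o))%:E * F (path w o \o cyc k i)) +
  \int[P]_o ((tail_prob k i.+1 (path w o))%:E * F (path w o \o cyc k i.+1)).
Proof.
move=> F0 mF.
pose H (x : seqR R) := (`|(1 - psum x k)^-1|)%:E * F (x \o cyc k i).
have H0 x : 0 <= H x by rewrite mule_ge0 ?pick0 ?tail0.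
have mH : measurable_fun setT H.
  apply: emeasurable_funM; last exact: m_cyc.
  by apply/measurable_EFinP; apply: measurableT_comp => //; exact: m_inv.
have tailE x : (tail_prob k i.+1 x)%:E * F (x \o cyc k i.+1) =
    (`|1 - psum x (k + i).+1|)%:E * H (x \o transp (k + i)%N).
  by rewrite /H psum_cyc muleA -EFinM -normrM /tail_prob addnS.
under [X in _ = _ + X]eq_integral do rewrite tailE.
rewrite -(swap (k + i)%N H0 mH) -ge0_integralD//; last 4 first.
- by move=> o _; rewrite mule_ge0 ?pick0 ?tail0.
- exact: m_gF.
- by move=> o _; rewrite mule_ge0 ?pick0 ?tail0.
- apply: (m_path (F := fun x => (`|1 - psum x (k + i).+1|)%:E * H x)).
  by apply: emeasurable_funM => //; apply/measurable_EFinP; exact: (measurable_onem_psum (k + i).+1).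
apply: (eq_integral_ae aegood).
- by move=> o; rewrite mule_ge0 ?pick0 ?tail0.
- by move=> o; rewrite adde_ge0// mule_ge0 ?pick0 ?tail0.
- exact: m_gF.
- apply: emeasurable_funD.
    exact: m_gF.
  apply: (m_path (F := fun x => (`|1 - psum x (k + i).+1|)%:E * H x)).
  by apply: emeasurable_funM => //; apply/measurable_EFinP; exact: (measurable_onem_psum (k + i).+1).
move=> o go; rewrite /H muleA -EFinM -ge0_muleDl; [|exact: pick0|by rewrite lee_fin].
congr (_ * _); apply: (congr1 EFin).
set x := path w o in go *.
have lt1 n : (0 < 1 - psum x n)%R by rewrite subr_gt0 good_psum_lt1.
rewrite -normrM /tail_prob /pick_prob !gtr0_norm ?mulr_gt0 ?invr_gt0//; last exact: go.1.
by rewrite psumS -mulrDl; congr (_ * _)%R; ring.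
Qed.

(** Iterating [tail_step] peels off one term at a time. The remainder carries the tail probability,
    which tends to 0 because the weights sum to 1, and F <= 1 provides the domination. *)
Lemma pick_to_front k (F : seqR R -> \bar R) : (forall x, 0 <= F x) ->
  (forall x, good x -> F x <= 1) -> measurable_fun setT F ->
  \int[P]_o F (path w o) =
  \sum_(i <oo) \int[P]_o ((`|path w o (k + i)%N / (1 - psum (path w o) k)|)%:E *
                          F (path w o \o cyc k i)).
Proof.
move=> F0 F1 mF.
pose a i := \int[P]_o ((pick_prob k i (path w o))%:E * F (path w o \o cyc k i)).
pose r i := \int[P]_o ((tail_prob k i (path w o))%:E * F (path w o \o cyc k i)).
have mt i : measurable_fun setT (fun o => (tail_prob k i (path w o))%:E * F (path w o \o cyc k i)).
  exact: m_gF.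
have a0 i : 0 <= a i by apply: integral_ge0 => o _; rewrite mule_ge0 ?pick0 ?tail0.
have r0 i : 0 <= r i by apply: integral_ge0 => o _; rewrite mule_ge0 ?pick0 ?tail0.
have E n : \int[P]_o F (path w o) = \sum_(i < n) a i + r n.
  elim: n => [|n IHn]; last by rewrite IHn big_ord_recr/= -addeA -(tail_step k n F0 mF).
  rewrite big_ord0 add0e; apply: (eq_integral_ae aegood) => //.
  - by move=> o; rewrite mule_ge0 ?pick0 ?tail0.
  - exact: m_path.
  move=> o go; rewrite /tail_prob addn0 divff ?normr1 ?mul1e//.
  by rewrite subr_eq0 gt_eqF// good_psum_lt1.
have rcvg : r n @[n --> \oo] --> 0.
  have -> : (0 : \bar R) = \int[P]_o cst 0 o by rewrite integral0.
  pose fs n o := (tail_prob k n (path w o))%:E * F (path w o \o cyc k n).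
  have h1 : {ae P, forall o, setT o -> fs ^~ o @ \oo --> cst 0 o}.
    apply: filterS aegood => o go _.
    have tcvg : (tail_prob k n (path w o))%:E @[n --> \oo] --> 0.
      apply: cvg_EFin; first exact: nearW.
      rewrite -[X in _ --> X](normr0 R); apply: cvg_norm.
      rewrite -[X in _ --> X](mul0r (1 - psum (path w o) k)^-1%R).
      apply: cvgM; last exact: cvg_cst.
      rewrite -[X in _ --> X](subrr (1%R : R)); apply: cvgB; first exact: cvg_cst.
      by have := go.2; rewrite -(cvg_shiftn k); under eq_fun do rewrite addnC.
    apply: (@squeeze_cvge _ _ _ _ (cst 0) _ (fun n => (tail_prob k n (path w o))%:E)) => //; last exact: cvg_cst.
    apply: nearW => n; rewrite mule_ge0 ?tail0//= -[leRHS]mule1; apply: lee_wpmul2l; first exact: tail0.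
    by apply: F1; exact: good_cyc.
  have h2 : P.-integrable setT (cst 1 : T -> \bar R).
    exact: finite_measure_integrable_cst.
  have h3 : {ae P, forall o n, setT o -> `|fs n o| <= cst 1 o}.
    apply: filterS aegood => o go n _; rewrite /fs gee0_abs; last by rewrite mule_ge0 ?tail0.
    rewrite -[leRHS]mule1; apply: lee_pmul; [exact: tail0|exact: F0| |by apply: F1; exact: good_cyc].
    have lt1 m : (0 < 1 - psum (path w o) m)%R by rewrite subr_gt0 good_psum_lt1.
    rewrite lee_fin /tail_prob gtr0_norm ?divr_gt0// ler_pdivrMr// mul1r lerB//.
    by rewrite /psum big_split_ord/= lerDl; apply: sumr_ge0 => i _; exact: ltW (go.1 _).
  by have [_ _] := dominated_convergence measurableT mt (measurable_cst _) h1 h2 h3.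
have scvg : \sum_(i < n) a i @[n --> \oo] --> \sum_(i <oo) a i.
  under eq_fun do rewrite -(big_mkord xpredT a).
  by apply: is_cvg_nneseries => n _ _.
have L : (\sum_(i < n) a i + r n) @[n --> \oo] --> \sum_(i <oo) a i + 0.
  by apply: cvgeD => //; rewrite fin_num_adde_defl.
rewrite adde0 (_ : (fun n => _) = cst (\int[P]_o F (path w o))) in L.
  by rewrite -[RHS](cvg_lim (@ereal_hausdorff R) L) lim_cst.
by apply/funext => n; rewrite -E.
Qed.

Lemma swap_picks_invariant n (F : seqR R -> \bar R) :
  (forall x, 0 <= F x <= 1) -> measurable_fun setT F -> depends n F ->
  \int[P]_o F (path w o) =
  \int[P]_o picks n (path w o) [::] (fun t => F (sub (path w o) t)).
Proof.
move=> F01 mF dF; have F0 x : 0 <= F x by have /andP[] := F01 x.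
have mpk m s : measurable_fun setT (fun o => picks m (path w o) s (fun t => F (sub (path w o) t))).
  exact: m_path (measurable_picks m s F0 mF).
(* The first n - m picks are frozen to 0, ..., n - m - 1 and the last m are random: m = 0 gives [F]
   itself and m = n the full sampling. Each step frees one more pick through [pick_to_front]. *)
suff H m : (m <= n)%N -> \int[P]_o picks m (path w o) (iota 0 (n - m)) (fun t => F (sub (path w o) t))
    = \int[P]_o F (path w o) by rewrite -(H n)// subnn.
elim: m => [_|m IHm mn].
  apply: eq_integral => o _ /=; apply: dF => i i_n.
  by rewrite subn0 /sub nth_iota.
rewrite -IHm; last exact: ltnW.
set k := (n - m.+1)%N; have -> : (n - m)%N = k.+1 by rewrite /k; lia.
pose H (x : seqR R) := picks m x (iota 0 k.+1) (fun t => F (sub x t)).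
rewrite [RHS](pick_to_front k (F := H)); last 3 first.
- by move=> x; exact: picks_ge0.
- by move=> x gx; apply: picks_le1 => //; exact: iota_uniq.
- exact: measurable_picks.
have mprod j : measurable_fun setT (fun o => (sbc (path w o) (iota 0 k) j)%:E *
    picks m (path w o) (rcons (iota 0 k) j) (fun t => F (sub (path w o) t))).
  apply: emeasurable_funM => //; apply/measurable_EFinP.
  exact: measurableT_comp (measurable_sbc (iota 0 k) j) mp.
pose g j o := (sbc (path w o) (iota 0 k) j)%:E *
    picks m (path w o) (rcons (iota 0 k) j) (fun t => F (sub (path w o) t)).
have g0 j o : setT o -> 0 <= g j o by move=> _; apply: sbc_picks_ge0.
transitivity (\int[P]_o \sum_(j <oo) g j o); first by [].
rewrite (integral_nneseries P measurableT mprod g0) (nneseries_split 0 k); last first.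
  by move=> j _; apply: integral_ge0 => o _; apply: sbc_picks_ge0.
rewrite add0n big1_seq ?add0e; last first.
  move=> j; rewrite mem_index_iota => /andP[_ jk]; apply: integral0_eq => o _.
  by rewrite /sbc mem_iota jk mul0e.
rewrite -nneseries_addn; last first.
  by move=> j; apply: integral_ge0 => o _; apply: sbc_picks_ge0.
apply: eq_eseriesr => i _; rewrite addnC.
apply: eq_integral => o _; set x := path w o; congr (_%:E * _).
  by rewrite /sbc mem_iota add0n ltnNge leq_addr/= wsum_iota.
rewrite /H -map_cyc -[in LHS](picks_bij m x _ (p := cyc k i)) //; last exact: cyc_bij.
apply: eq_picks => t; rewrite size_iota => tn.
apply: dF => l ln /=; rewrite /sub/= (nth_map 0%N)// tn /k; lia.
Qed.

End swap_picks.

(** * Existence of size-biased permutations *)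

Section cells.
Context {R : realType}.
Implicit Types (x : nat -> R) (s t : seq nat) (n k i j : nat) (u : R).

Definition cum x s j : R := \sum_(i < j) sbc x s i.

(** The probability that the successive picks are the entries of [s]. *)
Definition cell_len x s : R := \prod_(l < size s) sbc x (take l s) (nth 0%N s l).

(* The cells of [rcons s j] for varying [j] subdivide the cell of [s]
   proportionally to the conditional probabilities [sbc x s j]. *)
Definition cell_start x s : R :=
  \sum_(l < size s) cell_len x (take l s) * cum x (take l s) (nth 0%N s l).

Definition cell x s u : bool := (cell_start x s <= u) && (u < cell_start x s + cell_len x s).

Lemma cell_len_rcons x s j : cell_len x (rcons s j) = cell_len x s * sbc x s j.
Proof.
rewrite /cell_len size_rcons big_ord_recr/= nth_rcons ltnn eqxx -cats1 take_size_cat//.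
congr (_ * _); apply: eq_bigr => l _.
by rewrite takel_cat ?nth_cat ?ltn_ord// ltnW.
Qed.

Lemma cell_start_rcons x s j :
  cell_start x (rcons s j) = cell_start x s + cell_len x s * cum x s j.
Proof.
rewrite /cell_start size_rcons big_ord_recr/= nth_rcons ltnn eqxx -cats1 take_size_cat//.
congr (_ + _); apply: eq_bigr => l _.
by rewrite takel_cat ?nth_cat ?ltn_ord// ltnW.
Qed.

Lemma cell_len_ge0 x s : 0 <= cell_len x s.
Proof. by apply: prodr_ge0 => l _; exact: sbc_ge0. Qed.

Lemma cumS x s j : cum x s j.+1 = cum x s j + sbc x s j.
Proof. by rewrite /cum big_ord_recr. Qed.

Lemma cum_le x s i j : (i <= j)%N -> cum x s i <= cum x s j.
Proof.
move=> /subnKC <-; elim: (j - i)%N => [|m IHm]; first by rewrite addn0.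
by rewrite addnS cumS (le_trans IHm)// lerDl sbc_ge0.
Qed.

Lemma cell_rcons x s j u : cell x (rcons s j) u =
  (cell_start x s + cell_len x s * cum x s j <= u) &&
  (u < cell_start x s + cell_len x s * cum x s j.+1).
Proof. by rewrite /cell cell_start_rcons cell_len_rcons cumS mulrDr addrA. Qed.

Lemma cell_rcons_inj x s i j u : cell x (rcons s i) u -> cell x (rcons s j) u -> i = j.
Proof.
wlog ij : i j / (i <= j)%N => [h ci cj|].
  by have [ij|ji] := leqP i j; [exact: h|apply/esym; apply: h => //; exact: ltnW].
move: ij; rewrite leq_eqVlt => /predU1P[//|ij].
rewrite !cell_rcons => /andP[_ ui] /andP[uj _]; exfalso.
have := le_lt_trans uj ui; rewrite ltrD2l.
by have := ler_wpM2l (cell_len_ge0 x s) (cum_le x s ij); rewrite leNgt => /negP.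
Qed.

Lemma cell_nil x u : cell x [::] u = (0 <= u < 1).
Proof. by rewrite /cell /cell_start /cell_len big_ord0 big_ord0 add0r. Qed.

Section good.
Variable x : nat -> R.
Hypothesis gx : good x.

Lemma cell_len_uniq s : cell_len x s != 0 -> uniq s.
Proof.
elim/last_ind: s => [//|s j IHs]; rewrite cell_len_rcons mulf_eq0 negb_or => /andP[/IHs us].
by rewrite rcons_uniq us andbT /sbc; case: (j \in s); rewrite ?eqxx.
Qed.

Lemma cell_uniq s u : cell x s u -> uniq s.
Proof.
move=> /andP[h1 h2]; apply: cell_len_uniq; apply: lt0r_neq0.
by have := le_lt_trans h1 h2; rewrite ltrDl.
Qed.

Lemma cum_le1 s j : uniq s -> cum x s j <= 1.
Proof.
move=> us; rewrite -lee_fin -(nneseries_sbc gx us) -sumEFin.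
rewrite -(big_mkord xpredT (fun i => (sbc x s i)%:E)).
by apply: nneseries_lim_ge => i _ _; rewrite lee_fin sbc_ge0.
Qed.

Lemma cum_gt s (r : R) : uniq s -> r < 1 -> exists j, r < cum x s j.
Proof.
move=> us r1; apply: contrapT => /forallNP h.
have : (\sum_(j <oo) (sbc x s j)%:E <= r%:E)%E.
  apply: lime_le; first by apply: is_cvg_nneseries => n _ _; rewrite lee_fin sbc_ge0.
  apply: nearW => n; rewrite sumEFin big_mkord lee_fin leNgt; apply/negP; exact: h.
by rewrite (nneseries_sbc gx us) lee_fin leNgt r1.
Qed.

Lemma cell_sub s j u : cell x (rcons s j) u -> cell x s u.
Proof.
move=> c; have us : uniq s by have := cell_uniq c; rewrite rcons_uniq => /andP[].
move: c; rewrite cell_rcons => /andP[h1 h2]; apply/andP; split.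
  by apply: le_trans h1; rewrite lerDl mulr_ge0 ?cell_len_ge0//; apply: sumr_ge0 => i _; exact: sbc_ge0.
by apply: (lt_le_trans h2); rewrite lerD2l ler_piMr ?cell_len_ge0// cum_le1.
Qed.

Lemma cell_exists s u : cell x s u -> exists j, cell x (rcons s j) u.
Proof.
move=> c; have us := cell_uniq c.
case/andP: c => h1 h2; have L0 : 0 < cell_len x s.
  by have := le_lt_trans h1 h2; rewrite ltrDl.
(* The relative position of [u] in its cell; the next pick is the first index whose cumulative
   probability exceeds it. *)
pose r := (u - cell_start x s) / cell_len x s.
have r1 : r < 1 by rewrite ltr_pdivrMr// mul1r ltrBlDl.
have r0 : 0 <= r by rewrite divr_ge0 ?subr_ge0// ltW.
have ex : exists j, r < cum x s j by exact: cum_gt.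
case: (ex_minnP ex) => -[|j] rj min.
  by move: rj; rewrite /cum big_ord0 ltNge r0.
exists j; have uE : u = cell_start x s + cell_len x s * r.
  by rewrite /r mulrCA divff ?lt0r_neq0// mulr1 subrKC.
rewrite cell_rcons uE lerD2l ltrD2l ler_pM2l// ltr_pM2l// rj andbT leNgt.
by apply/negP => /min; rewrite ltnn.
Qed.

Lemma cell_start_ge0 s : 0 <= cell_start x s.
Proof.
apply: sumr_ge0 => l _; rewrite mulr_ge0 ?cell_len_ge0//.
by apply: sumr_ge0 => i _; exact: sbc_ge0.
Qed.

Lemma cell_end_le1 s : uniq s -> cell_start x s + cell_len x s <= 1.
Proof.
elim/last_ind: s => [_|s j IHs].
  by rewrite /cell_start /cell_len big_ord0 big_ord0 add0r.
rewrite rcons_uniq => /andP[js us]; apply: le_trans (IHs us).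
rewrite cell_start_rcons cell_len_rcons -addrA -mulrDr -cumS lerD2l.
by rewrite ler_piMr ?cell_len_ge0// cum_le1.
Qed.

End good.

(** The default 0 is reached only if no subcell contains [u], which by [cell_exists] cannot happen
    for good weights and [u] in the cell of [s]. *)
Definition pick x u s : nat := xget 0%N [set j | cell x (rcons s j) u].

Fixpoint prefix x u k : seq nat :=
  if k is k'.+1 then rcons (prefix x u k') (pick x u (prefix x u k')) else [::].

Lemma size_prefix x u k : size (prefix x u k) = k.
Proof. by elim: k => //= k IHk; rewrite size_rcons IHk. Qed.

Lemma pickE x u s j : cell x (rcons s j) u -> pick x u s = j.
Proof.
by move=> c; apply: xget_unique => // i /= ci; exact: cell_rcons_inj ci c.
Qed.

(** The default value has to be described too, because the picks must be measurable on the whole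
    space and not only almost everywhere. *)
Lemma pickP x u s i : (pick x u s == i) = cell x (rcons s i) u ||
  ((i == 0%N) && `[< forall j, ~~ cell x (rcons s j) u >]).
Proof.
have [[j cj]|no] := pselect (exists j, cell x (rcons s j) u).
  rewrite (pickE cj) [X in _ && X]asboolF ?andbF ?orbF; last by move=> /(_ j); rewrite cj.
  apply/eqP/idP => [<-//|ci]; exact: cell_rcons_inj cj ci.
have no' j : cell x (rcons s j) u = false by apply/negP => c; apply: no; exists j.
rewrite no' asboolT ?andbT/=; last by move=> j; rewrite no'.
rewrite eq_sym; congr (_ == _); apply: xgetPN => j /=.
by rewrite no'.
Qed.

Lemma prefix_cell x u s : good x -> 0 <= u < 1 ->
  (prefix x u (size s) = s) <-> cell x s u.
Proof.
move=> gx u01; elim/last_ind: s => [|s j IHs]; first by rewrite cell_nil.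
rewrite size_rcons /=; split=> [/rcons_inj[ps pj]|c].
  have [i ci] := cell_exists gx (IHs.1 ps).
  by move: pj; rewrite ps (pickE ci) => <-.
have /IHs -> := cell_sub gx c.
by rewrite (pickE c).
Qed.

Lemma prefix_nth x u k l : (l < k)%N ->
  nth 0%N (prefix x u k) l = pick x u (prefix x u l).
Proof.
elim: k => // k IHk; rewrite ltnS leq_eqVlt => /predU1P[->|lk] /=.
  by rewrite nth_rcons size_prefix ltnn eqxx.
by rewrite nth_rcons size_prefix lk IHk.
Qed.

Lemma prefixE x u s : (prefix x u (size s) = s) <->
  (forall l, (l < size s)%N -> pick x u (prefix x u l) = nth 0%N s l).
Proof.
split=> [ps l ls|h]; first by rewrite -[in RHS]ps prefix_nth.
apply: (@eq_from_nth _ 0%N); rewrite size_prefix// => l ls.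
by rewrite prefix_nth// h.
Qed.

End cells.

Section size_biased_existence.
Local Open Scope ereal_scope.
Context {R : realType} d (T : measurableType d) (P : probability T R).
Implicit Types (s t : seq nat).
Variable w : nat -> T -> R.
Hypothesis mw : forall j, measurable_fun setT (w j).
Hypothesis aegood : {ae P, forall o, good (path w o)}.

(** A single independent uniform variable drives all the picks: the k-th one is read off from the
    cell of depth k + 1 that contains it. *)
Let U : probability (measurableTypeR R) R := uniform_prob (@ltr01 R).
Let TU : measurableType _ := (T * measurableTypeR R)%type.
Let Q : probability TU R := (P \x U)%E.
Let w' j (z : TU) : R := w j z.1.
Let rho k (z : TU) : nat := pick (path w z.1) z.2 (prefix (path w z.1) z.2 k).

Let mw' j : measurable_fun setT (w' j).
Proof. exact: measurableT_comp (mw j) measurable_fst. Qed.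

Let mp' : measurable_fun setT (fun z : TU => path w z.1).
Proof. by apply: (measurable_path mw'). Qed.

Let m_cum s j : measurable_fun setT (fun x : seqR R => cum x s j).
Proof. by apply: measurable_sum => i; exact: measurable_sbc. Qed.

Let m_len s : measurable_fun setT (fun x : seqR R => cell_len x s).
Proof. by apply: measurable_prod => i _; exact: measurable_sbc. Qed.

Let m_start s : measurable_fun setT (fun x : seqR R => cell_start x s).
Proof. by apply: measurable_sum => i; apply: measurable_funM. Qed.

Let m_snd : measurable_fun setT (fun z : TU => z.2 : R).
Proof. exact: (@measurable_snd _ _ T (measurableTypeR R)). Qed.

Let m_cell s : measurable [set z : TU | cell (path w z.1) s z.2].
Proof.
rewrite (_ : [set z : TU | _] = [set z : TU | (cell_start (path w z.1) s <= z.2)%R] `&`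
  [set z : TU | (z.2 < cell_start (path w z.1) s + cell_len (path w z.1) s)%R]).
  have ms := measurableT_comp (m_start s) mp'; have ml := measurableT_comp (m_len s) mp'.
  apply: measurableI; first exact: (measurable_le_set ms m_snd).
  exact: (measurable_lt_set m_snd (measurable_funD ms ml)).
by apply/seteqP; split => z /=; rewrite /cell; [move=> /andP[]|move=> [-> ->]].
Qed.

Let m_pick s i : measurable [set z : TU | pick (path w z.1) z.2 s = i].
Proof.
rewrite (_ : [set z : TU | _] = [set z : TU | cell (path w z.1) (rcons s i) z.2] `|`
  (if i == 0%N then \bigcap_j ~` [set z : TU | cell (path w z.1) (rcons s j) z.2] else set0)).
  apply: measurableU => //; case: ifP => // _.
  by apply: bigcapT_measurable => j; exact: measurableC.
apply/seteqP; split => z /=.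
  move=> /eqP; rewrite pickP => /orP[c|/andP[i0 /asboolP h]]; [by left|right].
  by rewrite i0 => j _ /=; apply/negP; exact: h.
move=> h; apply/eqP; rewrite pickP; case: h => [->//|].
case: ifP => [_ h|//]; apply/orP; right => /=; apply/asboolP => j.
by apply/negP; exact: (h j Logic.I).
Qed.

Let m_prefix s : measurable [set z : TU | prefix (path w z.1) z.2 (size s) = s].
Proof.
elim/last_ind: s => [|s j IHs]; first by rewrite (_ : [set z | _] = setT)//; apply/seteqP; split.
rewrite (_ : [set z : TU | _] = [set z : TU | prefix (path w z.1) z.2 (size s) = s] `&`
  [set z : TU | pick (path w z.1) z.2 s = j]); first exact: (measurableI _ _ IHs (m_pick s j)).
apply/seteqP; split => z /=; rewrite size_rcons /=.
  by move=> /rcons_inj[h]; rewrite h.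
by move=> [h]; rewrite h => ->.
Qed.

Let mrho k i : measurable (rho k @^-1` [set i]).
Proof.
(* There are countably many lists of length k, enumerated by [unpickle]; on each of them the pick is
   a measurable function. *)
pose F n : set TU := if (unpickle n : option (seq nat)) is Some s then
   if size s == k then [set z : TU | prefix (path w z.1) z.2 (size s) = s] `&`
   [set z : TU | pick (path w z.1) z.2 s = i] else set0 else set0.
have mF n : measurable (F n).
  rewrite /F; case: (unpickle n) => [s|] //.
  by case: ifP => _ //; exact: (measurableI _ _ (m_prefix s) (m_pick s i)).
rewrite (_ : _ @^-1` _ = \bigcup_n F n); first exact: bigcupT_measurable.
apply/seteqP; split => z /=.
  move=> ri; exists (pickle (prefix (path w z.1) z.2 k)) => //.
  by rewrite /F pickleK !size_prefix eqxx.
move=> [n _]; rewrite /F; case: (unpickle n) => // s; case: eqP => // <- [/= ps pi].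
by rewrite /rho ps.
Qed.

Let startsE s : starts rho s = [set z : TU | prefix (path w z.1) z.2 (size s) = s].
Proof. by apply/seteqP; split => z /= /prefixE. Qed.

Let U_cell x s : good x -> measurable ([set u | prefix x u (size s) = s] : set R) ->
  U [set u | prefix x u (size s) = s] = (cell_len x s)%:E.
Proof.
move=> gx mA; set A := [set u | _] in mA *.
have mfA : measurable_fun setT (fun u : R => (\1_A u)%:E : \bar R) by exact: measurable_indicE.
have mA' : measurable (A : set (measurableTypeR R)) by [].
rewrite -(integral_indic_prob U mA') (@integral_uniform R 0 1 ltr01 _ mfA); last first.
  by move=> u; rewrite lee_fin.
rewrite subr0 invr1 mul1e -integral_itv_bndo_bndc; last by exact: measurable_funTS mfA.
rewrite integral_indic//.
rewrite (_ : A `&` _ = `[cell_start x s, (cell_start x s + cell_len x s)%R[%classic).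
  rewrite [LHS]lebesgue_measure_itv/= lte_fin; case: ltP => [_|].
    by rewrite -EFinB addrC addKr.
  rewrite -[leRHS]addr0 lerD2l => l0; congr EFin.
  by apply/eqP; rewrite eq_le cell_len_ge0.
apply/seteqP; split => u /=.
  move=> [Au]; rewrite !in_itv/= => u01; exact: (prefix_cell s gx u01).1.
rewrite !in_itv/= => c.
have u01 : (0 <= u < 1)%R.
  case/andP: (c) => h1 h2; rewrite (le_trans (cell_start_ge0 x s) h1)/=.
  by apply: (lt_le_trans h2); apply: cell_end_le1 => //; exact: cell_uniq c.
by split=> //; exact: (prefix_cell s gx u01).2.
Qed.

(** Fubini: for fixed good weights the uniform variable produces the list [s] exactly when it falls
    in the cell of [s]. *)
Let Q_starts (C : set T) s : measurable C ->
  Q ((fun z : TU => z.1) @^-1` C `&` starts rho s) =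
  \int[P]_o ((\1_C o)%:E * (cell_len (path w o) s)%:E).
Proof.
move=> mC; set S := _ `&` _.
have mS : measurable S.
  apply: measurableI; last by rewrite startsE; exact: m_prefix.
  by rewrite -[X in measurable X]setTI; exact: (@measurable_fst _ _ T (measurableTypeR R)).
have ml : measurable_fun setT (fun o => cell_len (path w o) s).
  exact: measurableT_comp (m_len s) (measurable_path mw).
rewrite [LHS](_ : _ = \int[P]_o U (xsection S o))//.
apply: (eq_integral_ae aegood).
- by [].
- by move=> o; rewrite mule_ge0// lee_fin cell_len_ge0.
- exact: measurable_fun_xsection.
- by apply: emeasurable_funM; [exact: measurable_indicE|exact/measurable_EFinP].
move=> o go; rewrite indicE; have [oC|oC] := boolP (o \in C).
  rewrite mul1e; have mX := measurable_xsection o mS.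
  have XE : xsection S o = [set u | prefix (path w o) u (size s) = s].
    apply/seteqP; split => u /=; rewrite xsectionE /S startsE/=; first by move=> [].
    by move=> h; split => //; exact/set_mem.
  by rewrite XE U_cell//; rewrite XE in mX.
rewrite mul0e (_ : xsection S o = set0) ?measure0//.
apply/seteqP; split => u //=; rewrite xsectionE /S /= => -[Co _].
by move/negP: oC; apply; exact/mem_set.
Qed.

Let Q_starts_fun s (f : T -> \bar R) : (forall o, 0 <= f o) -> measurable_fun setT f ->
  \int[Q]_z ((\1_(starts rho s) z)%:E * f z.1) =
  \int[P]_o ((cell_len (path w o) s)%:E * f o).
Proof.
have mst : measurable (starts rho s) by rewrite startsE; exact: m_prefix.
have ml : measurable_fun setT (fun o => cell_len (path w o) s).
  exact: measurableT_comp (m_len s) (measurable_path mw).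
have pf1 : posfun (fun f : T -> \bar R => \int[Q]_z ((\1_(starts rho s) z)%:E * f z.1)).
  exact: (posfun_comp (posfun_integral Q measurableT) measurable_fst (g := \1_(starts rho s))).
have pf2 : posfun (fun f : T -> \bar R => \int[P]_o ((cell_len (path w o) s)%:E * f o)).
  apply: (posfun_comp (posfun_integral P measurableT) (@measurable_id _ _ _)) => // o.
  exact: cell_len_ge0.
apply: (posfun_ext pf1 pf2) => C mC.
have mC' : measurable ((fun z : TU => z.1) @^-1` C).
  by rewrite -[X in measurable X]setTI; exact: (@measurable_fst _ _ T (measurableTypeR R)).
under [RHS]eq_integral do rewrite muleC.
rewrite -Q_starts// -integral_indic_prob; last exact: measurableI.
by apply: eq_integral => z _; rewrite indicI/= -EFinM mulrC.
Qed.

Let law_w' : same_law P w Q w'.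
Proof.
move=> n A mA; set C := [set o | _].
have mC : measurable C.
  rewrite -[X in measurable X]setTI.
  exact: (measurable_path mw measurableT (measurable_cylinder n mA)).
rewrite (_ : [set z : TU | _] = C `*` setT); last by apply/seteqP; split => [z h|z [h _]].
rewrite [RHS](product_measure1E P U mC measurableT) [X in _ = _ * X](_ : _ = 1) ?mule1//.
exact: (probability_setT U).
Qed.

Let aegood' : {ae Q, forall z, good (path w z.1)}.
Proof. exact: (same_law_ae mw mw' law_w' measurable_good aegood). Qed.

Lemma size_biased_exists : exists (d' : measure_display) (T' : measurableType d')
    (Q' : probability T' R) (v' : nat -> T' -> R) (r : nat -> T' -> nat),
  [/\ forall j, measurable_fun setT (v' j),
      forall k i, measurable (r k @^-1` [set i]),
      same_law P w Q' v' & size_biased_perm Q' v' r].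
Proof.
exists _, TU, Q, w', rho; split; [exact: mw'|exact: mrho|exact: law_w'|].
move=> k j n A idx mA /=.
pose s := mkseq idx k; have sk : size s = k by rewrite size_mkseq.
have idxE l : (l < k)%N -> nth 0%N s l = idx l by move=> lk; rewrite nth_mkseq.
pose C := [set o | forall i, (i < n)%N -> A i (w i o)].
have mC : measurable C.
  rewrite -[X in measurable X]setTI.
  exact: (measurable_path mw measurableT (measurable_cylinder n mA)).
have stE : [set z | forall l, (l < k)%N -> rho l z = idx l] = starts rho s.
  apply/seteqP; split => z /= h l lk.
    by rewrite idxE ?h// -sk.
  by rewrite h ?sk// idxE.
set E := [set z | _ /\ _]; have EE : E = (fun z : TU => z.1) @^-1` C `&` starts rho s.
  by rewrite -stE.
have mst t : measurable (starts rho t) by rewrite startsE; exact: m_prefix.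
have mC' : measurable ((fun z : TU => z.1) @^-1` C).
  by rewrite -[X in measurable X]setTI; exact: (@measurable_fst _ _ T (measurableTypeR R)).
have mE : measurable E by rewrite EE; exact: measurableI.
have ml t : measurable_fun setT (fun o => cell_len (path w o) t).
  exact: measurableT_comp (m_len t) (measurable_path mw).
have mI : measurable_fun setT (fun o => (\1_C o)%:E : \bar R) by exact: measurable_indicE.
have -> : E `&` [set z | rho k z = j] = (fun z : TU => z.1) @^-1` C `&` starts rho (rcons s j).
  by rewrite starts_rcons sk EE setIA.
rewrite Q_starts//.
pose h (x : seqR R) : R := if (wsum x s < 1)%R then
  (if j \in s then 0 else x j / (1 - wsum x s))%R
  else (if j == first_free (nth 0%N s) (size s) then 1 else 0)%R.
have mh : measurable_fun setT h.
  apply: measurable_fun_ifT.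
  - by apply: measurable_fun_ltr => //; exact: measurable_wsum.
  - case: (j \in s); first exact: measurable_cst.
    apply: measurable_funM; first exact: measurable_coord.
    exact: measurableT_comp (@measurable_invr R) (measurable_onem_wsum s).
  - exact: measurable_cst.
have mhw : measurable_fun setT (fun z : TU => (h (path w z.1))%:E).
  by apply/measurable_EFinP; exact: measurableT_comp mh mp'.
transitivity (\int[Q]_(z in E) (h (path w z.1))%:E); last first.
  apply: eq_integral => z; rewrite inE EE => -[_ sz]; congr EFin.
  rewrite -{1}sk; apply/esym; exact: sb_cond_list.
(* A list with a repetition has a cell of length zero, so both sides vanish. *)
have [us|us] := boolP (uniq s); last first.
  have z0 t : ~~ uniq t -> \int[P]_o ((\1_C o)%:E * (cell_len (path w o) t)%:E) = 0.
    move=> ut; rewrite -[RHS](integral0 P setT); apply: (eq_integral_ae aegood) => //.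
    - by move=> o; rewrite mule_ge0// lee_fin cell_len_ge0.
    - by apply: emeasurable_funM => //; exact/measurable_EFinP.
    move=> o go; have [->|/cell_len_uniq] := eqVneq (cell_len (path w o) t) 0%R.
      by rewrite mule0.
    by rewrite (negbTE ut).
  rewrite z0; last by rewrite rcons_uniq negb_and us orbT.
  have QE0 : Q E = 0 by rewrite EE Q_starts// z0.
  by rewrite null_set_integral//; exact: measurable_funTS.
have msb : measurable_fun setT (fun x : seqR R => sbc x s j) by exact: measurable_sbc.
have msw : measurable_fun setT (fun o => (\1_C o * sbc (path w o) s j)%:E).
  apply/measurable_EFinP; apply: measurable_funM; first exact: measurable_indic.
  exact: measurableT_comp msb (measurable_path mw).
transitivity (\int[P]_o ((cell_len (path w o) s)%:E * (\1_C o * sbc (path w o) s j)%:E)).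
  by apply: eq_integral => o _; rewrite -!EFinM cell_len_rcons; congr EFin; ring.
rewrite -(Q_starts_fun s (f := fun o => (\1_C o * sbc (path w o) s j)%:E))//; last first.
  by move=> o; rewrite lee_fin mulr_ge0// sbc_ge0.
rewrite -[RHS]integral_indic_mul//; apply: ae_eq_integral => //.
- apply: emeasurable_funM; first exact: measurable_indicE.
  exact: (measurableT_comp msw (@measurable_fst _ _ T (measurableTypeR R))).
- by apply: emeasurable_funM => //; exact: measurable_indicE.
apply: filterS aegood' => z gz _; rewrite -!EFinM EE indicI/=; congr EFin.
rewrite /h good_wsum_lt1//; have [js|js] := boolP (j \in s).
  by rewrite /sbc js !(mulr0, mul0r).
by rewrite sbc_good// [X in (_ = X * _ * _)%R]indicE [X in (_ * (X * _) = _)%R]indicE; ring.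
Qed.

End size_biased_existence.

(** * Exchange of consecutive length variables *)

Section invariance.
Local Open Scope ereal_scope.
Context {R : realType} d (T : measurableType d) (P : probability T R).
Variable w : nat -> T -> R.
Hypothesis mw : forall j, measurable_fun setT (w j).
Hypothesis aegood : {ae P, forall o, good (path w o)}.

(** The hypothesis speaks about spaces that carry a size-biased permutation: [size_biased_exists]
    supplies one and [picks_formula] eliminates it again. *)
Lemma sbp_invariant_swap : sbp_invariant P w -> swap_invariant P w.
Proof.
move=> inv; apply: picks_swap_invariant => // n F F0 mF dF.
have [d' [T' [Q [w' [r [mw' mr law sb]]]]]] := size_biased_exists mw aegood.
have aegood' : {ae Q, forall z, good (path w' z)} :=
  same_law_ae mw mw' law measurable_good aegood.
have mr' := measurable_reordered mw' mr.
rewrite -(same_law_integral mr' mw (inv _ _ _ _ _ mw' mr law sb) F0 mF).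
rewrite (picks_formula mw' mr aegood' sb F0 mF dF).
rewrite (same_law_integral mw mw' law (F := fun x => picks n x [::] (fun t => F (sub x t))))//.
- by move=> x; exact: picks_ge0.
- exact: measurable_picks.
Qed.

Lemma swap_sbp_invariant : swap_invariant P w -> sbp_invariant P w.
Proof.
move=> swap d' T' Q w' r mw' mr law sb n A mA.
have aegood' : {ae Q, forall z, good (path w' z)} :=
  same_law_ae mw mw' law measurable_good aegood.
have mr' := measurable_reordered mw' mr.
pose F (x : seqR R) : \bar R := (\1_(cylinder n A) x)%:E.
have F0 x : 0 <= F x by rewrite lee_fin.
have F01 x : 0 <= F x <= 1.
  by rewrite F0/= lee_fin indicE; case: (_ \in _).
have mF : measurable_fun setT F by apply: measurable_indicE; exact: (measurable_cylinder n mA).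
have dF : depends n F.
  move=> x y xy; rewrite /F !indicE; congr ((_ : bool)%:R%:E).
  by apply/idP/idP; rewrite !inE => h i i_n; have := h i i_n; rewrite xy.
have cE d1 (T1 : measurableType d1) (P1 : probability T1 R) (Z : nat -> T1 -> R) :
    (forall j, measurable_fun setT (Z j)) ->
    P1 [set o | forall i, (i < n)%N -> A i (Z i o)] = \int[P1]_o F (path Z o).
  move=> mZ; have mC : measurable (path Z @^-1` cylinder n A).
    rewrite -[X in measurable X]setTI.
    exact: (measurable_path mZ measurableT (measurable_cylinder n mA)).
  by rewrite -(integral_indic_prob P1 mC); apply: eq_integral => o _; rewrite /F !indicE.
rewrite (cE _ _ _ _ mr') (cE _ _ _ _ mw).
rewrite (picks_formula mw' mr aegood' sb F0 mF dF).
rewrite (swap_picks_invariant mw aegood swap F01 mF dF).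
rewrite (same_law_integral mw mw' law (F := fun x => picks n x [::] (fun t => F (sub x t))))//.
- by move=> x; exact: picks_ge0.
- exact: measurable_picks.
Qed.

End invariance.

Section sticks.
Context {R : realType}.
Implicit Types (y x : nat -> R) (i j k n : nat).

Definition weights y : nat -> R := fun j => y j * \prod_(i < j) (1 - y i).

Definition good_sticks y : Prop := (forall j, 0 < y j < 1) /\ good (weights y).

Lemma path_weights d (T : measurableType d) (v : nat -> T -> R) o :
  path (sb_weights v) o = weights (path v o).
Proof. by []. Qed.

Lemma onem_psum_weights y n : 1 - psum (weights y) n = \prod_(i < n) (1 - y i).
Proof.
elim: n => [|n IHn]; first by rewrite /psum !big_ord0 subr0.
by rewrite psumS big_ord_recr/= -IHn opprD addrA IHn /weights; ring.
Qed.

(** The length variables of the weights with w_k and w_{k+1} exchanged. What remains of the stick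
    after both breaks is the same, so all the other length variables are unchanged. *)
Definition stick_swap k y : nat -> R := fun i =>
  if i == k then (1 - y k) * y k.+1
  else if i == k.+1 then y k / (1 - (1 - y k) * y k.+1) else y i.

Lemma stick_swap_lt k y i : (i < k)%N -> stick_swap k y i = y i.
Proof. by move=> ik; rewrite /stick_swap !ifF//; apply/eqP; lia. Qed.

Lemma stick_swap_gt k y i : (k.+1 < i)%N -> stick_swap k y i = y i.
Proof. by move=> ik; rewrite /stick_swap !ifF//; apply/eqP; lia. Qed.

Lemma stick_swap_k k y : stick_swap k y k = (1 - y k) * y k.+1.
Proof. by rewrite /stick_swap eqxx. Qed.

Lemma stick_swap_k1 k y : stick_swap k y k.+1 = y k / (1 - (1 - y k) * y k.+1).
Proof. by rewrite /stick_swap eqxx ifF//; apply/eqP; lia. Qed.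

Lemma prod_stick_swap k y n : (n <= k)%N ->
  \prod_(i < n) (1 - stick_swap k y i) = \prod_(i < n) (1 - y i).
Proof.
move=> nk; apply: eq_bigr => i _.
by rewrite stick_swap_lt// (leq_trans (ltn_ord i)).
Qed.

Section two_sticks.
Variables (k : nat) (y : nat -> R).
Hypotheses (y0 : 0 < y k < 1) (y1 : 0 < y k.+1 < 1).

Lemma stick_swap_den : 0 < 1 - (1 - y k) * y k.+1.
Proof.
case/andP: y0 => a b; case/andP: y1 => c e; rewrite subr_gt0 mulr_ilt1//.
- by rewrite subr_ge0 ltW.
- exact: ltW.
- by rewrite ltrBlDr ltrDl.
Qed.

Lemma stick_swap_01 : 0 < stick_swap k y k < 1 /\ 0 < stick_swap k y k.+1 < 1.
Proof.
have D := stick_swap_den.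
case/andP: (y0) => a b; case/andP: (y1) => c e.
rewrite stick_swap_k stick_swap_k1; split; apply/andP; split.
- by rewrite mulr_gt0// subr_gt0.
- by rewrite -subr_gt0.
- by rewrite divr_gt0.
- by rewrite ltr_pdivrMr// mul1r; nra.
Qed.

Lemma stick_swap_onem :
  (1 - stick_swap k y k) * (1 - stick_swap k y k.+1) = (1 - y k) * (1 - y k.+1).
Proof.
rewrite stick_swap_k stick_swap_k1; field; exact/lt0r_neq0/stick_swap_den.
Qed.

Lemma stick_swapK : stick_swap k (stick_swap k y) = y.
Proof.
have D := stick_swap_den; have [/andP[s0 s1] _] := stick_swap_01.
case/andP: y0 => a b.
apply/funext => i; rewrite {1}/stick_swap; have [->|ik] := eqVneq i k.
  rewrite stick_swap_k stick_swap_k1; field; exact: lt0r_neq0.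
have [->|ik1] := eqVneq i k.+1; last by rewrite /stick_swap (negbTE ik) (negbTE ik1).
rewrite stick_swap_k stick_swap_k1.
have E : 1 - (1 - (1 - y k) * y k.+1) * (y k / (1 - (1 - y k) * y k.+1)) = 1 - y k.
  by field; exact: lt0r_neq0.
by rewrite E; field; rewrite subr_eq0 gt_eqF.
Qed.

Lemma weights_stick_swap : weights (stick_swap k y) = weights y \o transp k.
Proof.
have D := stick_swap_den.
apply/funext => i /=; rewrite /weights.
have [ik|ki|->] := ltngtP i k.
- by rewrite transp_lt// stick_swap_lt// prod_stick_swap// ltnW.
- have [->|ik1] := eqVneq i k.+1.
    rewrite /transp eqxx ifF; last by apply/eqP; lia.
    rewrite big_ord_recr/= prod_stick_swap// stick_swap_k stick_swap_k1.
    by field; exact: lt0r_neq0.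
  have ki2 : (k.+1 < i)%N by lia.
  rewrite /transp !ifF; [|by apply/eqP; lia|by apply/eqP; lia].
  rewrite stick_swap_gt//; congr (_ * _).
  have [m {i ki ik1 ki2}->] : exists m, i = (k.+2 + m)%N by exists (i - k.+2)%N; lia.
  elim: m => [|m IHm].
    rewrite addn0 !big_ord_recr/= prod_stick_swap// -!mulrA; congr (_ * _).
    exact: stick_swap_onem.
  by rewrite addnS big_ord_recr [RHS]big_ord_recr/= IHm stick_swap_gt//; lia.
- by rewrite /transp eqxx stick_swap_k prod_stick_swap// big_ord_recr/=; ring.
Qed.

End two_sticks.

Definition sticks x : nat -> R := fun j => x j / (1 - psum x j).

Lemma weightsK y : (forall j, y j < 1) -> sticks (weights y) = y.
Proof.
move=> y1; apply/funext => j; rewrite /sticks onem_psum_weights /weights mulfK//.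
by apply/prodf_neq0 => i _; rewrite subr_eq0 gt_eqF.
Qed.

Lemma good_sticks_swap k y : good_sticks y -> good_sticks (stick_swap k y).
Proof.
move=> [y01 gw]; split; last by rewrite weights_stick_swap//; exact: good_transp.
move=> j; have [s0 s1] := stick_swap_01 (y01 k) (y01 k.+1).
have [->//|jk] := eqVneq j k; have [->//|jk1] := eqVneq j k.+1.
by rewrite /stick_swap (negbTE jk) (negbTE jk1).
Qed.

Lemma measurable_weights : measurable_fun setT (weights : seqR R -> seqR R).
Proof.
apply: measurable_seqR => j; apply: measurable_funM; first exact: measurable_coord.
by apply: measurable_prod => i _; apply: measurable_funB => //; exact: measurable_coord.
Qed.

Lemma measurable_sticks : measurable_fun setT (sticks : seqR R -> seqR R).
Proof.
apply: measurable_seqR => j; apply: measurable_funM; first exact: measurable_coord.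
apply: (measurableT_comp (@measurable_invr R)).
by apply: measurable_funB => //; exact: measurable_psum.
Qed.

Lemma measurable_stick_swap k : measurable_fun setT (stick_swap k : seqR R -> seqR R).
Proof.
have m1 : measurable_fun setT (fun y : seqR R => (1 - y k) * y k.+1).
  apply: measurable_funM; last exact: measurable_coord.
  by apply: measurable_funB => //; exact: measurable_coord.
apply: measurable_seqR => j; rewrite /stick_swap.
case: (j == k) => //; case: (j == k.+1); last exact: measurable_coord.
apply: measurable_funM; first exact: measurable_coord.
apply: (measurableT_comp (@measurable_invr R)).
exact: measurable_funB.
Qed.

Section law.
Local Open Scope ereal_scope.
Context d (T : measurableType d) (P : probability T R) (v : nat -> T -> R).
Hypothesis mv : forall j, measurable_fun setT (v j).
Hypothesis aegood : {ae P, forall o, good_sticks (path v o)}.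

(* The invariance [swap_invariant] expressed with the length variables. *)
Definition stick_invariant k : Prop := forall H : seqR R -> \bar R,
  (forall y, 0 <= H y) -> measurable_fun setT H ->
  \int[P]_o ((`|1 - v k o|)%:E * H (path v o)) =
  \int[P]_o ((`|1 - v k o|)%:E * H (stick_swap k (path v o))).

Let mp := measurable_path mv.

Let mH (H : seqR R -> \bar R) (f : seqR R -> seqR R) (g : seqR R -> R) :
  measurable_fun setT H -> measurable_fun setT f -> measurable_fun setT g ->
  measurable_fun setT (fun o => (`|g (path v o)|)%:E * H (f (path v o))).
Proof.
move=> mH mf mg.
apply: (measurableT_comp (f := fun y : seqR R => (`|g y|)%:E * H (f y))) mp => //.
apply: emeasurable_funM; last exact: measurableT_comp.
by apply/measurable_EFinP; exact: measurableT_comp.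
Qed.

Let m_onem k : measurable_fun setT (fun y : seqR R => 1 - y k)%R.
Proof. by apply: measurable_funB => //; exact: measurable_coord. Qed.

Let m_psum n : measurable_fun setT (fun y : seqR R => 1 - psum (weights y) n)%R.
Proof.
apply: measurable_funB => //.
exact: measurableT_comp (measurable_psum n) measurable_weights.
Qed.

Lemma measurable_sb_weights j : measurable_fun setT (sb_weights v j).
Proof. exact: measurableT_comp (measurable_coord j) (measurableT_comp measurable_weights mp).
Qed.

Let mw := measurable_sb_weights.

(** The density 1 - w_0 - ... - w_k is the product of the 1 - v_i for i <= k. The factors with i < k
    are fixed by the exchange and are divided out by the test function [F], which leaves 1 - v_k. *)
Lemma swap_stick_invariant : swap_invariant P (sb_weights v) -> forall k, stick_invariant k.
Proof.
move=> swap k H H0 mH'.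
pose F (x : seqR R) := (`|(1 - psum x k)^-1|)%:E * H (sticks x).
have F0 x : 0 <= F x by rewrite mule_ge0.
have mF : measurable_fun setT F.
  apply: emeasurable_funM; last exact: measurableT_comp mH' measurable_sticks.
  apply/measurable_EFinP; apply: measurableT_comp => //.
  apply: (measurableT_comp (@measurable_invr R)).
  by apply: measurable_funB => //; exact: measurable_psum.
have prod0 y : good_sticks y -> (0 < \prod_(i < k) (1 - y i))%R.
  by move=> [y01 _]; apply: prodr_gt0 => i _; have /andP[_] := y01 i; rewrite subr_gt0.
have cancel y : good_sticks y -> (`|1 - psum (weights y) k.+1| *
    `|(1 - psum (weights y) k)^-1| = `|1 - y k|)%R.
  move=> gy; rewrite !onem_psum_weights -normrM big_ord_recr/=; congr (`|_|)%R.
  by field; exact/lt0r_neq0/prod0.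
have mFw : measurable_fun setT (fun o => (`|1 - psum (path (sb_weights v) o) k.+1|)%:E * F (path (sb_weights v) o)).
  exact: (mH mF measurable_weights (m_psum k.+1)).
have mFt : measurable_fun setT (fun o => (`|1 - psum (path (sb_weights v) o) k.+1|)%:E * F (path (sb_weights v) o \o transp k)).
  exact: (mH mF (measurableT_comp (measurable_reindex (transp k)) measurable_weights) (m_psum k.+1)).
transitivity (\int[P]_o ((`|1 - psum (path (sb_weights v) o) k.+1|)%:E * F (path (sb_weights v) o))).
  apply: (eq_integral_ae aegood) => //.
  - by move=> o; rewrite mule_ge0.
  - by move=> o; rewrite mule_ge0.
  - exact: (mH (f := id) mH' (@measurable_id _ _ _) (m_onem k)).
  move=> o go; rewrite /F path_weights weightsK; last by move=> j; have /andP[] := go.1 j.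
  by rewrite muleA -EFinM cancel.
rewrite swap//; apply: (eq_integral_ae aegood) => //.
- by move=> o; rewrite mule_ge0.
- by move=> o; rewrite mule_ge0.
- exact: (mH mH' (measurable_stick_swap k) (m_onem k)).
move=> o go; have gs := good_sticks_swap k go.
rewrite /F path_weights -weights_stick_swap; [|exact: go.1|exact: go.1].
rewrite weightsK; last by move=> j; have /andP[] := gs.1 j.
rewrite (_ : psum (weights (stick_swap k (path v o))) k = psum (weights (path v o)) k).
  by rewrite muleA -EFinM cancel.
by rewrite weights_stick_swap ?psum_transp//; exact: go.1.
Qed.

Lemma stick_swap_invariant : (forall k, stick_invariant k) -> swap_invariant P (sb_weights v).
Proof.
move=> inv k F F0 mF.
pose H (y : seqR R) := (`|\prod_(i < k) (1 - y i)|)%:E * F (weights y).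
have mprod : measurable_fun setT (fun y : seqR R => \prod_(i < k) (1 - y i))%R.
  by apply: measurable_prod => i _; exact: m_onem.
have H0 y : 0 <= H y by rewrite mule_ge0.
have mH' : measurable_fun setT H.
  apply: emeasurable_funM; last exact: measurableT_comp mF measurable_weights.
  by apply/measurable_EFinP; exact: measurableT_comp.
have E y : (`|1 - y k| * `|\prod_(i < k) (1 - y i)| = `|1 - psum (weights y) k.+1|)%R.
  by rewrite onem_psum_weights big_ord_recr/= normrM mulrC.
transitivity (\int[P]_o ((`|1 - v k o|)%:E * H (path v o))).
  by apply: eq_integral => o _; rewrite /H muleA -EFinM E.
rewrite inv//; apply: (eq_integral_ae aegood) => //.
- by move=> o; rewrite mule_ge0.
- by move=> o; rewrite mule_ge0.
- exact: (mH mH' (measurable_stick_swap k) (m_onem k)).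
- exact: (mH mF (measurableT_comp (measurable_reindex (transp k)) measurable_weights) (m_psum k.+1)).
move=> o go; rewrite /H muleA -EFinM prod_stick_swap// E.
by rewrite weights_stick_swap//; exact: go.1.
Qed.

End law.

End sticks.

(** * Independent beta length variables *)

Section beta_swap.
Local Open Scope ereal_scope.
Context {R : realType}.
Local Notation mu := (@lebesgue_measure R).
Local Notation RR := (measurableTypeR R * measurableTypeR R)%type.
Implicit Types (a b c x y q : R).

Lemma integral_indic_lebesgue (D A : set R) : measurable D -> measurable A ->
  \int[mu]_(x in D) (\1_A x)%:E = mu (A `&` D).
Proof.
move=> mD mA; have mD' : measurable (D : set (measurableTypeR R)) by [].
have mA' : measurable (A : set (measurableTypeR R)) by [].
exact: (@integral_indic _ _ R (@lebesgue_measure R) D mD' A mA').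
Qed.

Lemma lebesgue_itvoo x y : mu `]x, y[%classic = (Num.max 0 (y - x))%:E.
Proof.
rewrite lebesgue_measure_itv/= lte_fin; case: ltP => xy.
  by rewrite -EFinB (max_idPr _)// subr_ge0 ltW.
by rewrite (max_idPl _)// subr_le0.
Qed.

(** Both sides are positive functionals of [f], so it suffices to compare the lengths of the images
    of rays. *)
Lemma lebesgue_scale c (f : R -> \bar R) : (0 < c)%R ->
  (forall x, 0 <= f x) -> measurable_fun setT f ->
  \int[mu]_(y in `]0%R, 1%R[) f y = c^-1%:E * \int[mu]_(q in `]0%R, c[) f (q / c)%R.
Proof.
move=> c0 f0 mf; have ci0 : (0 <= c^-1)%R by rewrite invr_ge0 ltW.
have mdiv : measurable_fun setT (fun q : R => q / c)%R.
  by apply: measurable_funM => //; exact: measurable_cst.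
pose Psi (f : R -> \bar R) := \int[mu]_(q in `]0%R, c[) (c^-1%:E * f (q / c)%R).
have pf1 : posfun (fun f : R -> \bar R => \int[mu]_(x in `]0%R, 1%R[) f x).
  exact: posfun_lebesgue.
have pf2 : posfun Psi.
  apply: (@posfun_comp _ _ R R R (fun f => \int[mu]_(q in `]0%R, c[) f q) (fun q => q / c)%R (fun=> c^-1%R)) => //.
  exact: posfun_lebesgue.
have itv0 r : mu `]0%R, r[%classic = (Num.max 0 r)%:E by rewrite lebesgue_itvoo subr0.
have cst1 r : \int[mu]_(x in `]0%R, r[) 1 = (Num.max 0 r)%:E.
  rewrite -itv0 -[X in mu X]setTI -integral_indic_lebesgue//.
  by apply: eq_integral => x _; rewrite indicE mem_set.
have PZ (h : R -> \bar R) : (forall x, 0 <= h x) -> measurable_fun setT h ->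
    Psi h = c^-1%:E * \int[mu]_(q in `]0%R, c[) h (q / c)%R.
  move=> h0 mh; apply: (posfunZ (posfun_lebesgue (D := `]0%R, c[%classic) (measurable_itv _)) (k := c^-1%R) (f := fun q => h (q / c)%R)) => //.
  exact: measurableT_comp mh mdiv.
rewrite -PZ//; apply: (posfun_unique_ray pf1 pf2) f0 mf => /=.
- by rewrite cst1 ltry.
- rewrite (PZ (fun=> 1) (fun=> lee01) (measurable_cst _)).
  by rewrite !cst1 -EFinM !(max_idPr _) ?ler01 ?(ltW c0)// mulVf// lt0r_neq0.
move=> t; rewrite integral_indic_lebesgue// PZ//; last exact: measurable_indicE.
rewrite (_ : `]t, +oo[%classic `&` _ = `]Num.max 0%R t, 1%R[%classic); last first.
  by apply/seteqP; split => x /=; rewrite !in_itv/= andbT gt_max;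
    [move=> [-> /andP[-> ->]]|move=> /andP[/andP[-> ->] ->]].
rewrite (_ : \int[mu]_(q in `]0%R, c[) (\1_(`]t, +oo[%classic : set R) (q / c)%R)%:E =
    \int[mu]_(q in `]0%R, c[) (\1_(`](t * c)%R, +oo[%classic : set R) q)%:E); last first.
  apply: eq_integral => q _; rewrite !indicE; congr ((_ : bool)%:R%:E).
  by rewrite !mem_setE/= !in_itv/= !andbT ltr_pdivlMr.
rewrite integral_indic_lebesgue//.
rewrite (_ : `](t * c)%R, +oo[%classic `&` _ = `]Num.max 0%R (t * c)%R, c[%classic); last first.
  by apply/seteqP; split => x /=; rewrite !in_itv/= andbT gt_max;
    [move=> [-> /andP[-> ->]]|move=> /andP[/andP[-> ->] ->]].
rewrite !lebesgue_itvoo -EFinM; congr EFin.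
have -> : (Num.max 0 (t * c) = Num.max 0 t * c)%R.
  by rewrite maxr_pMl ?mul0r// ltW.
set m := Num.max 0%R t; have -> : (Num.max 0 (c - m * c) = Num.max 0 (1 - m) * c)%R.
  by rewrite [RHS]maxr_pMl ?(ltW c0)// mul0r mulrBl mul1r.
by rewrite mulrCA mulVf ?mulr1// lt0r_neq0.
Qed.

Definition bdens a b x : R := if (0 < x < 1)%R then beta_dens a b x else 0%R.

Lemma bdens_ge0 a b x : (0 <= bdens a b x)%R.
Proof. by rewrite /bdens; case: ifP => // _; exact: beta_dens_ge0. Qed.

Lemma bdensE a b x : bdens a b x = (beta_dens a b x * \1_(`]0%R, 1%R[%classic : set R) x)%R.
Proof.
rewrite /bdens indicE mem_setE/= in_itv/=.
by case: ifP => _; rewrite ?mulr1 ?mulr0.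
Qed.

Lemma measurable_bdens a b : measurable_fun setT (bdens a b).
Proof.
rewrite (_ : bdens a b = fun x => beta_dens a b x * \1_(`]0%R, 1%R[%classic : set R) x)%R.
  by apply: measurable_funM; [exact: measurable_beta_dens|exact: measurable_indic].
by apply/funext => x; exact: bdensE.
Qed.

Lemma integral_bdens a b (f : R -> \bar R) :
  \int[mu]_x ((bdens a b x)%:E * f x) = \int[mu]_(x in `]0%R, 1%R[) ((beta_dens a b x)%:E * f x).
Proof.
rewrite [RHS]integral_mkcond; apply: eq_integral => x _.
by rewrite patchE /bdens mem_setE/= in_itv/=; case: ifP => _ //; rewrite mul0e.
Qed.

(** The unnormalised Dirichlet density with parameters (a, a, c); the equality of the first two
    parameters is the source of its symmetry. *)
Definition simplex_dens a c x q : R := if [&& 0 < x, 0 < q & x + q < 1]%R then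
  (x `^ (a - 1) * q `^ (a - 1) * (1 - x - q) `^ (c - 1))%R else 0%R.

Lemma simplex_densC a c x q : simplex_dens a c x q = simplex_dens a c q x.
Proof.
rewrite /simplex_dens andbCA addrC; case: ifP => // _.
by rewrite [X in (X * _)%R]mulrC [(1 - x - q)%R]addrAC.
Qed.

Lemma simplex_dens_ge0 a c x q : (0 <= simplex_dens a c x q)%R.
Proof. by rewrite /simplex_dens; case: ifP => // _; rewrite !mulr_ge0// powR_ge0. Qed.

(** The second parameter b + 1 - a is the one for which all powers of 1 - x cancel, the density 1 -
    x and the Jacobian 1 / (1 - x) included. *)
Lemma simplex_densE a b x q : (0 < x < 1)%R ->
  (beta_dens a b x * (1 - x) * ((1 - x)^-1 * (if (0 < q < 1 - x)%R then
     beta_dens a (b + 1 - a) (q / (1 - x)) else 0)) = simplex_dens a (b + 1 - a) x q)%R.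
Proof.
move=> /andP[x0 x1]; rewrite /simplex_dens x0/= ltrBrDl.
case: ifP => [/andP[q0 qx]|]; last by rewrite !mulr0.
have c0 : (0 < 1 - x)%R by rewrite subr_gt0.
have cn : (1 - x != 0)%R by rewrite lt0r_neq0.
rewrite mulrA mulfK// /beta_dens.
have qc : (0 <= 1 - x - q)%R by rewrite -addrA -opprD subr_ge0 ltW.
have -> : (1 - q / (1 - x) = (1 - x - q) / (1 - x))%R by field.
have ci : (0 <= (1 - x)^-1)%R by rewrite invr_ge0 ltW.
rewrite !powRM ?(ltW q0)//.
have inv p : ((1 - x)^-1 `^ p = (1 - x) `^ (- p))%R.
  by rewrite -powR_inv1 ?(ltW c0)// -powRrM mulN1r.
rewrite !inv.
have one : ((1 - x) `^ (b - 1) * (1 - x) `^ (- (a - 1)) * (1 - x) `^ (- (b + 1 - a - 1)) = 1)%R.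
  rewrite -!powRD ?cn ?implybT// [X in (_ `^ X)%R](_ : _ = 0%R) ?powRr0//; by ring.
by rewrite -[RHS]mulr1 -[X in _ = (_ * X)%R]one; ring.
Qed.

Let mR2 (f : RR -> R) (g : RR -> R) : measurable_fun setT f -> measurable_fun setT g ->
  measurable_fun setT (fun z => (f z, g z) : RR).
Proof. by move=> mf mg; apply: measurable_fun_pair. Qed.

Let m1 : measurable_fun setT (fun z : RR => z.1 : R).
Proof. exact: (@measurable_fst _ _ (measurableTypeR R) (measurableTypeR R)). Qed.

Let m2 : measurable_fun setT (fun z : RR => z.2 : R).
Proof. exact: (@measurable_snd _ _ (measurableTypeR R) (measurableTypeR R)). Qed.

Lemma measurable_simplex_dens a c : measurable_fun setT (fun z : RR => simplex_dens a c z.1 z.2).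
Proof.
rewrite /simplex_dens; apply: measurable_fun_ifT.
- apply: measurable_and; first exact: measurable_fun_ltr.
  apply: measurable_and; first exact: measurable_fun_ltr.
  by apply: measurable_fun_ltr => //; exact: measurable_funD.
- apply: measurable_funM; first apply: measurable_funM.
  + exact: measurableT_comp (measurable_powR _) m1.
  + exact: measurableT_comp (measurable_powR _) m2.
  + apply: (measurableT_comp (measurable_powR _)).
    by apply: measurable_funB => //; exact: measurable_funB.
- exact: measurable_cst.
Qed.

Lemma beta_simplex a b (g : RR -> \bar R) : (forall z, 0 <= g z) -> measurable_fun setT g ->
  \int[mu]_x ((bdens a b x * `|1 - x|)%:E *
     \int[mu]_y ((bdens a (b + 1 - a) y)%:E * g (x, (1 - x) * y)%R)) =
  \int[mu]_x \int[mu]_q ((simplex_dens a (b + 1 - a) x q)%:E * g (x, q)).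
Proof.
move=> g0 mg; apply: eq_integral => x _; have [x01|x01] := boolP (0 < x < 1)%R; last first.
  rewrite /bdens (negbTE x01) mul0r mul0e; apply/esym.
  rewrite integral0_eq// => q _; rewrite /simplex_dens ifF ?mul0e//.
  apply/negP => /and3P[x0 q0 xq]; move/negP: x01; apply; rewrite x0/=.
  by apply: lt_trans xq; rewrite ltrDl.
have [x0 x1] := andP x01; have c0 : (0 < 1 - x)%R by rewrite subr_gt0.
rewrite integral_bdens.
pose h y : \bar R := (beta_dens a (b + 1 - a) y)%:E * g (x, (1 - x) * y)%R.
have h0 y : 0 <= h y by rewrite mule_ge0// lee_fin beta_dens_ge0.
have mgx : measurable_fun setT (fun q : R => g (x, q)).
  exact: (measurableT_comp mg (pair1_measurable x)).
have mh : measurable_fun setT h.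
  apply: emeasurable_funM; first by apply/measurable_EFinP; exact: measurable_beta_dens.
  apply: (measurableT_comp mgx); apply: measurable_funM => //; exact: measurable_cst.
rewrite (lebesgue_scale c0 h0 mh) muleA -EFinM.
have K0 : (0 <= bdens a b x * `|1 - x| * (1 - x)^-1)%R.
  by rewrite mulr_ge0// ?mulr_ge0// ?bdens_ge0// invr_ge0 ltW.
have mdiv : measurable_fun setT (fun q : R => q / (1 - x))%R.
  by apply: measurable_funM => //; exact: measurable_cst.
rewrite -(posfunZ (posfun_lebesgue (D := `]0%R, (1 - x)%R[%classic) (measurable_itv _)) (f := fun q => h (q / (1 - x))%R) K0)//; last first.
  exact: measurableT_comp mh mdiv.
rewrite integral_mkcond; apply: eq_integral => q _.
rewrite patchE mem_setE/= in_itv/= -simplex_densE// /bdens x01 gtr0_norm//.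
case: ifP => [/andP[q0 qx]|_]; last by rewrite !mulr0 mul0e.
rewrite /h muleA -EFinM; have -> : ((1 - x) * (q / (1 - x)) = q)%R.
  by field; exact: lt0r_neq0.
by rewrite !mulrA.
Qed.

(* In the coordinates [(p, q) = (x, (1 - x) y)] the density is symmetric. *)
Lemma beta_swap a b (G : RR -> \bar R) : (forall z, 0 <= G z) -> measurable_fun setT G ->
  \int[mu]_x ((bdens a b x * `|1 - x|)%:E *
     \int[mu]_y ((bdens a (b + 1 - a) y)%:E * G (x, y))) =
  \int[mu]_x ((bdens a b x * `|1 - x|)%:E *
     \int[mu]_y ((bdens a (b + 1 - a) y)%:E *
        G ((1 - x) * y, x / (1 - (1 - x) * y))%R)).
Proof.
move=> G0 mG.
have mdiv : measurable_fun setT (fun z : RR => z.2 / (1 - z.1))%R.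
  apply: measurable_funM => //; apply: (measurableT_comp (@measurable_invr R)).
  exact: measurable_funB.
pose g (z : RR) := G (z.1, z.2 / (1 - z.1))%R.
have mg : measurable_fun setT g by apply: (measurableT_comp mG); exact: mR2.
have mg' : measurable_fun setT (fun z : RR => g (z.2, z.1)).
  by apply: (measurableT_comp mg); exact: mR2.
have g0 z : 0 <= g z by exact: G0.
transitivity (\int[mu]_x ((bdens a b x * `|1 - x|)%:E *
     \int[mu]_y ((bdens a (b + 1 - a) y)%:E * g (x, (1 - x) * y)%R))).
  apply: eq_integral => x _; have [x1|x1] := eqVneq (1 - x)%R 0%R.
    by rewrite x1 normr0 mulr0 !mul0e.
  congr (_ * _); apply: eq_integral => y _; congr (_ * G (_, _)).
  by rewrite /= mulrAC divff ?mul1r.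
rewrite beta_simplex//.
transitivity (\int[mu]_x \int[mu]_q ((simplex_dens a (b + 1 - a) x q)%:E * g (q, x))); last first.
  by apply/esym; exact: (beta_simplex a b (g := fun z => g (z.2, z.1)) (fun z => g0 _) mg').
rewrite (@fubini_tonelli _ _ (measurableTypeR R) (measurableTypeR R) R mu mu (fun z => (simplex_dens a (b + 1 - a) z.1 z.2)%:E * g z)).
- by apply: eq_integral => x _; apply: eq_integral => q _; rewrite simplex_densC.
- by apply: emeasurable_funM => //; apply/measurable_EFinP; exact: measurable_simplex_dens.
- by move=> z; rewrite mule_ge0// lee_fin simplex_dens_ge0.
Qed.

End beta_swap.

(** * Integrals against independent pairs *)

Section independence.
Local Open Scope ereal_scope.
Context d (T : measurableType d) (R : realType) (P : probability T R).
Context dS dU (S : measurableType dS) (U : measurableType dU).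
Variables (X : T -> S) (Y : T -> U).
Hypotheses (mX : measurable_fun setT X) (mY : measurable_fun setT Y).
Implicit Types G : (S * U)%type -> \bar R.

Lemma posfun_eq_on (Phi Psi : ((S * U)%type -> \bar R) -> \bar R) : posfun Phi ->
  (forall f, (forall x, 0 <= f x) -> measurable_fun setT f -> Phi f = Psi f) -> posfun Psi.
Proof.
move=> [h0 hD hZ hc] E; split.
- by move=> f f0 mf; rewrite -E//; exact: h0.
- move=> f g f0 mf g0 mg; rewrite -!E//; first exact: hD.
    by move=> x; exact: adde_ge0.
  exact: emeasurable_funD.
- move=> k f k0 f0 mf; rewrite -!E//; first exact: hZ.
    by move=> x; rewrite mule_ge0.
  by apply: emeasurable_funM.
move=> f_ f f0 mf nd cf; rewrite -E.
- under eq_fun do rewrite -E//.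
  exact: hc.
- move=> x; rewrite -(cvg_lim _ (cf x))//; apply: lime_ge; first by apply/cvg_ex; exists (f x).
  by apply: nearW => n.
- apply: (emeasurable_fun_cvg f_) => // x _; exact: cf.
Qed.

Lemma measurable_partial G : (forall z, 0 <= G z) -> measurable_fun setT G ->
  measurable_fun setT (fun x => \int[P]_o G (x, Y o)).
Proof.
move=> G0 mG; pose F (z : S * T) := G (z.1, Y z.2).
have mF : measurable_fun setT F.
  by apply: (measurableT_comp mG); apply: measurable_fun_pair => //; exact: measurableT_comp.
exact: (@measurable_fun_fubini_tonelli_F _ _ S T R P F mF (fun z => G0 _)).
Qed.

Lemma posfun_prod : posfun (fun G => \int[P]_o \int[P]_o' G (X o, Y o')).
Proof.
have mXY : measurable_fun setT (fun z : T * T => (X z.1, Y z.2)).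
  by apply: measurable_fun_pair; exact: measurableT_comp.
have hP := posfun_integral (P \x P) (@measurableT _ (T * T)%type).
apply: (posfun_eq_on (posfun_pull hP mXY)) => G G0 mG.
rewrite (fubini_tonelli1 (m1 := P) (m2 := P) (fun z : T * T => G (X z.1, Y z.2)))//.
by apply: measurableT_comp.
Qed.

Lemma posfun_rectangles (Phi Psi : ((S * U)%type -> \bar R) -> \bar R) :
  posfun Phi -> posfun Psi -> Phi (fun=> 1) < +oo ->
  (forall A B, measurable A -> measurable B ->
     Phi (fun z => (\1_(A `*` B) z)%:E) = Psi (fun z => (\1_(A `*` B) z)%:E)) ->
  forall G, (forall x, 0 <= G x) -> measurable_fun setT G -> Phi G = Psi G.
Proof.
move=> hPhi hPsi Phi1 h.
apply: (posfun_unique (G := [set A `*` B | A in measurable & B in measurable]) hPhi hPsi) => //.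
- exact: measurable_prod_measurableType.
- move=> _ _ [A1 mA1 [A2 mA2 <-]] [B1 mB1 [B2 mB2 <-]].
  exists (A1 `&` B1); first exact: measurableI.
  by exists (A2 `&` B2); [exact: measurableI|rewrite setXI].
- by exists setT => //; exists setT => //; rewrite setXTT.
- by move=> _ [A mA [B mB <-]]; exact: h.
Qed.

Lemma prod_rectangle A B : measurable A -> measurable B ->
  \int[P]_o \int[P]_o' (\1_(A `*` B) (X o, Y o'))%:E = P (X @^-1` A) * P (Y @^-1` B).
Proof.
move=> mA mB.
have mYB : measurable (Y @^-1` B) by rewrite -[X in measurable X]setTI; exact: mY.
have mXA : measurable (X @^-1` A) by rewrite -[X in measurable X]setTI; exact: mX.
rewrite muleC -[P (X @^-1` A)]integral_indic_prob//.
rewrite -[P (Y @^-1` B)]fineK ?fin_num_measure//.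
rewrite -(posfunZ (posfun_integral P measurableT))//; first last.
- exact: measurable_indicE.
- by rewrite fine_ge0.
apply: eq_integral => o _; rewrite fineK ?fin_num_measure// -integral_indic_prob//.
rewrite muleC -(posfunZ (posfun_integral P measurableT))//; last exact: measurable_indicE.
apply: eq_integral => o' _; rewrite -EFinM !indicE in_setX/= -natrM mulnb.
by congr (_%:R%:E); rewrite /mem /= /in_mem /= /in_set.
Qed.

(** [W] collects the constraints on the remaining coordinates, so that only the pair is integrated
    against the product law. *)
Lemma independent_integral (W : set T) : measurable W ->
  (forall A B, measurable A -> measurable B ->
     P (W `&` (X @^-1` A `&` Y @^-1` B)) = P W * (P (X @^-1` A) * P (Y @^-1` B))) ->
  forall G, (forall z, 0 <= G z) -> measurable_fun setT G ->
  \int[P]_o ((\1_W o)%:E * G (X o, Y o)) = P W * \int[P]_o \int[P]_o' G (X o, Y o').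
Proof.
move=> mW ind G G0 mG.
have W0 : (0 <= fine (P W))%R by rewrite fine_ge0.
have PW : (fine (P W))%:E = P W by rewrite fineK ?fin_num_measure.
have hI := posfun_integral P (@measurableT _ T).
have mXY : measurable_fun setT (fun o => (X o, Y o)) by exact: measurable_fun_pair.
have h1 : posfun (fun G => \int[P]_o ((\1_W o)%:E * G (X o, Y o))).
  by apply: (posfun_comp hI mXY) => //; exact: measurable_indic.
have h2 : posfun (fun G => (fine (P W))%:E * \int[P]_o \int[P]_o' G (X o, Y o')).
  apply: (posfun_eq_on (posfun_comp posfun_prod (@measurable_id _ _ _) (g := fun=> fine (P W)) (fun=> W0) (measurable_cst _))).
  by move=> f f0 mf; rewrite (posfunZ posfun_prod).
rewrite -PW; apply: (posfun_rectangles h1 h2) => //.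
- rewrite (eq_integral (fun o => (\1_W o)%:E)); last by move=> o _; rewrite mule1.
  by rewrite integral_indic_prob//; exact: le_lt_trans (probability_le1 P mW) (ltry _).
move=> A B mA mB.
have mYB : measurable (Y @^-1` B) by rewrite -[X in measurable X]setTI; exact: mY.
have mXA : measurable (X @^-1` A) by rewrite -[X in measurable X]setTI; exact: mX.
rewrite prod_rectangle// PW -ind// -integral_indic_prob; last first.
  by apply: measurableI => //; exact: measurableI.
apply: eq_integral => o _; rewrite -EFinM indicI /=; congr (_ * _)%:E.
Qed.

End independence.

Section beta_law.
Local Open Scope ereal_scope.
Context {R : realType} d (T : measurableType d) (P : probability T R).
Local Notation mu := (@lebesgue_measure R).
Implicit Types (X : T -> R) (a b : R).

Lemma beta_law_int X a b : beta_law P X a b <->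
  forall A : set R, measurable A ->
    P (X @^-1` A) = \int[mu]_x ((bdens a b x)%:E * (\1_A x)%:E) * (beta_int a b)^-1.
Proof.
have E (A : set R) : measurable A -> \int[mu]_(x in A `&` `]0%R, 1%R[) (beta_dens a b x)%:E =
    \int[mu]_x ((bdens a b x)%:E * (\1_A x)%:E).
  move=> mA; rewrite integral_mkcond; apply: eq_integral => x _.
  rewrite patchE in_setI mem_setE/= in_itv/= /bdens indicE.
  by case: (x \in A) => /=; case: ifP; rewrite ?mule1 ?mule0 ?mul0e.
by split => h A mA; [rewrite -E//|rewrite E//]; exact: h.
Qed.

Lemma posfun_bdens a b : posfun (fun f : R -> \bar R => \int[mu]_x ((bdens a b x)%:E * f x)).
Proof.
have hI : posfun (fun f : R -> \bar R => \int[mu]_x f x).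
  exact: posfun_lebesgue.
exact: (posfun_comp hI (@measurable_id _ R _) (bdens_ge0 a b) (measurable_bdens a b)).
Qed.

Lemma beta_law_integral X a b : (0 < a)%R -> (0 < b)%R -> measurable_fun setT X ->
  beta_law P X a b -> forall f : R -> \bar R, (forall x, 0 <= f x) -> measurable_fun setT f ->
  \int[P]_o f (X o) = ((betaR a b)^-1)%:E * \int[mu]_x ((bdens a b x)%:E * f x).
Proof.
move=> a0 b0 mX /beta_law_int law f f0 mf.
have hb : posfun (fun f : R -> \bar R => \int[mu]_x ((bdens a b x)%:E * f x)) by exact: posfun_bdens.
have bi0 : (0 <= (betaR a b)^-1)%R by rewrite invr_ge0 ltW// betaR_gt0.
have h2 : posfun (fun f : R -> \bar R => \int[mu]_x ((bdens a b x)%:E * (((betaR a b)^-1)%:E * f x))).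
  exact: (posfun_comp hb (@measurable_id _ R _) (fun=> bi0) (measurable_cst _)).
rewrite -(posfunZ hb)//.
apply: (posfun_ext (posfun_pull (posfun_integral P measurableT) mX) h2) => // A mA.
rewrite (posfunZ hb)//; last exact: measurable_indicE.
rewrite muleC; have := law A mA; rewrite betaRE// inver (negbTE (lt0r_neq0 (betaR_gt0 a0 b0))) => <-.
rewrite -integral_indic_prob; last by rewrite -[X in measurable X]setTI; exact: mX.
by [].
Qed.

End beta_law.

Section beta_invariance.
Local Open Scope ereal_scope.
Context {R : realType} d (T : measurableType d) (P : probability T R).
Local Notation RR := (measurableTypeR R * measurableTypeR R)%type.
Implicit Types (X Y : T -> R) (a b : R) (G : RR -> \bar R).

Definition pair_swap (z : RR) : RR := ((1 - z.1) * z.2, z.1 / (1 - (1 - z.1) * z.2))%R.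

Lemma measurable_fst_R : measurable_fun setT (fun z : RR => z.1 : R).
Proof. exact: (@measurable_fst _ _ (measurableTypeR R) (measurableTypeR R)). Qed.

Lemma measurable_snd_R : measurable_fun setT (fun z : RR => z.2 : R).
Proof. exact: (@measurable_snd _ _ (measurableTypeR R) (measurableTypeR R)). Qed.

Lemma measurable_onem_fst : measurable_fun setT (fun z : RR => 1 - z.1 : R)%R.
Proof. by apply: measurable_funB => //; exact: measurable_fst_R. Qed.

Lemma measurable_pair_swap : measurable_fun setT pair_swap.
Proof.
have m1 : measurable_fun setT (fun z : RR => (1 - z.1) * z.2 : R)%R.
  by apply: measurable_funM; [exact: measurable_onem_fst|exact: measurable_snd_R].
apply: measurable_fun_pair; first exact: m1.
apply: measurable_funM; first exact: measurable_fst_R.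
apply: (measurableT_comp (@measurable_invr R)).
exact: measurable_funB.
Qed.

Lemma integral_le1_lty (f : T -> \bar R) : measurable_fun setT f ->
  (forall o, 0 <= f o <= 1) -> \int[P]_o f o < +oo.
Proof.
move=> mf f01; apply: (@le_lt_trans _ _ (\int[P]_o cst 1 o)).
  apply: ge0_le_integral => //.
  - by move=> o ?; have /andP[] := f01 o.
  - by move=> o ?; have /andP[] := f01 o.
rewrite integral_cst// mul1e.
exact: le_lt_trans (probability_le1 P measurableT) (ltry _).
Qed.

Lemma beta_pair_swap X Y a b : (0 < a)%R -> (0 < b)%R -> (0 < b + 1 - a)%R ->
  measurable_fun setT X -> measurable_fun setT Y ->
  beta_law P X a b -> beta_law P Y a (b + 1 - a) ->
  forall G, (forall z, 0 <= G z) -> measurable_fun setT G ->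
  \int[P]_o ((`|1 - X o|)%:E * \int[P]_o' G (X o, Y o')) =
  \int[P]_o ((`|1 - X o|)%:E * \int[P]_o' G (pair_swap (X o, Y o'))).
Proof.
move=> a0 b0 b'0 mX mY lX lY.
set c := betaR a (b + 1 - a)%R.
have c0 : (0 < c)%R by exact: betaR_gt0.
have E G : (forall z, 0 <= G z) -> measurable_fun setT G ->
    \int[P]_o ((`|1 - X o|)%:E * \int[P]_o' G (X o, Y o')) =
    ((betaR a b)^-1)%:E * ((c^-1)%:E * \int[lebesgue_measure]_x ((bdens a b x * `|1 - x|)%:E *
     \int[lebesgue_measure]_y ((bdens a (b + 1 - a) y)%:E * G (x, y)))).
  move=> G0 mG; pose I (x : R) := \int[P]_o' G (x, Y o').
  have I0 x : 0 <= I x by apply: integral_ge0.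
  have mI : measurable_fun setT I.
    exact: (measurable_partial (S := measurableTypeR R) (U := measurableTypeR R) P mY G0 mG).
  have mh : measurable_fun setT (fun x : R => (`|1 - x|)%:E * I x).
    apply: emeasurable_funM => //; apply/measurable_EFinP; apply: measurableT_comp => //.
    exact: measurable_funB.
  rewrite (beta_law_integral a0 b0 mX lX (f := fun x => (`|1 - x|)%:E * I x))//; last first.
    by move=> x; rewrite mule_ge0.
  congr (_ * _).
  have IE x : \int[lebesgue_measure]_y ((bdens a (b + 1 - a) y)%:E * G (x, y)) = c%:E * I x.
    rewrite /I (beta_law_integral a0 b'0 mY lY (f := fun y => G (x, y)))//.
      by rewrite muleA -EFinM divff ?mul1e// lt0r_neq0.
    exact: (measurableT_comp mG (pair1_measurable (T1 := measurableTypeR R) (T2 := measurableTypeR R) x)).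
  have -> : \int[lebesgue_measure]_x ((bdens a b x * `|1 - x|)%:E *
     \int[lebesgue_measure]_y ((bdens a (b + 1 - a) y)%:E * G (x, y))) =
     \int[lebesgue_measure]_x ((bdens a b x)%:E * (c%:E * ((`|1 - x|)%:E * I x))).
    by apply: eq_integral => x _; rewrite IE EFinM -muleA; congr (_ * _); exact: muleCA.
  rewrite (posfunZ (posfun_bdens a b) (k := c) (f := fun x => (`|1 - x|)%:E * I x))//; first last.
  - by move=> x; rewrite mule_ge0.
  - exact: ltW.
  by rewrite muleA -EFinM mulVf ?mul1e// lt0r_neq0.
move=> G G0 mG; rewrite (E G G0 mG) (E (fun z => G (pair_swap z)) (fun z => G0 _) (measurableT_comp mG measurable_pair_swap)).
by rewrite beta_swap.
Qed.

Variable v : nat -> T -> R.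
Hypothesis mv : forall j, measurable_fun setT (v j).
Hypothesis v01 : forall j o, (0 <= v j o <= 1)%R.

Lemma posfun_stick k : posfun (fun H : seqR R -> \bar R => \int[P]_o ((`|1 - v k o|)%:E * H (path v o))).
Proof.
apply: (posfun_comp (posfun_integral P measurableT) (measurable_path mv)) => //.
by apply: measurableT_comp => //; exact: measurable_funB.
Qed.

Lemma posfun_stick_swap k : posfun (fun H : seqR R -> \bar R =>
  \int[P]_o ((`|1 - v k o|)%:E * H (stick_swap k (path v o)))).
Proof.
apply: (posfun_comp (posfun_integral P measurableT) (measurableT_comp (measurable_stick_swap k) (measurable_path mv))) => //.
by apply: measurableT_comp => //; exact: measurable_funB.
Qed.

Lemma stick_total k : \int[P]_o ((`|1 - v k o|)%:E * 1) < +oo.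
Proof.
apply: integral_le1_lty.
  apply: emeasurable_funM => //; apply/measurable_EFinP.
  by apply: measurableT_comp => //; exact: measurable_funB.
move=> o; rewrite mule1 !lee_fin normr_ge0 ler_norml.
by have /andP[] := v01 k o; lra.
Qed.

Lemma independent_sticks k n (B : nat -> set R) : (k.+1 < n)%N -> (forall i, measurable (B i)) ->
  mutually_independent P v ->
  let W := [set o | forall i, (i < n)%N -> i != k -> i != k.+1 -> B i (v i o)] in
  measurable W /\ forall C D, measurable C -> measurable D ->
    P (W `&` (v k @^-1` C `&` v k.+1 @^-1` D)) = P W * (P (v k @^-1` C) * P (v k.+1 @^-1` D)).
Proof.
move=> kn mB ind W.
pose E C D i := if i == k then C else if i == k.+1 then D else B i : set R.
have mE C D i : measurable C -> measurable D -> measurable (E C D i).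
  by rewrite /E => mC mD; case: (i == k) => //; case: (i == k.+1).
have WE C D : W `&` (v k @^-1` C `&` v k.+1 @^-1` D) =
    [set o | forall i, (i < n)%N -> E C D i (v i o)].
  apply/seteqP; split => o /=.
    move=> [Wo [Co Do]] i ilt; rewrite /E.
    by have [->//|ik] := eqVneq i k; have [->//|ik1] := eqVneq i k.+1; exact: Wo.
  move=> h; split=> [i ilt ik ik1|].
    by have := h i ilt; rewrite /E (negbTE ik) (negbTE ik1).
  split; first by have := h k (ltnW kn); rewrite /E eqxx.
  by have := h k.+1 kn; rewrite /E eqxx ifF//; apply/eqP; lia.
have WT : W = W `&` (v k @^-1` setT `&` v k.+1 @^-1` setT) by rewrite !preimage_setT !setIT.
pose k' := Ordinal (ltnW kn); pose k1' := Ordinal kn.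
pose q := \prod_(i < n | (i != k') && (i != k1')) P (v i @^-1` B i).
have PE C D : measurable C -> measurable D ->
    P (W `&` (v k @^-1` C `&` v k.+1 @^-1` D)) = P (v k @^-1` C) * (P (v k.+1 @^-1` D) * q).
  move=> mC mD; rewrite WE ind; last by move=> i; exact: mE.
  rewrite (bigD1 k')//= {1}/E eqxx (bigD1 k1')/=; last by apply/eqP => /(congr1 val)/=; lia.
  rewrite /E eqxx ifF; last by apply/eqP; lia.
  congr (_ * (_ * _)); apply: eq_bigr => i /andP[ik ik1].
  rewrite !ifF//; apply/negbTE.
    by apply: contra ik1 => /eqP h; apply/eqP/val_inj.
  by apply: contra ik => /eqP h; apply/eqP/val_inj.
have PW : P W = q.
  rewrite WT PE// !preimage_setT probability_setT !mul1e//.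
split; last by move=> C D mC mD; rewrite PE// PW muleA muleC.
rewrite WT WE (_ : [set o | _] = path v @^-1` cylinder n (E setT setT))//.
rewrite -[X in measurable X]setTI; apply: measurable_path => //.
by apply: measurable_cylinder => i; exact: mE.
Qed.

Lemma beta_stick_invariant k a b : (0 < a)%R -> (0 < b)%R -> (0 < b + 1 - a)%R ->
  mutually_independent P v ->
  beta_law P (v k) a b -> beta_law P (v k.+1) a (b + 1 - a) -> stick_invariant P v k.
Proof.
move=> a0 b0 b'0 ind lk lk1.
apply: (seqR_unique (posfun_stick k) (posfun_stick_swap k) (stick_total k)) => n A mA.
(* The cylinder is lengthened so that both exchanged coordinates are among its constraints. *)
pose B i := if (i < n)%N then A i else setT; pose N := maxn n k.+2.
have mB i : measurable (B i) by rewrite /B; case: ifP.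
have kN : (k.+1 < N)%N by rewrite leq_max leqnn orbT.
have -> : cylinder n A = cylinder N B.
  apply/seteqP; split => x h i iN; rewrite /cylinder /= in h.
    by rewrite /B; case: ifP => // ilt; exact: h.
  by have := h i; rewrite /B iN leq_max iN => /(_ isT).
have [mW indW] := independent_sticks kN mB ind; set W := [set o | _] in mW indW.
have cylE (y : nat -> R) o : (forall i, i != k -> i != k.+1 -> y i = v i o) ->
    \1_(cylinder N B) y = (\1_W o * \1_(B k `*` B k.+1) (y k, y k.+1) :> R)%R.
  move=> yv; rewrite !indicE -natrM mulnb; congr ((nat_of_bool _)%:R).
  apply/idP/idP; rewrite !inE/=.
    move=> h; apply/andP; split; rewrite inE/=.
      by move=> i iN ik ik1; rewrite -yv//; exact: h.
    by split; apply: h => //; exact: ltnW.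
  move=> /andP[]; rewrite !inE/= => h [hk hk1] i iN.
  have [->//|ik] := eqVneq i k; have [->//|ik1] := eqVneq i k.+1.
  by rewrite yv//; exact: h.
pose r (z : RR) : \bar R := (\1_(B k `*` B k.+1) z)%:E.
have mr : measurable_fun setT r.
  apply: measurable_indicE.
  apply: measurableX; exact: mB.
have mG (s : RR -> RR) : measurable_fun setT s ->
    measurable_fun setT (fun z : RR => (`|1 - z.1|)%:E * r (s z)).
  move=> ms; apply: emeasurable_funM; last exact: measurableT_comp mr ms.
  by apply/measurable_EFinP; apply: measurableT_comp => //; exact: measurable_onem_fst.
have G0 (s : RR -> RR) z : 0 <= (`|1 - z.1|)%:E * r (s z) by rewrite mule_ge0// lee_fin.
have E (s : RR -> RR) (f : T -> \bar R) : measurable_fun setT s ->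
    (forall o, f o = (`|1 - v k o|)%:E * ((\1_W o)%:E * r (s (v k o, v k.+1 o)))) ->
    \int[P]_o f o = P W * \int[P]_o ((`|1 - v k o|)%:E * \int[P]_o' r (s (v k o, v k.+1 o'))).
  move=> ms fE; under eq_integral do rewrite fE muleCA.
  rewrite (independent_integral (S := measurableTypeR R) (U := measurableTypeR R) (mv k) (mv k.+1) mW indW (G := fun z : RR => (`|1 - z.1|)%:E * r (s z)) (G0 s) (mG s ms)).
  congr (_ * _); apply: eq_integral => o _ /=.
  rewrite (posfunZ (posfun_integral P measurableT) (f := fun o' => r (s (v k o, v k.+1 o'))))//.
    by move=> o'; rewrite lee_fin.
  apply: (measurableT_comp mr); apply: (measurableT_comp ms).
  apply: measurable_fun_pair; [exact: measurable_cst|exact: mv].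
rewrite (E id _ (@measurable_id _ _ _)); last first.
  by move=> o; rewrite -EFinM (cylE _ o).
rewrite [RHS](E pair_swap _ measurable_pair_swap); last first.
  move=> o; rewrite (cylE _ o); first by rewrite stick_swap_k stick_swap_k1.
  by move=> i ik ik1; rewrite /stick_swap (negbTE ik) (negbTE ik1).
have r0 z : 0 <= r z by rewrite lee_fin.
by congr (_ * _); exact: (beta_pair_swap a0 b0 b'0 (mv k) (mv k.+1) lk lk1 r0 mr).
Qed.

End beta_invariance.

(** * Conditional moments *)

Section conditional_moments.
Local Open Scope ereal_scope.
Context {R : realType} d (T : measurableType d) (P : probability T R).
Local Notation RR := (measurableTypeR R * measurableTypeR R)%type.

(** Testing with the indicator of G < F shows that the positive part of F - G integrates to 0; the
    finite integral of [G] is what permits the subtraction. *)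
Lemma ae_le_test dS (S : measurableType dS) (Z : T -> S) (F G : S -> R) :
  measurable_fun setT Z -> measurable_fun setT F -> measurable_fun setT G ->
  (forall z, 0 <= F z)%R -> (forall z, 0 <= G z)%R ->
  \int[P]_o (G (Z o))%:E < +oo ->
  (forall h : S -> \bar R, (forall z, 0 <= h z) -> measurable_fun setT h ->
    \int[P]_o ((F (Z o))%:E * h (Z o)) = \int[P]_o ((G (Z o))%:E * h (Z o))) ->
  {ae P, forall o, (F (Z o) <= G (Z o))%R}.
Proof.
move=> mZ mF mG F0 G0 Gfin FG.
have mFZ : measurable_fun setT (F \o Z) by exact: measurableT_comp.
have mGZ : measurable_fun setT (G \o Z) by exact: measurableT_comp.
pose A := [set z | G z < F z]%R.
have mA : measurable A by exact: measurable_lt_set.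
pose D o : \bar R := (Num.max 0 (F (Z o) - G (Z o)))%R%:E.
have D0 o : 0 <= D o by rewrite lee_fin le_max lexx.
have mD : measurable_fun setT D.
  by apply/measurable_EFinP; apply: measurable_maxr => //; exact: measurable_funB.
have m1 : measurable_fun setT (fun o => (G (Z o))%:E * (\1_A (Z o))%:E).
  apply: emeasurable_funM; first exact/measurable_EFinP.
  exact: measurableT_comp (measurable_indicE mA) mZ.
have E o : (F (Z o))%:E * (\1_A (Z o))%:E = (G (Z o))%:E * (\1_A (Z o))%:E + D o.
  rewrite /D -!EFinM -EFinD; congr EFin; rewrite indicE.
  have -> : (Z o \in A) = (G (Z o) < F (Z o))%R by apply/idP/idP; rewrite inE.
  case: (leP (F (Z o)) (G (Z o))) => h.
    by rewrite (max_idPl _) ?subr_le0// !mulr0n !mulr0 addr0.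
  by rewrite (max_idPr _) ?subr_ge0 ?(ltW h)// !mulr1n !mulr1 addrC subrK.
have GA0 o : 0 <= (G (Z o))%:E * (\1_A (Z o))%:E by rewrite mule_ge0// lee_fin.
have : \int[P]_o ((F (Z o))%:E * (\1_A (Z o))%:E) = \int[P]_o ((G (Z o))%:E * (\1_A (Z o))%:E).
  by apply: (FG (fun z => (\1_A z)%:E)); [move=> z; rewrite lee_fin|exact: measurable_indicE].
under eq_integral do rewrite E.
rewrite ge0_integralD// => eq1.
have I1 : \int[P]_o ((G (Z o))%:E * (\1_A (Z o))%:E) \is a fin_num.
  rewrite ge0_fin_numE; last exact: integral_ge0.
  apply: le_lt_trans Gfin; apply: ge0_le_integral => //.
  - exact/measurable_EFinP.
  by move=> o _; rewrite -EFinM lee_fin indicE; case: (_ \in _); rewrite ?mulr1 ?mulr0.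
have D00 : \int[P]_o D o = 0.
  by rewrite -[LHS](addeK (x := _) _ I1) [X in X - _]addeC eq1 subee.
have := (ae_eq_integral_abs P (@measurableT _ T) (f := D) mD).1.
rewrite (_ : \int[P]_o `|D o| = 0); last first.
  by rewrite -D00; apply: eq_integral => o _; rewrite gee0_abs.
move=> /(_ erefl); apply: filterS => o /(_ Logic.I) [].
rewrite -subr_le0 => h; have : (F (Z o) - G (Z o) <= Num.max 0 (F (Z o) - G (Z o)))%R.
  by rewrite le_max lexx orbT.
by rewrite h.
Qed.

Lemma ae_eq_test dS (S : measurableType dS) (Z : T -> S) (F G : S -> R) :
  measurable_fun setT Z -> measurable_fun setT F -> measurable_fun setT G ->
  (forall z, 0 <= F z)%R -> (forall z, 0 <= G z)%R ->
  \int[P]_o (G (Z o))%:E < +oo ->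
  (forall h : S -> \bar R, (forall z, 0 <= h z) -> measurable_fun setT h ->
    \int[P]_o ((F (Z o))%:E * h (Z o)) = \int[P]_o ((G (Z o))%:E * h (Z o))) ->
  {ae P, forall o, F (Z o) = G (Z o)}.
Proof.
move=> mZ mF mG F0 G0 Gfin FG.
have Ffin : \int[P]_o (F (Z o))%:E < +oo.
  have := FG (fun=> 1) (fun=> lee01) (measurable_cst _).
  by under eq_integral do rewrite mule1; under [in X in _ = X -> _]eq_integral do rewrite mule1; move=> ->.
have h1 := ae_le_test mZ mF mG F0 G0 Gfin FG.
have h2 := ae_le_test mZ mG mF G0 F0 Ffin (fun h h0 mh => esym (FG h h0 mh)).
apply: filterS2 h1 h2 => o h1 h2; by apply/eqP; rewrite eq_le h1 h2.
Qed.

(** Powers of 1 - x rather than of x, since the density 1 - v_k of the exchange then merely shifts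
    the exponent. With [clamp] the function is bounded and continuous on the whole line, hence
    admissible for weak convergence. *)
Definition onem_pow l (x : R) : R := ((1 - clamp x) ^+ l)%R.

Lemma onem_pow_ge0 l x : (0 <= onem_pow l x)%R.
Proof. by rewrite exprn_ge0// subr_ge0 clamp_le1. Qed.

Lemma onem_pow_le1 l x : (onem_pow l x <= 1)%R.
Proof. by rewrite exprn_ile1// ?subr_ge0 ?clamp_le1// lerBlDr lerDl clamp_ge0. Qed.

Lemma measurable_onem_pow l : measurable_fun setT (onem_pow l).
Proof.
by apply: measurable_funX; apply: measurable_funB => //; exact: measurable_clamp.
Qed.

Lemma continuous_onem_pow l : continuous (onem_pow l).
Proof.
move=> x; apply: (@continuous_comp _ _ _ (fun x => 1 - clamp x)%R (fun x => x ^+ l)%R).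
  by apply: cvgB; [exact: cvg_cst|exact: clamp_continuous].
exact: exprn_continuous.
Qed.

Section kernel.
Variable kappa : R -> probability R R.
Hypothesis mkappa : forall B : set R, measurable B ->
  measurable_fun setT (fun u : R => kappa u B : \bar R).

(** These countably many bounded functions stand in for the kernel: if each is almost surely
    constant along the conditioning variable, independence follows. *)
Definition kmom l (u : R) : R := fine (\int[kappa u]_x (onem_pow l x)%:E).

Lemma kmom_integral l u : 0 <= \int[kappa u]_x (onem_pow l x)%:E <= 1.
Proof.
apply/andP; split; first by apply: integral_ge0 => x _; rewrite lee_fin onem_pow_ge0.
apply: (@le_trans _ _ (\int[kappa u]_x cst 1 x)).
  apply: ge0_le_integral => //.
  - by move=> x _; rewrite lee_fin onem_pow_ge0.
  - by apply/measurable_EFinP; exact: measurable_onem_pow.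
  - by move=> x _; rewrite lee_fin onem_pow_le1.
by rewrite integral_cst// mul1e; exact: probability_le1.
Qed.

Lemma kmomE l u : (kmom l u)%:E = \int[kappa u]_x (onem_pow l x)%:E.
Proof.
have /andP[h0 h1] := kmom_integral l u; rewrite /kmom fineK// ge0_fin_numE//.
exact: le_lt_trans h1 (ltry _).
Qed.

Lemma kmom_ge0 l u : (0 <= kmom l u)%R.
Proof. by rewrite -lee_fin kmomE; have /andP[] := kmom_integral l u. Qed.

Lemma kmom_le1 l u : (kmom l u <= 1)%R.
Proof. by rewrite -lee_fin kmomE; have /andP[] := kmom_integral l u. Qed.

Lemma measurable_kmom l : measurable_fun setT (kmom l).
Proof.
apply: (measurableT_comp (f := fine)) => //.
apply: (measurable_kernel_integral mkappa); first by move=> x; rewrite lee_fin onem_pow_ge0.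
by apply/measurable_EFinP; exact: measurable_onem_pow.
Qed.

Lemma kernel_moment (X Y : T -> R) (E : set T) l :
  measurable E -> measurable_fun setT X -> measurable_fun setT Y ->
  (forall B, measurable B -> P (E `&` Y @^-1` B) = \int[P]_(o in E) kappa (X o) B) ->
  \int[P]_o ((\1_E o)%:E * (onem_pow l (Y o))%:E) = \int[P]_o ((\1_E o)%:E * (kmom l (X o))%:E).
Proof.
move=> mE mX mY h.
have hI := posfun_integral P (@measurableT _ T).
have h1 : posfun (fun f : R -> \bar R => \int[P]_o ((\1_E o)%:E * f (Y o))).
  by apply: (posfun_comp hI mY) => //; exact: measurable_indic.
have h2 : posfun (fun f : R -> \bar R => \int[P]_o ((\1_E o)%:E * f (X o))).
  by apply: (posfun_comp hI mX) => //; exact: measurable_indic.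
have h3 := posfun_kernel h2 mkappa.
rewrite (posfun_ext h1 h3 _ (f := fun x => (onem_pow l x)%:E)); last 3 first.
- move=> B mB; transitivity (P (E `&` Y @^-1` B)).
    rewrite -integral_indic_prob; last first.
      by apply: measurableI => //; rewrite -[X in measurable X]setTI; exact: mY.
    by apply: eq_integral => o _; rewrite -EFinM indicI.
  rewrite h// integral_mkcond; apply: eq_integral => o _.
  rewrite patchE integral_indic_prob// indicE; case: (o \in E); by rewrite ?mul1e ?mul0e.
- by move=> x; rewrite lee_fin onem_pow_ge0.
- by apply/measurable_EFinP; exact: measurable_onem_pow.
by apply: eq_integral => o _; rewrite kmomE.
Qed.

End kernel.

Variable v : nat -> T -> R.
Hypothesis mv : forall j, measurable_fun setT (v j).
Hypothesis v01 : forall j o, (0 <= v j o <= 1)%R.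
Hypothesis aegood : {ae P, forall o, good_sticks (path v o)}.

(* [g (v k.+1)] is a version of the conditional expectation of [f (v k.+2)]. *)
Definition cond_version k (f g : R -> R) : Prop :=
  forall h : RR -> \bar R, (forall z, 0 <= h z) -> measurable_fun setT h ->
  \int[P]_o ((f (v k.+2 o))%:E * h (v k o, v k.+1 o)) =
  \int[P]_o ((g (v k.+1 o))%:E * h (v k o, v k.+1 o)).

Let mpair k : measurable_fun setT (fun o => (v k o, v k.+1 o) : RR).
Proof. by apply: measurable_fun_pair; exact: mv. Qed.

Lemma pair_swapE k o : pair_swap (v k o, v k.+1 o) =
  (stick_swap k (path v o) k, stick_swap k (path v o) k.+1).
Proof. by rewrite stick_swap_k stick_swap_k1. Qed.

Lemma pair_swapK k o : good_sticks (path v o) ->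
  pair_swap (pair_swap (v k o, v k.+1 o)) = (v k o, v k.+1 o).
Proof.
move=> gy; rewrite pair_swapE /pair_swap/=.
by rewrite -[in X in (X, _)]stick_swap_k -[in X in (_, X)]stick_swap_k1 stick_swapK//; exact: gy.1.
Qed.

(* Since the exchange is an involution fixing [v k.+2], both [g (v k.+1)] and
   [g] of the exchanged length variable are conditional expectations of
   [f (v k.+2)]. *)
Lemma cond_version_swap k (f g : R -> R) :
  (forall x, 0 <= f x)%R -> measurable_fun setT f ->
  (forall x, 0 <= g x <= 1)%R -> measurable_fun setT g ->
  stick_invariant P v k -> cond_version k f g ->
  {ae P, forall o, g (v k.+1 o) = g (stick_swap k (path v o) k.+1)}.
Proof.
move=> f0 mf g01 mg inv cond.
have g0 x : (0 <= g x)%R by have /andP[] := g01 x.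
have n1 : measurable_fun setT (fun z : RR => `|1 - z.1| : R)%R.
  by apply: measurableT_comp => //; exact: measurable_onem_fst.
pose N (z : RR) : \bar R := (`|1 - z.1|)%:E.
have mN : measurable_fun setT N by exact/measurable_EFinP.
have mpath := measurable_path mv.
have mcoord2 : measurable_fun setT (fun y : seqR R => (y k, y k.+1) : RR).
  by apply: measurable_fun_pair; exact: measurable_coord.
(* Both sides equal one integral of [f (v k.+2)]. The left side conditions directly; the right side
   exchanges, conditions, and exchanges back, which replaces [v k.+1] by its exchanged value. *)
have main (h : RR -> \bar R) : (forall z, 0 <= h z) -> measurable_fun setT h ->
    \int[P]_o ((g (v k.+1 o))%:E * (N (v k o, v k.+1 o) * h (pair_swap (v k o, v k.+1 o)))) =
    \int[P]_o ((g (pair_swap (v k o, v k.+1 o)).2)%:E * (N (v k o, v k.+1 o) * h (pair_swap (v k o, v k.+1 o)))).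
  move=> h0 mh.
  have mNh : measurable_fun setT (fun z => N z * h z) by exact: emeasurable_funM.
  have mNhs : measurable_fun setT (fun z => N z * h (pair_swap z)).
    by apply: emeasurable_funM => //; exact: measurableT_comp mh measurable_pair_swap.
  have Nh0 z : 0 <= N z * h z by rewrite mule_ge0// lee_fin.
  have Nhs0 z : 0 <= N z * h (pair_swap z) by rewrite mule_ge0// lee_fin.
  rewrite -(cond _ Nhs0 mNhs).
  transitivity (\int[P]_o ((`|1 - v k o|)%:E * ((f (v k.+2 o))%:E * h (v k o, v k.+1 o)))).
    rewrite (inv (fun y => (f (y k.+2))%:E * h (y k, y k.+1))).
    - apply: eq_integral => o _; rewrite pair_swapE muleCA; congr (_ * (_ * _)).
      by rewrite stick_swap_gt.
    - by move=> y; rewrite mule_ge0// lee_fin.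
    apply: emeasurable_funM; last exact: measurableT_comp mh mcoord2.
    by apply/measurable_EFinP; exact: measurableT_comp mf (measurable_coord _).
  under eq_integral do rewrite muleCA.
  rewrite (cond _ Nh0 mNh).
  transitivity (\int[P]_o ((`|1 - v k o|)%:E * ((g (v k.+1 o))%:E * h (v k o, v k.+1 o)))).
    by apply: eq_integral => o _; exact: muleCA.
  rewrite (inv (fun y => (g (y k.+1))%:E * h (y k, y k.+1))).
  - by apply: eq_integral => o _; rewrite pair_swapE muleCA.
  - by move=> y; rewrite mule_ge0// lee_fin.
  apply: emeasurable_funM; last exact: measurableT_comp mh mcoord2.
  by apply/measurable_EFinP; exact: measurableT_comp mg (measurable_coord _).
pose F (z : RR) : R := (`|1 - z.1| * g z.2)%R.
pose G (z : RR) : R := (`|1 - z.1| * g (pair_swap z).2)%R.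
have mF : measurable_fun setT F.
  by apply: measurable_funM => //; exact: measurableT_comp mg measurable_snd_R.
have mG : measurable_fun setT G.
  apply: measurable_funM => //; apply: (measurableT_comp mg).
  exact: measurableT_comp measurable_snd_R measurable_pair_swap.
have eqFG : {ae P, forall o, F (v k o, v k.+1 o) = G (v k o, v k.+1 o)}.
  apply: (ae_eq_test (mpair k) mF mG) => //.
  - by move=> z; rewrite mulr_ge0.
  - by move=> z; rewrite mulr_ge0.
  - apply: integral_le1_lty => [|o].
      by apply/measurable_EFinP; exact: measurableT_comp mG (mpair k).
    rewrite !lee_fin mulr_ge0//= mulr_ile1//=.
      by rewrite ler_norml; have /andP[] := v01 k o; lra.
    by have /andP[] := g01 (v k o / (1 - (1 - v k o) * v k.+1 o))%R.
  move=> h h0 mh.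
  have mhs : measurable_fun setT (h \o pair_swap) by exact: measurableT_comp mh measurable_pair_swap.
  (* [main] tests only against functions of the exchanged pair; as the exchange is almost surely an
     involution, composing with it once more yields every test function. *)
  have := main (h \o pair_swap) (fun z => h0 _) mhs.
  have mm (q : RR -> R) : measurable_fun setT q ->
     measurable_fun setT (fun o => (q (v k o, v k.+1 o))%:E *
       (N (v k o, v k.+1 o) * h (pair_swap (pair_swap (v k o, v k.+1 o))))) /\
     measurable_fun setT (fun o => (`|1 - v k o| * q (v k o, v k.+1 o))%:E * h (v k o, v k.+1 o)).
    move=> mq; split.
      apply: (measurableT_comp (f := fun z => (q z)%:E * (N z * h (pair_swap (pair_swap z)))) _ (mpair k)).
      apply: emeasurable_funM; first exact/measurable_EFinP.
      by apply: emeasurable_funM => //; exact: measurableT_comp mhs measurable_pair_swap.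
    have m2 : measurable_fun setT (fun z : RR => (`|1 - z.1| * q z)%R%:E * h z).
      by apply: emeasurable_funM => //; apply/measurable_EFinP; exact: measurable_funM.
    exact: measurableT_comp m2 (mpair k).
  have conv (q : RR -> R) : (forall z, 0 <= q z)%R -> measurable_fun setT q ->
      \int[P]_o ((q (v k o, v k.+1 o))%:E * (N (v k o, v k.+1 o) * (h \o pair_swap) (pair_swap (v k o, v k.+1 o)))) =
      \int[P]_o ((`|1 - v k o| * q (v k o, v k.+1 o))%:E * h (v k o, v k.+1 o)).
    move=> q0 mq; have [mm1 mm2] := mm q mq.
    apply: (eq_integral_ae aegood) => //.
    - by move=> o; rewrite mule_ge0 ?lee_fin//; apply: mule_ge0; [rewrite lee_fin|exact: h0].
    - by move=> o; apply: mule_ge0; [rewrite lee_fin mulr_ge0|exact: h0].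
    by move=> o gy /=; rewrite pair_swapK// EFinM -muleA muleCA.
  rewrite (conv (fun z => g z.2)) => //; last exact: measurableT_comp mg measurable_snd_R.
  rewrite (conv (fun z => g (pair_swap z).2)) => //.
  apply: (measurableT_comp mg); exact: measurableT_comp measurable_snd_R measurable_pair_swap.
apply: filterS2 aegood eqFG => o gy; rewrite /F /G pair_swapE/=.
have /andP[_ v1] := gy.1 k => /mulfI; apply.
by rewrite normr_eq0 subr_eq0 gt_eqF.
Qed.

End conditional_moments.

Section moments_independence.
Local Open Scope ereal_scope.
Context {R : realType} d (T : measurableType d) (P : probability T R).
Local Notation RR := (measurableTypeR R * measurableTypeR R)%type.

Lemma good_sticks_ae (v : nat -> T -> R) : (forall j o, 0 <= v j o <= 1)%R ->
  {ae P, forall o, (fun n => \sum_(j < n) sb_weights v j o)%R @ \oo --> (1%R : R)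
                   /\ (forall j, 0 < sb_weights v j o)%R} ->
  {ae P, forall o, good_sticks (path v o)}.
Proof.
move=> v01; apply: filterS => o [cw w0]; split => [j|]; last by split.
have /andP[v0 v1] := v01 j o; rewrite /path !lt_neqAle v0 v1 !andbT; apply/andP; split.
  by have := w0 j; rewrite /sb_weights; apply: contraTN => /eqP <-; rewrite mul0r ltxx.
have := w0 j.+1; rewrite /sb_weights big_ord_recr/=; apply: contraTN => /eqP ->.
by rewrite subrr !mulr0 ltxx.
Qed.

Lemma moments_weighted (w1 w2 Y : T -> R) :
  measurable_fun setT w1 -> measurable_fun setT w2 -> measurable_fun setT Y ->
  (forall o, 0 <= w1 o)%R -> (forall o, 0 <= w2 o)%R -> (forall o, 0 <= Y o <= 1)%R ->
  \int[P]_o (w1 o)%:E < +oo ->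
  (forall l, \int[P]_o ((w1 o)%:E * (onem_pow l (Y o))%:E) =
             \int[P]_o ((w2 o)%:E * (onem_pow l (Y o))%:E)) ->
  forall f : R -> \bar R, (forall x, 0 <= f x) -> measurable_fun setT f ->
  \int[P]_o ((w1 o)%:E * f (Y o)) = \int[P]_o ((w2 o)%:E * f (Y o)).
Proof.
move=> mw1 mw2 mY w10 w20 Y01 fin mom f f0 mf.
have hI := posfun_integral P (@measurableT _ T).
have h1 := posfun_comp hI mY w10 mw1; have h2 := posfun_comp hI mY w20 mw2.
have := moments_unique h1 h2 _ mom f0 mf.
have E (w : T -> R) : \int[P]_o ((w o)%:E * f (clamp (Y o))) = \int[P]_o ((w o)%:E * f (Y o)).
  by apply: eq_integral => o _; rewrite clamp_id.
rewrite !E; apply.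
by under eq_integral do rewrite mule1.
Qed.

(** The law of [Y] restricted to [E] and the law of [Y] scaled by [P E] have the same moments, and
    these determine a law on [0, 1]. *)
Lemma moments_independent (E : set T) (Y : T -> R) : measurable E ->
  measurable_fun setT Y -> (forall o, 0 <= Y o <= 1)%R ->
  (forall l, \int[P]_o ((\1_E o)%:E * (onem_pow l (Y o))%:E) =
             P E * \int[P]_o (onem_pow l (Y o))%:E) ->
  forall C, measurable C -> P (E `&` Y @^-1` C) = P E * P (Y @^-1` C).
Proof.
move=> mE mY Y01 mom C mC.
have mYC : measurable (Y @^-1` C) by rewrite -[X in measurable X]setTI; exact: mY.
have PE0 : (0 <= fine (P E))%R by rewrite fine_ge0.
have PE : (fine (P E))%:E = P E by rewrite fineK ?fin_num_measure.
have hI := posfun_integral P (@measurableT _ T).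
have Z (f : R -> \bar R) : (forall x, 0 <= f x) -> measurable_fun setT f ->
    \int[P]_o ((fine (P E))%:E * f (Y o)) = P E * \int[P]_o f (Y o).
  by move=> f0 mf; rewrite (posfunZ hI (f := fun o => f (Y o)))// ?PE//; exact: measurableT_comp.
have i0 o : (0 <= \1_E o :> R)%R by [].
have mi : measurable_fun setT (\1_E : T -> R) by exact: measurable_indic.
have fin : \int[P]_o (\1_E o)%:E < +oo.
  by rewrite integral_indic_prob//; exact: le_lt_trans (probability_le1 P mE) (ltry _).
have ml l : measurable_fun setT (fun x : R => (onem_pow l x)%:E).
  by apply/measurable_EFinP; exact: measurable_onem_pow.
have hm l : \int[P]_o ((\1_E o)%:E * (onem_pow l (Y o))%:E) =
     \int[P]_o ((fine (P E))%:E * (onem_pow l (Y o))%:E).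
  by rewrite (Z (fun x => (onem_pow l x)%:E))// => x; rewrite lee_fin onem_pow_ge0.
have h := moments_weighted mi (measurable_cst _) mY i0 (fun=> PE0) Y01 fin hm (f := fun x => (\1_C x)%:E).
rewrite -integral_indic_prob; last exact: measurableI.
transitivity (\int[P]_o ((\1_E o)%:E * (\1_C (Y o))%:E)).
  by apply: eq_integral => o _; rewrite -EFinM indicI.
rewrite h; [|by move=> x; rewrite lee_fin|exact: measurable_indicE].
rewrite (Z (fun x => (\1_C x)%:E)); last exact: measurable_indicE.
  by rewrite -[P (Y @^-1` C)]integral_indic_prob.
by move=> x; rewrite lee_fin.
Qed.

Variable kappa : R -> probability R R.
Hypothesis mkappa : forall B : set R, measurable B ->
  measurable_fun setT (fun u : R => kappa u B : \bar R).

Lemma const_kernel_independent (X Y : T -> R) (E : set T) : measurable E ->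
  measurable_fun setT X -> measurable_fun setT Y -> (forall o, 0 <= Y o <= 1)%R ->
  (forall C, measurable C -> P (E `&` Y @^-1` C) = \int[P]_(o in E) kappa (X o) C) ->
  (forall C, measurable C -> P (Y @^-1` C) = \int[P]_o kappa (X o) C) ->
  (forall l, exists c, {ae P, forall o, kmom kappa l (X o) = c}) ->
  forall C, measurable C -> P (E `&` Y @^-1` C) = P E * P (Y @^-1` C).
Proof.
move=> mE mX mY Y01 hE hT const; apply: moments_independent => // l.
have [c hc] := const l.
(* The absolute value makes the factor nonnegative, as pulling it out of the integral requires; it
   is harmless because [c] is almost surely the value of a nonnegative moment. *)
have key (D : set T) : measurable D ->
    (forall C, measurable C -> P (D `&` Y @^-1` C) = \int[P]_(o in D) kappa (X o) C) ->
    \int[P]_o ((\1_D o)%:E * (onem_pow l (Y o))%:E) = P D * (`|c|)%:E.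
  move=> mD hD; rewrite (kernel_moment mkappa l mD mX mY hD).
  rewrite muleC -integral_indic_prob//.
  rewrite -(posfunZ (posfun_integral P measurableT) (f := fun o => (\1_D o)%:E))//; last exact: measurable_indicE.
  apply: (eq_integral_ae hc).
  - by move=> o; rewrite mule_ge0// lee_fin kmom_ge0.
  - by move=> o; rewrite mule_ge0// lee_fin.
  - apply: emeasurable_funM; first exact: measurable_indicE.
    by apply/measurable_EFinP; exact: measurableT_comp (measurable_kmom mkappa l) mX.
  - by apply: emeasurable_funM; [exact: measurable_cst|exact: measurable_indicE].
  by move=> o <-; rewrite muleC ger0_norm// kmom_ge0.
rewrite (key E)//; congr (_ * _).
have := key setT measurableT; rewrite probability_setT mul1e => <-.
  by apply: eq_integral => o _; rewrite indicT mul1e.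
by move=> C mC; rewrite setTI hT.
Qed.

Variable v : nat -> T -> R.
Hypothesis mv : forall j, measurable_fun setT (v j).

Lemma cond_version_kernel k l :
  (forall A B C, measurable A -> measurable B -> measurable C ->
    P ((v k @^-1` A `&` v k.+1 @^-1` B) `&` v k.+2 @^-1` C) =
    \int[P]_(o in v k @^-1` A `&` v k.+1 @^-1` B) kappa (v k.+1 o) C) ->
  cond_version P v k (onem_pow l) (kmom kappa l).
Proof.
move=> ker h h0 mh.
have hI := posfun_integral P (@measurableT _ T).
have mp : measurable_fun setT (fun o => (v k o, v k.+1 o) : RR).
  by apply: measurable_fun_pair; exact: mv.
have mo : measurable_fun setT (fun o => onem_pow l (v k.+2 o)).
  exact: measurableT_comp (measurable_onem_pow l) (mv _).
have mk : measurable_fun setT (fun o => kmom kappa l (v k.+1 o)).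
  exact: measurableT_comp (measurable_kmom mkappa l) (mv _).
have h1 := posfun_comp hI mp (fun o => onem_pow_ge0 l (v k.+2 o)) mo.
have h2 := posfun_comp hI mp (fun o => kmom_ge0 kappa l (v k.+1 o)) mk.
apply: (posfun_rectangles h1 h2) => //.
  apply: integral_le1_lty => [|o].
    by apply: emeasurable_funM => //; exact/measurable_EFinP.
  by rewrite mule1 !lee_fin onem_pow_ge0 onem_pow_le1.
move=> A B mA mB; pose E := v k @^-1` A `&` v k.+1 @^-1` B.
have mE : measurable E.
  by apply: measurableI; rewrite -[X in measurable X]setTI; exact: mv.
have EE o : \1_(A `*` B) (v k o, v k.+1 o) = \1_E o :> R.
  by rewrite !indicE in_setX /E in_setI.
under eq_integral do rewrite EE muleC.
under [in RHS]eq_integral do rewrite EE muleC.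
by apply: kernel_moment => // C mC; exact: ker.
Qed.

End moments_independence.

(** * Absolutely continuous pairs *)

Section mobius.
Local Open Scope ereal_scope.
Context {R : realType}.
Local Notation mu := (@lebesgue_measure R).
Variable y : R.
Hypothesis y01 : (0 < y < 1)%R.

(* [mobius y x] is the second entry of [pair_swap (x, y)]. *)
Definition mobius (x : R) : R := (x / (1 - (1 - x) * y))%R.
Definition mobius_inv (z : R) : R := (z * (1 - y) * (1 - z * y)^-1)%R.
(** The derivative of [mobius_inv], hence the density of the image of Lebesgue measure on (0, 1)
    under [mobius]. *)
Definition mobius_dens (z : R) : R := ((1 - y) * ((1 - z * y)^-1) ^+ 2)%R.

Let y0 : (0 < y)%R. Proof. by case/andP: y01. Qed.
Let y1 : (y < 1)%R. Proof. by case/andP: y01. Qed.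
Let dn z : (0 <= z <= 1)%R -> (0 < 1 - z * y)%R.
Proof. by move=> /andP[z0 z1]; rewrite subr_gt0 (le_lt_trans _ y1)// ler_piMl// ltW. Qed.

Lemma measurable_mobius : measurable_fun setT mobius.
Proof.
apply: measurable_funM => //; apply: (measurableT_comp (@measurable_invr R)).
apply: measurable_funB => //; apply: measurable_funM => //.
exact: measurable_funB.
Qed.

Lemma measurable_mobius_dens : measurable_fun setT mobius_dens.
Proof.
apply: measurable_funM => //; apply: measurable_funX.
apply: (measurableT_comp (@measurable_invr R)).
by apply: measurable_funB => //; exact: measurable_funM.
Qed.

Lemma mobius_dens_ge0 z : (0 <= mobius_dens z)%R.
Proof. by rewrite mulr_ge0 ?sqr_ge0// subr_ge0 ltW. Qed.

(** A positive lower bound for the density: a set whose preimage under [mobius] is null must itself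
    be null. *)
Lemma mobius_dens_ge z : (0 <= z <= 1)%R -> (1 - y <= mobius_dens z)%R.
Proof.
move=> z01; have D := dn z01; rewrite ler_peMr ?subr_ge0 ?(ltW y1)//.
have /andP[z0 z1] := z01.
by apply: exprn_ege1; rewrite -[leLHS]invr1 lef_pV2 ?posrE// gerBl mulr_ge0// ltW.
Qed.

Lemma is_derive_mobius_inv (z : R) : (0 <= z <= 1)%R -> is_derive z 1%R mobius_inv (mobius_dens z).
Proof.
move=> z01; have D := dn z01; have Dn := lt0r_neq0 D.
have d1 : is_derive z 1%R (fun z : R => z * (1 - y))%R (1 - y)%R.
  have -> : (fun z : R => z * (1 - y))%R = (1 - y)%R \*: (id : R -> R).
    by apply/funext => t; rewrite mulrC.
  by rewrite -[X in is_derive _ _ _ X]mulr1; apply: is_deriveZ.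
have d2 : is_derive z 1%R (fun z : R => 1 - z * y)%R (- y)%R.
  have -> : (fun z : R => 1 - z * y)%R = ((fun=> 1) - (y \*: (id : R -> R)))%R.
    by apply/funext => t /=; rewrite mulrC.
  have dz : is_derive z 1%R (y \*: (id : R -> R)) (y *: 1)%R by apply: is_deriveZ.
  have := is_deriveB (is_derive_cst (1%R : R) z 1%R) dz.
  by congr is_derive; rewrite /GRing.scale/=; ring.
have := is_deriveM d1 (is_deriveV (f := fun z : R => (1 - z * y)%R) Dn d2).
congr is_derive; rewrite /mobius_dens /GRing.scale/=; by field.
Qed.

Lemma integral_mobius_dens t : (0 <= t <= 1)%R ->
  \int[mu]_(z in `]t, 1%R[) (mobius_dens z)%:E = (1 - mobius_inv t)%:E.
Proof.
move=> /andP[t0]; rewrite le_eqVlt => /orP[/eqP ->|t1].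
  rewrite set_itvoo0 integral_set0 /mobius_inv !mul1r divff ?subrr//.
  by rewrite subr_eq0 gt_eqF.
have mD : measurable_fun (`]t, 1%R[%classic : set R) (EFin \o mobius_dens).
  by apply/measurable_EFinP; apply: measurable_funTS; exact: measurable_mobius_dens.
rewrite -(integral_itv_bndoo true false mD).
have I x : x \in `[t, 1%R] -> (0 <= x <= 1)%R.
  by rewrite in_itv/= => /andP[h1 h2]; rewrite h2 (le_trans t0).
have Fc x : x \in `[t, 1%R] -> {for x, continuous mobius_inv}.
  by move=> /I /is_derive_mobius_inv [dF _]; apply/differentiable_continuous; apply/derivable1_diffP.
rewrite (@continuous_FTC2 _ _ mobius_inv t 1%R t1).
- by rewrite -EFinB {1}/mobius_inv !mul1r divff// subr_eq0 gt_eqF.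
- apply: continuous_in_subspaceT => x; rewrite inE/= => xI.
  have h : {for x, continuous (fun z : R => (1 - z * y)^-1)%R}.
    apply: cvgV; first exact/lt0r_neq0/dn/I.
    by apply: cvgB; [exact: cvg_cst|apply: cvgM; [exact: cvg_id|exact: cvg_cst]].
  exact: (cvgM (cvg_cst _) (cvgM h h)).
- split.
  + move=> x xI; suff /I/is_derive_mobius_inv[] : x \in `[t, 1%R] by [].
    exact: subset_itv_oo_cc xI.
  + by apply: cvg_at_right_filter; apply: Fc; rewrite in_itv/= lexx ltW.
  + by apply: cvg_at_left_filter; apply: Fc; rewrite in_itv/= lexx ltW.
- move=> x xI; have /I/is_derive_mobius_inv[_] : x \in `[t, 1%R] by exact: subset_itv_oo_cc xI.
  by rewrite derive1E.
Qed.

Lemma mobius_gt x t : (0 < x < 1)%R -> (0 <= t <= 1)%R -> (t < mobius x)%R = (mobius_inv t < x)%R.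
Proof.
move=> /andP[x0 x1] t01; have D := dn t01; have /andP[t0 t1] := t01.
have D2 : (0 < 1 - (1 - x) * y)%R by apply: dn; rewrite subr_ge0 gerBl !ltW.
rewrite /mobius ltr_pdivlMr// /mobius_inv ltr_pdivrMr//.
by apply/idP/idP => h; nra.
Qed.

Lemma mobius_inv01 t : (0 <= t <= 1)%R -> (0 <= mobius_inv t <= 1)%R.
Proof.
move=> t01; have D := dn t01; have /andP[t0 t1] := t01.
rewrite /mobius_inv ler_pdivrMr// mul1r; apply/andP; split; last by nra.
by rewrite !mulr_ge0 ?invr_ge0 ?(ltW D)// subr_ge0 ltW.
Qed.

Lemma mobius01 x : (0 < x < 1)%R -> (0 < mobius x < 1)%R.
Proof.
move=> /andP[x0 x1]; have D2 : (0 < 1 - (1 - x) * y)%R by apply: dn; rewrite subr_ge0 gerBl !ltW.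
rewrite /mobius divr_gt0//= ltr_pdivrMr// mul1r.
have h : (0 < (1 - x) * (1 - y))%R by rewrite mulr_gt0// subr_gt0.
lra.
Qed.

Lemma integral_mobius (f : R -> \bar R) : (forall x, 0 <= f x) -> measurable_fun setT f ->
  \int[mu]_(x in `]0%R, 1%R[) f (mobius x) =
  \int[mu]_(z in `]0%R, 1%R[) ((mobius_dens z)%:E * f z).
Proof.
move=> f0 mf.
have h : posfun (fun f : R -> \bar R => \int[mu]_(x in `]0%R, 1%R[) f x).
  exact: posfun_lebesgue.
have h1 := posfun_pull h measurable_mobius.
have h2 := posfun_comp h (@measurable_id _ R _) mobius_dens_ge0 measurable_mobius_dens.
have c01 : \int[mu]_(x in `]0%R, 1%R[) 1 = 1.
  transitivity (\int[mu]_(x in `]0%R, 1%R[) (\1_(setT : set R) x)%:E).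
    by apply: eq_integral => x _; rewrite indicT.
  by rewrite integral_indic_lebesgue// setTI lebesgue_itvoo subr0 (max_idPr _).
apply: (posfun_unique_ray h1 h2) f0 mf.
- by rewrite c01 ltry.
- rewrite c01; under eq_integral do rewrite mule1.
  rewrite integral_mobius_dens ?lexx ?ler01//.
  by rewrite /mobius_inv !mul0r subr0.
(* On (0, 1) a threshold outside [0, 1] acts like the nearest endpoint. *)
move=> t; pose c := clamp t.
have c01' : (0 <= c <= 1)%R by rewrite clamp_ge0 clamp_le1.
have rayE z : (0 < z < 1)%R -> \1_(`]t, +oo[%classic : set R) z = (c < z)%R%:R :> R.
  move=> /andP[z0 z1]; rewrite indicE mem_setE/= in_itv/= andbT; congr ((nat_of_bool _)%:R).
  rewrite /c; have [t0|t0] := leP t 0%R; first by rewrite clamp_eq0// z0 (le_lt_trans t0).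
  have [t1|t1] := leP 1%R t; last by rewrite clamp_id// !ltW.
  by rewrite clamp_eq1// !ltNge (ltW z1) (le_trans (ltW z1)).
have -> : \int[mu]_(x in `]0%R, 1%R[) (\1_(`]t, +oo[%classic : set R) (mobius x))%:E =
    \int[mu]_(x in `]0%R, 1%R[) (\1_(`]mobius_inv c, +oo[%classic : set R) x)%:E.
  apply: eq_integral => x; rewrite inE/= in_itv/= => x01.
  rewrite rayE ?mobius01// mobius_gt//.
  by rewrite indicE mem_setE/= in_itv/= andbT.
have itvI s : (0 <= s)%R -> `]s, +oo[%classic `&` `]0%R, 1%R[%classic = `]s, 1%R[%classic :> set R.
  move=> s0; apply/seteqP; split => x /=; rewrite !in_itv/= andbT.
    by move=> [-> /andP[_ ->]].
  by move=> /andP[sx ->]; rewrite sx (le_lt_trans s0).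
have /andP[i0 i1] := mobius_inv01 c01'.
rewrite integral_indic_lebesgue// itvI// lebesgue_itvoo (max_idPr _) ?subr_ge0//.
rewrite -integral_mobius_dens// -[RHS]/(\int[mu]_(z in _) _).
rewrite [RHS](_ : _ = \int[mu]_(z in `]0%R, 1%R[) ((mobius_dens z)%:E * (\1_(`]c, +oo[%classic : set R) z)%:E)); last first.
  apply: eq_integral => z; rewrite inE/= in_itv/= => z01.
  by rewrite rayE// [in RHS]indicE mem_setE/= in_itv/= andbT.
rewrite integral_mkcond [RHS]integral_mkcond; apply: eq_integral => z _.
rewrite !patchE -(itvI c) ?clamp_ge0// in_setI indicE.
by case: (z \in `]c, +oo[%classic) => /=; case: ifP => _; rewrite ?mule1 ?mule0.
Qed.

End mobius.

Section absolutely_continuous.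
Local Open Scope ereal_scope.
Context {R : realType} d (T : measurableType d) (P : probability T R).
Local Notation mu := (@lebesgue_measure R).
Local Notation RR := (measurableTypeR R * measurableTypeR R)%type.

(** Condition (A) for an arbitrary pair, so that the same argument serves again at every later
    index. *)
Definition ac_square (X Y : T -> R) : Prop := forall A : set (R * R), measurable A ->
  (P [set o | A (X o, Y o)] = 0 <-> (mu \x mu) (A `&` (`[0, 1] `*` `[0, 1])%R) = 0).

Lemma ae_null (A : set T) : measurable A -> {ae P, forall o, ~ A o} <-> P A = 0.
Proof.
move=> mA; rewrite -(negligibleP P mA) /almost_everywhere/=; split; apply: negligibleS.
  by move=> o Ao /=.
by move=> o /= /contrapT.
Qed.

(** By Tonelli almost every section at fixed height is null, and (0, 1) has positive length, so one
    such height lies in it. *)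
Lemma exists_unit_section (N : set RR) : measurable N -> (mu \x mu) N = 0 ->
  exists2 y : R, (0 < y < 1)%R & \int[mu]_x (\1_N (x, y))%:E = 0.
Proof.
move=> mN N0; pose I (y : R) := \int[mu]_x (\1_N (x, y))%:E.
have I0 y : 0 <= I y by apply: integral_ge0 => x _; rewrite lee_fin.
have mI1 : measurable_fun setT (fun z : RR => (\1_N z)%:E : \bar R) by exact: measurable_indicE.
have N0' z : 0 <= (\1_N z)%:E :> \bar R by rewrite lee_fin.
have mI : measurable_fun setT I.
  exact: (@measurable_fun_fubini_tonelli_G _ _ (measurableTypeR R) (measurableTypeR R) R mu _ mI1 N0').
have : \int[mu]_y I y = 0.
  rewrite -(@fubini_tonelli2 _ _ (measurableTypeR R) (measurableTypeR R) R mu mu _ mI1 N0').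
  by rewrite integral_indic// setIT.
have mI' : measurable_fun setT (I : measurableTypeR R -> \bar R) by exact: mI.
have := (ae_eq_integral_abs mu (@measurableT _ (measurableTypeR R)) (f := I) mI').1.
move=> h IE; have {}h : ae_eq mu setT I (cst 0).
  by apply: h; rewrite -IE; apply: eq_integral => x _; rewrite gee0_abs.
apply: contrapT => nex; case: h => M [mM M0 sM].
have : (mu `]0%R, 1%R[ <= mu M)%E.
  apply: le_measure; rewrite ?inE//.
  move=> y; rewrite /= in_itv/= => y01; apply: sM => /= /(_ Logic.I) Iy.
  by apply: nex; exists y.
by rewrite M0 lebesgue_itvoo subr0 (max_idPr _)// lee_fin ler10.
Qed.

Variables (X Y : T -> R) (g : R -> R).
Hypotheses (mX : measurable_fun setT X) (mY : measurable_fun setT Y).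
Hypothesis mg : measurable_fun setT g.

(** Fix a height y at which the exceptional set has a null section: then g(mobius y x) = g(y) for
    almost every x in (0, 1). The lower bound on the density of [mobius y] turns this into g = g(y)
    almost everywhere, and the law of [Y] does not charge the exceptional values. *)
Lemma ac_square_const : ac_square X Y -> {ae P, forall o, (0 < Y o < 1)%R} ->
  {ae P, forall o, g (Y o) = g (mobius (Y o) (X o))} ->
  exists c, {ae P, forall o, g (Y o) = c}.
Proof.
move=> ac Y01 gY.
pose N : set RR := [set z | [/\ 0 < z.1, z.1 < 1, 0 < z.2, z.2 < 1 & g z.2 - g (mobius z.2 z.1) != 0]%R].
have mgm : measurable_fun setT (fun z : RR => g z.2 - g (mobius z.2 z.1) : R)%R.
  apply: measurable_funB; first exact: measurableT_comp mg measurable_snd_R.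
  apply: (measurableT_comp mg).
  exact: (measurableT_comp measurable_snd_R measurable_pair_swap).
have mne (f : RR -> R) : measurable_fun setT f -> measurable [set z | f z != 0]%R.
  move=> mf; rewrite (_ : [set z | _] = setT `&` f @^-1` (~` [set 0%R])); last first.
    by rewrite setTI; apply/seteqP; split => z /=; [move/eqP|move=> ?; apply/eqP].
  by apply: mf => //; apply: measurableC.
have mN : measurable N.
  rewrite (_ : N = [set z : RR | 0 < z.1] `&` [set z : RR | z.1 < 1] `&` [set z : RR | 0 < z.2] `&` [set z : RR | z.2 < 1] `&` [set z : RR | g z.2 - g (mobius z.2 z.1) != 0])%R; last first.
    by apply/seteqP; split => z /=; [move=> []|move=> [[[[]]]]].
  apply: measurableI; last exact: mne.
  have m0 : measurable_fun setT (fun z : RR => 0%R : R) by exact: measurable_cst.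
  have m1 : measurable_fun setT (fun z : RR => 1%R : R) by exact: measurable_cst.
  by repeat apply: measurableI; exact: measurable_lt_set.
have mXY : measurable_fun setT (fun o => (X o, Y o) : RR) by exact: measurable_fun_pair.
have PN : P [set o | N (X o, Y o)] = 0.
  have mNX : measurable [set o | N (X o, Y o)].
    by rewrite -[X in measurable X]setTI; exact: mXY.
  by apply/(ae_null mNX); apply: filterS gY => o gE [_ _ _ _] /=; rewrite gE subrr eqxx.
have {}PN : (mu \x mu) N = 0.
  have /ac := PN => /(_ mN); rewrite (_ : _ `&` _ = N)//.
  apply/seteqP; split => z /=; first by case.
  by move=> Nz; split => //; have [a b c e _] := Nz; split; rewrite /= in_itv/= !ltW.
have [y y01 Iy] := exists_unit_section mN PN.
pose Z := [set z : R | [/\ 0 < z, z < 1 & g z - g y != 0]%R].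
have mZ : measurable Z.
  rewrite (_ : Z = [set z | 0 < z] `&` [set z | z < 1] `&` [set z | g z - g y != 0])%R; last first.
    by apply/seteqP; split => z /=; [move=> []|move=> [[]]].
  apply: measurableI.
    by apply: measurableI; apply: measurable_lt_set => //; exact: measurable_cst.
  rewrite (_ : [set z | _] = setT `&` (fun z => g z - g y)%R @^-1` (~` [set 0%R])); last first.
    by rewrite setTI; apply/seteqP; split => z /=; [move/eqP|move=> ?; apply/eqP].
  by apply: measurable_funB => //; exact: measurableC.
have muZ : mu Z = 0.
  have E : \int[mu]_(x in `]0%R, 1%R[) (\1_Z (mobius y x))%:E = 0.
    rewrite -Iy [LHS]integral_mkcond; apply: eq_integral => x _.
    rewrite patchE mem_setE/= in_itv/= !indicE; case: ifPn => x01.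
      congr ((nat_of_bool _)%:R%:E); apply/idP/idP; rewrite !inE /N /Z/=.
        move=> [_ _ h]; have /andP[-> ->] := x01; have /andP[-> ->] := y01.
        by split => //; rewrite -oppr_eq0 opprB.
      move=> [_ _ _ _ h]; have /andP[-> ->] := mobius01 y01 x01.
      by split => //; rewrite -oppr_eq0 opprB.
    by rewrite memNset// => -[/= a b _ _ _]; move/negP: x01; rewrite a b.
  have : (1 - y)%:E * mu Z <= 0.
    rewrite -E (integral_mobius y01 (f := fun z => (\1_Z z)%:E))//; last exact: measurable_indicE.
      have ZI : Z `&` `]0%R, 1%R[ = Z.
        by apply/seteqP; split => z //=; [case|move=> Zz; split => //; have [? ? _] := Zz; rewrite in_itv/=; apply/andP].
      rewrite -[in X in _ * mu X]ZI -integral_indic_lebesgue//.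
      have y1 : (0 <= 1 - y)%R by rewrite subr_ge0 ltW//; case/andP: y01.
      rewrite -(posfunZ (posfun_lebesgue (D := `]0%R, 1%R[%classic) (measurable_itv _)) (f := fun z => (\1_Z z)%:E) y1)//; last exact: measurable_indicE.
      apply: ge0_le_integral => //.
      - by move=> z ?; rewrite mule_ge0// lee_fin.
      - apply: measurable_funTS; apply: emeasurable_funM; last exact: measurable_indicE.
        exact: measurable_cst.
      - apply: measurable_funTS; apply: emeasurable_funM; last exact: measurable_indicE.
        by apply/measurable_EFinP; exact: measurable_mobius_dens.
      move=> z; rewrite /= in_itv/= => /andP[z0 z1].
      by apply: lee_wpmul2r; rewrite lee_fin// mobius_dens_ge// !ltW.
  move=> h; apply/eqP; rewrite eq_le measure_ge0 andbT.
  by move: h; rewrite pmule_rle0// lte_fin subr_gt0; case/andP: y01.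
exists (g y).
have PZ : P (Y @^-1` Z) = 0.
  pose A : set (R * R) := setT `*` Z.
  have mA : measurable (A : set RR) by apply: measurableX.
  have -> : Y @^-1` Z = [set o | A (X o, Y o)].
    by apply/seteqP; split => o /=; [|case].
  apply/(ac A mA); rewrite (_ : _ `&` _ = `[0%R, 1%R] `*` (Z `&` `[0%R, 1%R])); last first.
    by apply/seteqP; split => -[a b] /=; [move=> [[_ Zb] [? ?]]|move=> [? [? ?]]].
  rewrite product_measure1E//; last exact: measurableI.
  rewrite [X in _ * X](_ : _ = 0) ?mule0//.
  apply/eqP; rewrite eq_le measure_ge0 andbT -muZ; apply: le_measure; rewrite ?inE//.
  exact: measurableI.
have mYZ : measurable (Y @^-1` Z) by rewrite -[X in measurable X]setTI; exact: mY.
move/(ae_null mYZ): PZ; apply: filterS2 Y01 => o /andP[a b] nZ.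
by apply/eqP; rewrite -subr_eq0; apply: contrapT => /negP h; apply: nZ; split.
Qed.

End absolutely_continuous.

(** * Supports and weak continuity *)

Section supports.
Local Open Scope ereal_scope.
Context {R : realType} d (T : measurableType d) (P : probability T R).

(** The null members of a countable family can all be removed at no cost. For rational balls and
    boxes this shows that a law is carried by its support. *)
Lemma null_union dS (S : measurableType dS) (X : T -> S) (I : countType) (B : I -> set S) :
  measurable_fun setT X -> (forall i, measurable (B i)) ->
  exists N : set S, [/\ measurable N, P (X @^-1` N) = 0 &
    forall x i, ~ N x -> B i x -> 0 < P (X @^-1` (B i))].
Proof.
move=> mX mB.
pose C n := if unpickle n is Some i then
  (if P (X @^-1` (B i)) == 0 then B i else set0) else set0.
have mC n : measurable (C n).
  by rewrite /C; case: (unpickle n) => // i; case: ifP.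
have mXC n : measurable (X @^-1` C n) by rewrite -[X in measurable X]setTI; exact: mX.
exists (\bigcup_n C n); split.
- exact: bigcup_measurable.
- rewrite preimage_bigcup; apply/negligibleP; first exact: bigcup_measurable.
  apply: negligible_bigcup => n; apply/negligibleP => //.
  rewrite /C; case: (unpickle n) => [i|]; last by rewrite preimage_set0 measure0.
  by case: ifP => [/eqP //|_]; rewrite preimage_set0 measure0.
move=> x i nx Bx; rewrite lt_neqAle measure_ge0 andbT; apply/eqP => P0.
apply: nx; exists (pickle i) => //.
by rewrite /C pickleK -P0 eqxx.
Qed.

Lemma rat_ball (x e : R) : (0 < e)%R -> exists q r : rat,
  (`|x - ratr q| < ratr r)%R /\ forall y, (`|y - ratr q| < ratr r -> `|y - x| < e)%R.
Proof.
move=> e0.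
have [q] : exists q : rat, (ratr q : R) \in `](x - e / 3)%R, (x + e / 3)%R[.
  by apply: rat_in_itvoo; lra.
have [r] : exists r : rat, (ratr r : R) \in `](e / 3)%R, (e / 2)%R[.
  by apply: rat_in_itvoo; lra.
rewrite !in_itv/= => /andP[r1 r2] /andP[q1 q2].
exists q, r; split; first by rewrite ltr_norml; apply/andP; split; lra.
by move=> y; rewrite !ltr_norml => /andP[? ?]; apply/andP; split; lra.
Qed.

Lemma measurable_ball_set (q r : R) : measurable [set x : R | `|x - q| < r]%R.
Proof.
apply: measurable_lt_set; last exact: measurable_cst.
by apply: measurableT_comp => //; exact: measurable_funB.
Qed.

Lemma support1_full (X : T -> R) : measurable_fun setT X ->
  exists N : set R, [/\ measurable N, P (X @^-1` N) = 0 &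
    forall x, ~ N x -> support1 P X x].
Proof.
move=> mX.
pose B (i : (rat * rat)%type) : set R := [set x | `|x - ratr i.1| < ratr i.2]%R.
have mB i : measurable (B i) by exact: measurable_ball_set.
have [N [mN N0 NB]] := null_union mX mB; exists N; split => // x nx e e0.
have [q [r [xq sub]]] := rat_ball x e0.
apply: (lt_le_trans (NB x (q, r) nx xq)); apply: le_measure; rewrite ?inE.
- by rewrite -[X in measurable X]setTI; exact: mX.
- rewrite (_ : [set o | _] = setT `&` X @^-1` [set y | `|y - x| < e]%R) ?setTI//.
  by rewrite -[X in measurable X]setTI; apply: mX => //; exact: measurable_ball_set.
- by move=> o /=; exact: sub.
Qed.

Lemma measurable_ball2 (X Y : T -> R) (x y e : R) :
  measurable_fun setT X -> measurable_fun setT Y ->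
  measurable [set o | (`|X o - x| < e)%R /\ (`|Y o - y| < e)%R].
Proof.
move=> mX mY.
rewrite (_ : [set o | _] = (X @^-1` [set u | `|u - x| < e]%R) `&` (Y @^-1` [set u | `|u - y| < e]%R))//.
apply: measurableI; rewrite -[X in measurable X]setTI.
  by apply: mX => //; exact: measurable_ball_set.
by apply: mY => //; exact: measurable_ball_set.
Qed.

Lemma support2_full (X Y : T -> R) : measurable_fun setT X -> measurable_fun setT Y ->
  {ae P, forall o, support2 P X Y (X o, Y o)}.
Proof.
move=> mX mY.
pose B (i : (rat * rat * (rat * rat))%type) : set (measurableTypeR R * measurableTypeR R) :=
  [set x : R | `|x - ratr i.1.1| < ratr i.1.2]%R `*` [set x : R | `|x - ratr i.2.1| < ratr i.2.2]%R.
have mB i : measurable (B i) by apply: measurableX; exact: measurable_ball_set.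
have mXY : measurable_fun setT (fun o => (X o, Y o) : (measurableTypeR R * measurableTypeR R)%type).
  exact: measurable_fun_pair.
have [N [mN N0 NB]] := null_union mXY mB.
have mXYN : measurable ((fun o => (X o, Y o)) @^-1` N).
  by rewrite -[X in measurable X]setTI; exact: mXY.
move/(ae_null P mXYN): N0; apply: filterS => o nN e e0.
have [q [r [xq sub]]] := rat_ball (X o) e0; have [q' [r' [yq sub']]] := rat_ball (Y o) e0.
apply: (lt_le_trans (NB _ (q, r, (q', r')) nN (conj xq yq))).
apply: le_measure; rewrite ?inE.
- by rewrite -[X in measurable X]setTI; exact: mXY.
- exact: measurable_ball2.
- by move=> o' [/= h h']; split; [exact: sub|exact: sub'].
Qed.

Lemma ae_nonempty (D : set T) (A : set T) : {ae P, forall o, D o} -> measurable A ->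
  0 < P A -> exists o, A o /\ D o.
Proof.
move=> aeD mA PA; apply: contrapT => h.
have : P A = 0.
  apply/(ae_null P mA); apply: filterS aeD => o Do Ao.
  by apply: h; exists o.
by move=> P0; rewrite P0 ltxx in PA.
Qed.

Lemma weak_cvg_kmom (phi : R -> probability R R) (u : nat -> R) u0 l :
  weak_cvg (fun n => phi (u n)) (phi u0) ->
  (kmom phi l (u n) @[n --> \oo] --> kmom phi l u0)%R.
Proof.
move=> /(_ (onem_pow l) (@continuous_onem_pow _ l)) h; apply: fine_cvg.
rewrite fineK; last by rewrite -kmomE.
apply: h; exists 1%R => x; rewrite ger0_norm ?onem_pow_ge0//; exact: onem_pow_le1.
Qed.

Lemma cvg_harmonic_dist (f : nat -> R) (c : R) :
  (forall n, `|f n - c| < n.+1%:R^-1)%R -> f n @[n --> \oo] --> c.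
Proof.
move=> h; apply/cvgrPdist_lt => e he.
have /cvgrPdist_lt /(_ e he) := @cvg_harmonic R; apply: filterS => n.
rewrite sub0r normrN /harmonic/= ger0_norm; last by rewrite invr_ge0.
by move=> hn; rewrite distrC; exact: lt_trans (h n) hn.
Qed.

Section continuous_version.
Variables (X Y : T -> R) (g : R -> R) (eps : R).
Hypotheses (mX : measurable_fun setT X) (mY : measurable_fun setT Y).
Hypothesis eps01 : (0 < eps < 1)%R.
Hypothesis line : [set x : R * R | (0 <= x.1 <= 1)%R /\ x.2 = eps] `<=` support2 P X Y.
Hypothesis gc : forall (u : nat -> R) (u0 : R),
  (forall n, support1 P Y (u n)) -> support1 P Y u0 ->
  u @ \oo --> u0 -> g (u n) @[n --> \oo] --> g u0.

(** For z = Y(o) choose x with mobius eps x = z. The point (x, eps) lies in the support, so outcomes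
    satisfying the identity have (X, Y) tending to it, and continuity gives g(eps) = g(z). As [g] is
    continuous only along the support of [Y], the exchanged values must stay in that support too,
    which is the purpose of the first hypothesis. *)
Lemma continuous_version_const :
  (forall N : set R, measurable N -> P (Y @^-1` N) = 0 ->
     {ae P, forall o, ~ N (mobius (Y o) (X o))}) ->
  {ae P, forall o, (0 < Y o < 1)%R} ->
  {ae P, forall o, g (Y o) = g (mobius (Y o) (X o))} ->
  {ae P, forall o, g (Y o) = g eps}.
Proof.
move=> nullm Y01 gY.
have [N [mN N0 Nsupp]] := support1_full mY.
have mYN : measurable (Y @^-1` N) by rewrite -[X in measurable X]setTI; exact: mY.
have aeN := (ae_null P mYN).2 N0; have aeN' := nullm N mN N0.
have gd : {ae P, forall o, [/\ support1 P Y (Y o), support1 P Y (mobius (Y o) (X o)) &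
    g (Y o) = g (mobius (Y o) (X o))]}.
  have h : {ae P, forall o, support1 P Y (Y o) /\ support1 P Y (mobius (Y o) (X o))}.
    by apply: filterS2 aeN aeN' => o n1 n2; split; exact: Nsupp.
  by apply: filterS2 gY h => o ? [? ?]; split.
apply: filterS2 (gd) Y01 => o [sYo _ _] /andP[y0 y1].
have [e0 e1] := andP eps01.
set z := Y o in sYo y0 y1 *.
have z01 : (0 <= z <= 1)%R by rewrite !ltW.
pose x := mobius_inv eps z.
have x01 : (0 <= x <= 1)%R by exact: mobius_inv01.
have D : (0 < 1 - z * eps)%R by nra.
have mx : mobius eps x = z.
  rewrite /mobius /x /mobius_inv; field.
  apply/andP; split; first exact: lt0r_neq0.
  rewrite [X in X != _](_ : _ = (1 - eps)%R); last by ring.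
  by rewrite subr_eq0 gt_eqF.
have sx : support2 P X Y (x, eps) by apply: line.
have se : support1 P Y eps.
  move=> e he; apply: lt_le_trans (sx e he) _; apply: le_measure; rewrite ?inE.
  - exact: measurable_ball2.
  - rewrite (_ : [set o | _] = setT `&` Y @^-1` [set y | `|y - eps| < e]%R) ?setTI//.
    by rewrite -[X in measurable X]setTI; apply: mY => //; exact: measurable_ball_set.
  - by move=> o' [].
have /choice[s hs] : forall n : nat, exists o', ((`|X o' - x| < n.+1%:R^-1)%R /\ (`|Y o' - eps| < n.+1%:R^-1)%R) /\
    [/\ support1 P Y (Y o'), support1 P Y (mobius (Y o') (X o')) & g (Y o') = g (mobius (Y o') (X o'))].
  move=> n; have n0 : (0 < (n.+1%:R : R)^-1)%R by rewrite invr_gt0.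
  by have [t [h1 h2]] := ae_nonempty gd (measurable_ball2 x eps n.+1%:R^-1 mX mY) (sx _ n0); exists t.
have cX : X (s n) @[n --> \oo] --> x by apply: cvg_harmonic_dist => n; have [[]] := hs n.
have cY : Y (s n) @[n --> \oo] --> eps by apply: cvg_harmonic_dist => n; have [[]] := hs n.
have cM : mobius (Y (s n)) (X (s n)) @[n --> \oo] --> z.
  rewrite -mx; apply: cvgM => //; apply: cvgV.
    rewrite [X in X != _](_ : _ = ((1 - eps) / (1 - z * eps))%R).
      by rewrite mulf_neq0 ?invr_eq0 ?(lt0r_neq0 D)// subr_eq0 gt_eqF.
    by rewrite /x /mobius_inv; field; exact: lt0r_neq0.
  apply: cvgB; first exact: cvg_cst.
  by apply: cvgM => //; apply: cvgB => //; exact: cvg_cst.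
have c1 := gc (fun n => let: conj _ (And3 h _ _) := hs n in h) se cY.
have c2 := gc (fun n => let: conj _ (And3 _ h _) := hs n in h) sYo cM.
have E : (fun n => g (Y (s n))) = (fun n => g (mobius (Y (s n)) (X (s n)))).
  by apply/funext => n; have [_ []] := hs n.
rewrite E in c1.
exact: (cvg_unique (@Rhausdorff R) c2 c1).
Qed.

End continuous_version.

End supports.

(** * Convex support and left continuity *)

Section left_continuous.
Context {R : realType}.
Variable g : R -> R.
Hypothesis gl : forall (u : nat -> R) (u0 : R), (forall n, u n < u0) -> u @ \oo --> u0 ->
  g (u n) @[n --> \oo] --> g u0.

(** A connectedness argument on the largest interval of constancy: left continuity includes its
    supremum, and [step] moves strictly beyond it. *)
Lemma left_continuous_const (c : R) :
  (forall u, 0 < u < c -> exists2 u1, u < u1 & forall t, u <= t <= u1 -> t <= c -> g t = g u) ->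
  forall s t, 0 < s <= t -> t <= c -> g t = g s.
Proof.
move=> step s t /andP[s0 st] tc.
pose A := [set x | s <= x <= t /\ forall y, s <= y <= x -> g y = g s].
have As : A s.
  by split => [|y]; [rewrite lexx|rewrite -eq_le => /eqP <-].
have uA : ubound A t by move=> x [/andP[]].
have hA : has_sup A by split; [exists s|exists t].
pose m := sup A.
have sm : s <= m by apply: ub_le_sup => //; exact: hA.2.
have mt : m <= t by apply: ge_sup => //; exists s.
have gm y : s <= y < m -> g y = g s.
  move=> /andP[sy ym]; have my : 0 < m - y by rewrite subr_gt0.
  have [x [_ Ax] yx] := sup_adherent my hA; apply: Ax; rewrite sy /=.
  by apply: ltW; apply: le_lt_trans yx; rewrite opprB addrCA subrr addr0.
have gmm : g m = g s.
  have [->//|ms] := eqVneq m s.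
  have {ms}sm' : s < m by rewrite lt_neqAle eq_sym ms.
  pose u n := m - (m - s) * n.+1%:R^-1.
  have i0 n : 0 < n.+1%:R^-1 :> R by rewrite invr_gt0.
  have i1 n : n.+1%:R^-1 <= 1 :> R by rewrite invf_le1// ler1n.
  have um n : u n < m by rewrite /u gtrBl mulr_gt0// subr_gt0.
  have su n : s <= u n.
    by rewrite /u lerBrDr -lerBrDl ler_piMr// subr_ge0.
  have cu : u @ \oo --> m.
    rewrite -[X in _ --> X]subr0; apply: cvgB; first exact: cvg_cst.
    rewrite -[X in _ --> X](mulr0 (m - s)); apply: cvgM; first exact: cvg_cst.
    exact: cvg_harmonic.
  have := gl um cu; rewrite (_ : (fun n => g (u n)) = fun=> g s); last first.
    by apply/funext => n; rewrite gm// su um.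
  by move=> /cvg_lim <-//; rewrite lim_cst.
have Am : A m.
  split; first by rewrite sm.
  by move=> y /andP[sy]; rewrite le_eqVlt => /orP[/eqP ->//|ym]; rewrite gm// sy.
move: mt; rewrite le_eqVlt => /orP[/eqP <-//|mt].
have [|u1 mu1 h] := step m.
  by rewrite (lt_le_trans s0 sm)/= (lt_le_trans mt).
have Ax : A (Num.min u1 t).
  split; first by rewrite le_min ge_min lexx orbT st (le_trans sm (ltW mu1)).
  move=> y /andP[sy]; rewrite le_min => /andP[yu yt].
  have [ym|my] := ltP y m; first by rewrite gm// sy.
  by rewrite h// ?my ?yu// (le_trans yt).
have : Num.min u1 t <= m by apply: ub_le_sup => //; exact: hA.2.
by rewrite leNgt lt_min mu1 mt.
Qed.

(* The solution of q / (1 - p) = t and p / (1 - q) = s is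
   p = s (1 - t) / (1 - s t), q = t (1 - s) / (1 - s t): fixing s and moving t
   makes [g] constant on a right neighbourhood of every point. *)
Lemma rectangle_const (x1 x2 : R) : 0 < x1 -> 0 < x2 -> x1 + x2 < 1 ->
  (forall p q, 0 < p <= x1 -> 0 < q <= x2 -> g (q / (1 - p)) = g (p / (1 - q))) ->
  forall s t, 0 < s <= t -> t <= x2 / (1 - x1) -> g t = g s.
Proof.
move=> x10 x20 x12 rel; apply: left_continuous_const => u /andP[u0].
have x11 : 0 < 1 - x1 by lra.
rewrite ltr_pdivlMr// => uq; set q0 := u * (1 - x1) in uq.
have q00 : 0 < q0 by rewrite mulr_gt0.
have u1 : u < 1 by rewrite -(ltr_pM2r x11) mul1r -/q0; lra.
have D : 0 < 1 - q0 by lra.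
pose s := x1 / (1 - q0).
have s0 : 0 < s by rewrite divr_gt0.
have s1 : s < 1 by rewrite ltr_pdivrMr// mul1r; lra.
have sq : s * (1 - q0) = x1 by rewrite /s divfK// gt_eqF.
have E : 0 < 1 - s + s * x2 by rewrite addr_gt0 ?subr_gt0// mulr_gt0.
have key t : u <= t -> t <= x2 / (1 - s + s * x2) -> t <= x2 / (1 - x1) -> g t = g s.
  move=> ut; rewrite ler_pdivlMr// => tu1; rewrite ler_pdivlMr// => tc.
  have t0 : 0 < t by exact: lt_le_trans ut.
  have t1 : t < 1 by rewrite -(ltr_pM2r x11) mul1r; lra.
  have st : s * t < 1 by rewrite mulr_ilt1// ltW.
  have stD : 0 < 1 - s * t by lra.
  have stn : 1 - s * t != 0 by rewrite gt_eqF.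
  have sn : 1 - s != 0 by rewrite gt_eqF// subr_gt0.
  have tn : 1 - t != 0 by rewrite gt_eqF// subr_gt0.
  have := rel (s * (1 - t) / (1 - s * t)) (t * (1 - s) / (1 - s * t)).
  have -> : t * (1 - s) / (1 - s * t) / (1 - s * (1 - t) / (1 - s * t)) = t.
    field; apply/andP; split => //.
    by rewrite [X in X != 0](_ : _ = 1 - s)//; ring.
  have -> : s * (1 - t) / (1 - s * t) / (1 - t * (1 - s) / (1 - s * t)) = s.
    field; apply/andP; split => //.
    by rewrite [X in X != 0](_ : _ = 1 - t)//; ring.
  apply.
    apply/andP; split; first by rewrite divr_gt0// mulr_gt0// subr_gt0.
    rewrite ler_pdivrMr// -sq.
    have : s * (1 - x1) * u <= s * (1 - x1) * t by rewrite ler_pM2l// mulr_gt0.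
    have : (1 - q0) * (1 - s * t) * s = s * (1 - q0) * (1 - s * t) by ring.
    rewrite sq /q0; nra.
  apply/andP; split; first by rewrite divr_gt0// mulr_gt0// subr_gt0.
  by rewrite ler_pdivrMr//; nra.
have uu1 : u < x2 / (1 - s + s * x2).
  rewrite ltr_pdivlMr//.
  have h : q0 * (1 - u) < x2 * (1 - u) by rewrite ltr_pM2r// subr_gt0.
  rewrite -(ltr_pM2r D).
  have -> : u * (1 - s + s * x2) * (1 - q0) = u * ((1 - q0) - s * (1 - q0) * (1 - x2)) by ring.
  rewrite sq /q0 in h *; nra.
exists (x2 / (1 - s + s * x2)) => // t /andP[ut tu1] tc.
rewrite (key t)// (key u)//; first exact: ltW.
by rewrite ler_pdivlMr// ltW.
Qed.

End left_continuous.

(** * Null events under the exchange and the support of the first two weights *)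

Section weights_support.
Local Open Scope ereal_scope.
Context {R : realType} d (T : measurableType d) (P : probability T R).

(** The exchange is an equality of reweighted integrals; positivity of the density lets it transport
    null events of the law itself. *)
Lemma null_transfer (f : T -> R) (A B : set T) : measurable_fun setT f ->
  (forall o, 0 <= f o)%R -> {ae P, forall o, (0 < f o)%R} -> measurable A -> measurable B ->
  \int[P]_o ((f o)%:E * (\1_A o)%:E) = \int[P]_o ((f o)%:E * (\1_B o)%:E) ->
  P A = 0 -> P B = 0.
Proof.
move=> mf f0 aef mA mB AB PA.
have m1 (C : set T) : measurable C -> measurable_fun setT (fun o => (f o)%:E * (\1_C o)%:E).
  by move=> mC; apply: emeasurable_funM; [exact/measurable_EFinP|exact: measurable_indicE].
have p1 (C : set T) o : 0 <= (f o)%:E * (\1_C o)%:E by rewrite mule_ge0// lee_fin.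
have A0 : \int[P]_o ((f o)%:E * (\1_A o)%:E) = 0.
  rewrite (eq_integral_ae ((ae_null P mA).2 PA) (g := fun=> 0)) ?integral0//; last 2 first.
  - exact: m1.
  - by move=> o nA; rewrite indicE memNset// mule0.
have := (ae_eq_integral_abs P (@measurableT _ T) (m1 B mB)).1.
rewrite (_ : \int[P]_o `|_| = 0); last first.
  by rewrite -A0 AB; apply: eq_integral => o _; rewrite gee0_abs.
move=> /(_ erefl) h; apply/(ae_null P mB); apply: filterS2 aef h => o fo h Bo.
have := h Logic.I; rewrite indicE mem_set//= mule1 => -[f00].
by rewrite f00 ltxx in fo.
Qed.

Variable v : nat -> T -> R.
Hypothesis mv : forall j, measurable_fun setT (v j).
Hypothesis aegood : {ae P, forall o, good_sticks (path v o)}.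

Lemma stick_null k (N : set R) : measurable N -> stick_invariant P v k ->
  P (v k.+1 @^-1` N) = 0 ->
  {ae P, forall o, ~ N (stick_swap k (path v o) k.+1)}.
Proof.
move=> mN inv PN.
have mS : measurable_fun setT (fun o => stick_swap k (path v o) k.+1).
  exact: (measurableT_comp (measurable_coord k.+1) (measurableT_comp (measurable_stick_swap k) (measurable_path mv))).
have mB : measurable ((fun o => stick_swap k (path v o) k.+1) @^-1` N).
  by rewrite -[X in measurable X]setTI; exact: mS.
have mA : measurable (v k.+1 @^-1` N).
  by rewrite -[X in measurable X]setTI; exact: mv.
apply: ((ae_null P mB).2 _); apply: (null_transfer (f := fun o => `|1 - v k o|%R) _ _ _ mA mB) => //.
- by apply: measurableT_comp => //; exact: measurable_funB.
- apply: filterS aegood => o gy; rewrite normr_gt0 subr_eq0 gt_eqF//.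
  by have /andP[] := gy.1 k.
apply: (inv (fun y => (\1_N (y k.+1))%:E)); first by move=> y; rewrite lee_fin.
exact: measurableT_comp (measurable_indicE mN) (measurable_coord k.+1).
Qed.

Local Notation w := (sb_weights v).
Hypothesis swap : swap_invariant P w.

Let mw := measurable_sb_weights mv.

Lemma swap_null k (C : set (seqR R)) : measurable C ->
  P [set o | C (path w o)] = 0 -> P [set o | C (path w o \o transp k)] = 0.
Proof.
move=> mC; have mp := measurable_path mw.
have mA : measurable [set o | C (path w o)].
  by rewrite -[X in measurable X]setTI; exact: mp.
have mB : measurable [set o | C (path w o \o transp k)].
  rewrite -[X in measurable X]setTI; apply: (measurableT_comp (measurable_reindex (transp k)) mp) => //.
apply: (null_transfer (f := fun o => `|1 - psum (path w o) k.+1|%R) _ _ _ mA mB) => //.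
- apply: measurableT_comp => //; apply: measurable_funB => //.
  exact: measurableT_comp (measurable_psum _) mp.
- apply: filterS aegood => o gy; rewrite normr_gt0 subr_eq0 gt_eqF//.
  exact: good_psum_lt1 gy.2.
have C0 (x : seqR R) : 0 <= (\1_C x)%:E :> \bar R by rewrite lee_fin.
have h := swap k C0 (measurable_indicE mC); exact: h.
Qed.

Local Notation S := (support2 P (w 0%N) (w 1%N)).

Lemma measurable_box (i j : nat) (x y e : R) :
  measurable [set z : seqR R | (`|z i - x| < e)%R /\ (`|z j - y| < e)%R].
Proof.
apply: measurableI; (apply: measurable_lt_set; [|exact: measurable_cst]);
  by apply: measurableT_comp => //; apply: measurable_funB => //; exact: measurable_coord.
Qed.

Lemma support_swap (x1 x2 : R) : S (x1, x2) -> S (x2, x1).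
Proof.
move=> sx e e0; rewrite lt_neqAle measure_ge0 andbT; apply/eqP => P0.
have := swap_null 0%N (measurable_box 0%N 1%N x2 x1 e) (esym P0).
rewrite [X in P X](_ : _ = [set o | (`|w 0%N o - x1| < e)%R /\ (`|w 1%N o - x2| < e)%R]).
  by move=> h; have := sx e e0; rewrite /= h ltxx.
by apply/seteqP; split => o /= [].
Qed.

Lemma good_small (x : nat -> R) (e : R) : good x -> (0 < e)%R -> exists j, (x j.+1 < e)%R.
Proof.
move=> gx e0; apply: contrapT => h.
have ge j : (e <= x j.+1)%R by rewrite leNgt; apply/negP => xj; apply: h; exists j.
have ps n : (n%:R * e <= psum x n.+1)%R.
  elim: n => [|n IHn]; first by rewrite mul0r /psum big_ord1 ltW//; exact: gx.1.
  by rewrite psumS -natr1 mulrDl mul1r lerD.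
have := ps (Num.truncn (1 / e)%R).+1.
have := good_psum_lt1 (Num.truncn (1 / e)%R).+2 gx => h1 h2.
have : ((Num.truncn (1 / e)%R).+1%:R * e < 1)%R by exact: le_lt_trans h2 h1.
by rewrite -ltr_pdivlMr// ltNge ltW// truncnS_gt.
Qed.

(* The exchanges carry [w j] to index 1, and [w j] tends to 0. *)
Lemma support_axis (x1 x2 : R) : S (x1, x2) -> S (x1, 0%R).
Proof.
move=> sx e e0; rewrite lt_neqAle measure_ge0 andbT; apply/eqP => P0.
have mp := measurable_path mw.
have all0 j : P [set o | (`|w 0%N o - x1| < e)%R /\ (`|w j.+1 o - 0%R| < e)%R] = 0.
  elim: j => [|j IHj]; first exact: esym P0.
  have := swap_null j.+1 (measurable_box 0%N j.+1 x1 0%R e) IHj.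
  by move=> h; rewrite -[RHS]h; congr (P _); apply/seteqP; split => o /=; rewrite /transp eqxx.
have : P [set o | (`|w 0%N o - x1| < e)%R] = 0.
  have mA (C : set (seqR R)) : measurable C -> measurable [set o | C (path w o)].
    by move=> mC; rewrite -[X in measurable X]setTI; exact: mp.
  have mb j := mA _ (measurable_box 0%N j.+1 x1 0%R e).
  have mB : measurable [set o | (`|w 0%N o - x1| < e)%R].
    by have := mA _ (measurable_box 0%N 0%N x1 x1 e); congr measurable; apply/seteqP; split => o /=; [case|].
  apply/(ae_null P mB).
  have /ae_foralln h : forall j, {ae P, forall o, ~ ((`|w 0%N o - x1| < e)%R /\ (`|w j.+1 o - 0%R| < e)%R)}.
    by move=> j; exact: ((ae_null P (mb j)).2 (all0 j)).
  apply: filterS2 aegood h => o gy h wx; have [j wj] := good_small gy.2 e0.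
  apply: (h j); split => //; rewrite subr0 ger0_norm//.
  by apply: ltW; exact: gy.2.1.
move=> h; have := sx e e0; rewrite ltNge => /negP; apply.
rewrite -h; apply: le_measure; rewrite ?inE.
- exact: measurable_ball2.
- by have := measurable_ball2 x1 x1 e (mw 0%N) (mw 0%N); congr measurable; apply/seteqP; split => o /=; [case|].
- by move=> o [].
Qed.

(** The four corners (x1, x2), (x1, 0), (0, x2) and (0, 0) lie in the support by [support_axis] and
    [support_swap]; convexity fills the rectangle they span. *)
Lemma support_rectangle (x1 x2 : R) : convex2 S -> S (x1, x2) ->
  forall p q : R, (0 <= p <= x1)%R -> (0 <= q <= x2)%R -> S (p, q).
Proof.
move=> cS sx p q /andP[p0 px] /andP[q0 qx].
have s10 := support_axis sx; have s02 := support_swap (support_axis (support_swap sx)).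
have s00 := support_axis s02.
have ratio (r x : R) : (0 <= r <= x)%R -> exists2 t : R, (0 <= t <= 1)%R & (t * x = r)%R.
  move=> /andP[r0]; rewrite le_eqVlt => /orP[/eqP <-|rx].
    by exists 1%R; rewrite ?mul1r// ler01 lexx.
  have x0 : (0 < x)%R by exact: le_lt_trans rx.
  exists (r / x)%R; last by rewrite divfK// gt_eqF.
  by rewrite divr_ge0// ?(ltW x0)//= ler_pdivrMr// mul1r ltW.
have [t t01 tE] := ratio p x1 (introT andP (conj p0 px)).
have [s s01 sE] := ratio q x2 (introT andP (conj q0 qx)).
have := cS _ _ t sx s02 t01; have := cS _ _ t s10 s00 t01.
rewrite /= !mulr0 !addr0 tE => a b.
have := cS _ _ s b a s01; rewrite /= -mulrDl mulr0 addr0.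
have -> : ((s + (1 - s)) * p = p)%R by ring.
by have -> : (s * (t * x2 + (1 - t) * x2) = q)%R by rewrite -sE; ring.
Qed.

End weights_support.

Section first_step.
Local Open Scope ereal_scope.
Context {R : realType} d (T : measurableType d) (P : probability T R).
Variable v : nat -> T -> R.
Hypothesis mv : forall j, measurable_fun setT (v j).
Hypothesis v01 : forall j o, (0 <= v j o <= 1)%R.
Hypothesis aegood : {ae P, forall o, good_sticks (path v o)}.
Local Notation w := (sb_weights v).
Hypothesis swap : swap_invariant P w.

Let mw := measurable_sb_weights mv.

Lemma sb_weights0 o : w 0%N o = v 0%N o.
Proof. by rewrite /sb_weights big_ord0 mulr1. Qed.

Lemma sb_weights1 o : (w 1%N o = v 1%N o * (1 - v 0%N o))%R.
Proof. by rewrite /sb_weights big_ord1. Qed.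

(** Left continuity promotes the almost sure identity to every point with positive coordinates in a
    rectangle below a support point, where [rectangle_const] applies. *)
Lemma left_version_const (g : R -> R) : convex2 (support2 P (w 0%N) (w 1%N)) ->
  (forall (u : nat -> R) (u0 : R), (forall n, u n < u0)%R -> u @ \oo --> u0 ->
    g (u n) @[n --> \oo] --> g u0) ->
  {ae P, forall o, g (v 1%N o) = g (mobius (v 1%N o) (v 0%N o))} ->
  exists c, {ae P, forall o, g (v 1%N o) = c}.
Proof.
move=> cS gl gv.
have gw : {ae P, forall o, g (w 1%N o / (1 - w 0%N o))%R = g (w 0%N o / (1 - w 1%N o))%R}.
  apply: filterS2 aegood gv => o gy; rewrite sb_weights0 sb_weights1.
  have /andP[v0 v1] := gy.1 0%N; rewrite /path/= in v0 v1.
  rewrite mulfK; last by rewrite subr_eq0 gt_eqF.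
  by rewrite /mobius [(v 1%N o * _)%R]mulrC.
have rel (x1 x2 : R) : support2 P (w 0%N) (w 1%N) (x1, x2) -> (0 < x1)%R -> (0 < x2)%R ->
    (x1 + x2 < 1)%R -> forall p q : R, (0 < p <= x1)%R -> (0 < q <= x2)%R ->
    g (q / (1 - p))%R = g (p / (1 - q))%R.
  move=> sx x10 x20 x12 p q /andP[p0 px] /andP[q0 qx].
  have rect := support_rectangle mv aegood swap cS sx.
  pose m := Num.min p q; have m0 : (0 < m)%R by rewrite lt_min p0.
  have [mp mq] : (m <= p)%R /\ (m <= q)%R by rewrite !ge_min !lexx orbT.
  (* The ball of radius [e n] around (p - e n, q - e n) lies strictly below (p, q), and 2 e n <=
     min(p, q) keeps its centre in the rectangle and its points nonnegative. *)
  pose e (n : nat) : R := (m / 2 / n.+1%:R)%R.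
  have e0 n : (0 < e n)%R by rewrite !divr_gt0.
  have e2 n : (e n * 2 <= m)%R.
    have : (n.+1%:R^-1 <= 1 :> R)%R by rewrite invf_le1// ler1n.
    rewrite /e; set i := (n.+1%:R^-1)%R => i1; have : (0 <= m * (1 - i))%R by rewrite mulr_ge0 ?subr_ge0// ltW.
    lra.
  have ce : e @ \oo --> (0 : R)%R.
    rewrite -[X in _ --> X](mulr0 (m / 2)%R); apply: cvgM; first exact: cvg_cst.
    exact: cvg_harmonic.
  have /boolp.choice[s hs] : forall n : nat, exists t,
      ((`|w 0%N t - (p - e n)| < e n)%R /\ (`|w 1%N t - (q - e n)| < e n)%R) /\
      g (w 1%N t / (1 - w 0%N t))%R = g (w 0%N t / (1 - w 1%N t))%R.
    move=> n.
    have en0 := e0 n; have en2 := e2 n.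
    have Sn : support2 P (w 0%N) (w 1%N) ((p - e n)%R, (q - e n)%R).
      by apply: rect; apply/andP; split; lra.
    have [t [h1 h2]] := ae_nonempty gw (measurable_ball2 (p - e n) (q - e n) (e n) (mw 0%N) (mw 1%N)) (Sn _ en0).
    by exists t.
  have sub (r : R) (x : nat -> R) : (forall n, `|x n - (r - e n)| < e n)%R ->
      (forall n, x n < r)%R /\ x @ \oo --> r.
    move=> h; have b n : (r - e n * 2 < x n)%R /\ (x n < r)%R.
      by have := h n; rewrite ltr_norml => /andP[? ?]; split; lra.
    split; first by move=> n; have [] := b n.
    apply: (@squeeze_cvgr _ _ _ _ (fun n => r - e n * 2)%R (fun=> r)).
    - by apply: nearW => n; have [? ?] := b n; apply/andP; split; apply: ltW.
    - rewrite -[X in _ --> X]subr0 -[X in (_ - X)%R](mul0r (2 : R)%R).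
      apply: cvgB; first exact: cvg_cst.
      by apply: cvgM => //; exact: cvg_cst.
    - exact: cvg_cst.
  have [w0p c0] := sub p (fun n => w 0%N (s n)) (fun n => (hs n).1.1).
  have [w1q c1] := sub q (fun n => w 1%N (s n)) (fun n => (hs n).1.2).
  have w1p n : (0 <= w 1%N (s n))%R.
    by have [_ ] := (hs n).1; have := e2 n; rewrite ltr_norml => ? /andP[? ?]; lra.
  have w0p' n : (0 <= w 0%N (s n))%R.
    by have [+ _] := (hs n).1; have := e2 n; rewrite ltr_norml => ? /andP[? ?]; lra.
  (* The quotient b / (1 - a) increases with both entries, so strict approach of (a0, b0) from below
     gives strict approach of its quotient, as left continuity demands. *)
  have quot (a b : nat -> R) (a0 b0 : R) : (a0 < 1)%R -> (forall n, 0 <= b n)%R ->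
      (forall n, a n < a0)%R -> (forall n, b n < b0)%R -> a @ \oo --> a0 -> b @ \oo --> b0 ->
      g (b n / (1 - a n))%R @[n --> \oo] --> g (b0 / (1 - a0))%R.
    move=> a01 bp aa bb ca cb; apply: gl.
      move=> n; have h1 := aa n; have h2 := bb n; have h3 := bp n.
      have D0 : (0 < 1 - a0)%R by lra.
      have D1 : (0 < 1 - a n)%R by lra.
      rewrite ltr_pdivlMr// mulrAC ltr_pdivrMr//.
      apply: (@le_lt_trans _ _ (b n * (1 - a n))%R); last by rewrite ltr_pM2r.
      by apply: ler_wpM2l => //; lra.
    apply: cvgM => //; apply: cvgV; first by rewrite subr_eq0 gt_eqF.
    by apply: cvgB => //; exact: cvg_cst.
  have g1 := quot _ _ p q _ w1p w0p w1q c0 c1; have {}g1 := g1 ltac:(lra).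
  have g2 := quot _ _ q p _ w0p' w1q w0p c1 c0; have {}g2 := g2 ltac:(lra).
  have E : (fun n => g (w 1%N (s n) / (1 - w 0%N (s n)))%R) =
           (fun n => g (w 0%N (s n) / (1 - w 1%N (s n)))%R).
    by apply/funext => n; exact: (hs n).2.
  rewrite E in g1; exact: (cvg_unique (@Rhausdorff R) g1 g2).
have const (x1 x2 : R) : support2 P (w 0%N) (w 1%N) (x1, x2) -> (0 < x1)%R -> (0 < x2)%R ->
    (x1 + x2 < 1)%R -> forall s t : R, (0 < s <= t)%R -> (t <= x2 / (1 - x1))%R -> g t = g s.
  by move=> sx x10 x20 x12; exact: (rectangle_const gl x10 x20 x12 (rel _ _ sx x10 x20 x12)).
(* The rectangle is taken at the support point (w_0, w_1) of the outcome itself; the right end w_1 /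
   (1 - w_0) of the interval of constancy is then v_1. *)
have good1 : {ae P, forall o, (0 < v 1%N o)%R /\ forall s : R, (0 < s <= v 1%N o)%R -> g (v 1%N o) = g s}.
  apply: filterS2 aegood (support2_full P (mw 0%N) (mw 1%N)) => o gy so.
  have /andP[y00 y01] := gy.1 0%N; have /andP[y10 y11] := gy.1 1%N.
  rewrite /path/= in y00 y01 y10 y11.
  have E : v 1%N o = (w 1%N o / (1 - w 0%N o))%R.
    by rewrite sb_weights0 sb_weights1 mulfK// subr_eq0 gt_eqF.
  split => // s sv; apply: (const _ _ so _ _ _ s (v 1%N o) sv).
  - exact: gy.2.1 0%N.
  - exact: gy.2.1 1%N.
  - by rewrite sb_weights0 sb_weights1; nra.
  - by rewrite E.
have PT : 0 < P setT by rewrite probability_setT.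
have [t1 [_ [v10 h1]]] := ae_nonempty good1 (@measurableT _ T) PT.
exists (g (v 1%N t1)); apply: filterS good1 => o [v0 h].
(* Constancy is known on ]0, v_1] for each outcome separately; two such intervals always meet, so
   the constant is common. *)
have m0 : (0 < Num.min (v 1%N o) (v 1%N t1))%R by rewrite lt_min v0.
by rewrite (h _ (introT andP (conj m0 _))) ?ge_min ?lexx// (h1 _ (introT andP (conj m0 _))) ?ge_min ?lexx ?orbT.
Qed.

(** Under (B) and (C) the regularity belongs to a given version and not to the Markov kernel
    [kappa]. Their moments agree almost surely, so constancy is proved for the regular version and
    carried back. *)
Lemma first_const (kappa : R -> probability R R) l :
  (forall B : set R, measurable B -> measurable_fun setT (fun u : R => (kappa u B : \bar R))) ->
  (forall A B C, measurable A -> measurable B -> measurable C ->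
    P ((v 0%N @^-1` A `&` v 1%N @^-1` B) `&` v 2%N @^-1` C) =
    \int[P]_(o in v 0%N @^-1` A `&` v 1%N @^-1` B) kappa (v 1%N o) C) ->
  condA P v \/ condB P v \/ condC P v ->
  exists c, {ae P, forall o, kmom kappa l (v 1%N o) = c}.
Proof.
move=> mk ker cond.
have inv0 : stick_invariant P v 0 := swap_stick_invariant mv aegood swap 0.
have f0 x : (0 <= onem_pow l x :> R)%R by exact: onem_pow_ge0.
have y1 : {ae P, forall o, (0 < v 1%N o < 1)%R} by apply: filterS aegood => o [h _]; exact: h.
have kswap (phi : R -> probability R R) :
    (forall B : set R, measurable B -> measurable_fun setT (fun u : R => (phi u B : \bar R))) ->
    cond_version P v 0 (onem_pow l) (kmom phi l) ->
    {ae P, forall o, kmom phi l (v 1%N o) = kmom phi l (mobius (v 1%N o) (v 0%N o))}.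
  move=> mphi; apply: (cond_version_swap mv v01 aegood f0 (measurable_onem_pow l) _ (measurable_kmom mphi l) inv0).
  by move=> x; rewrite kmom_ge0 kmom_le1.
have kcond : cond_version P v 0 (onem_pow l) (kmom kappa l) by exact: cond_version_kernel.
have version (phi : R -> probability R R) : cond_law_version P (v 1%N) (v 2%N) phi ->
    {ae P, forall o, kmom kappa l (v 1%N o) = kmom phi l (v 1%N o)}.
  move=> [mphi hphi].
  apply: (ae_eq_test (mv 1%N) (measurable_kmom mk l) (measurable_kmom mphi l)).
  - exact: kmom_ge0.
  - exact: kmom_ge0.
  - apply: integral_le1_lty => [|o].
      by apply/measurable_EFinP; exact: measurableT_comp (measurable_kmom mphi l) (mv 1%N).
    by rewrite !lee_fin kmom_ge0 kmom_le1.
  have hI := posfun_integral P (@measurableT _ T).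
  have h1 := posfun_comp hI (mv 1%N) (fun o => kmom_ge0 kappa l (v 1%N o)) (measurableT_comp (measurable_kmom mk l) (mv 1%N)).
  have h2 := posfun_comp hI (mv 1%N) (fun o => kmom_ge0 phi l (v 1%N o)) (measurableT_comp (measurable_kmom mphi l) (mv 1%N)).
  apply: (posfun_ext h1 h2) => B mB.
  have mE : measurable (v 1%N @^-1` B) by rewrite -[X in measurable X]setTI; exact: mv.
  have ker1 C : measurable C -> P (v 1%N @^-1` B `&` v 2%N @^-1` C) =
      \int[P]_(o in v 1%N @^-1` B) kappa (v 1%N o) C.
    by move=> mC; have := ker setT B C measurableT mB mC; rewrite preimage_setT setTI.
  have e1 := kernel_moment mk l mE (mv 1%N) (mv 2%N) ker1.
  have e2 := kernel_moment mphi l mE (mv 1%N) (mv 2%N) (fun C mC => hphi B C mB mC).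
  transitivity (\int[P]_o ((\1_(v 1%N @^-1` B) o)%:E * (kmom kappa l (v 1%N o))%:E)).
    by apply: eq_integral => o _; rewrite muleC.
  by rewrite -e1 e2; apply: eq_integral => o _; rewrite muleC.
have mp : measurable_fun setT (fun o => (v 0%N o, v 1%N o) : (measurableTypeR R * measurableTypeR R)%type).
  by apply: measurable_fun_pair; exact: mv.
have vcond (phi : R -> probability R R) :
    (forall B : set R, measurable B -> measurable_fun setT (fun u : R => (phi u B : \bar R))) ->
    {ae P, forall o, kmom kappa l (v 1%N o) = kmom phi l (v 1%N o)} ->
    cond_version P v 0 (onem_pow l) (kmom phi l).
  move=> mphi ver h h0 mh; rewrite kcond//.
  have mm (chi : R -> probability R R) :
      (forall B : set R, measurable B -> measurable_fun setT (fun u : R => (chi u B : \bar R))) ->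
      measurable_fun setT (fun o => (kmom chi l (v 1%N o))%:E * h (v 0%N o, v 1%N o)).
    move=> mchi; apply: emeasurable_funM; last exact: measurableT_comp mh mp.
    by apply/measurable_EFinP; exact: measurableT_comp (measurable_kmom mchi l) (mv 1%N).
  apply: (eq_integral_ae ver).
  - by move=> o; rewrite mule_ge0// lee_fin kmom_ge0.
  - by move=> o; rewrite mule_ge0// lee_fin kmom_ge0.
  - exact: mm.
  - exact: mm.
  by move=> o ->.
case: cond => [cA|[[cS [phi [cphi left]]]|[[eps [e01 line]] [psi [cpsi cont]]]]].
- by apply: (ac_square_const (mv 0%N) (mv 1%N) (measurable_kmom mk l) cA y1); exact: kswap.
- have ver := version _ cphi; have [mphi _] := cphi.
  have [c hc] : exists c, {ae P, forall o, kmom phi l (v 1%N o) = c}.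
    apply: left_version_const => //.
      by move=> u u0 uu cu; apply: weak_cvg_kmom; exact: left.
    by apply: kswap => //; exact: vcond.
  by exists c; apply: filterS2 ver hc => o ->.
- have ver := version _ cpsi; have [mpsi _] := cpsi.
  have hc : {ae P, forall o, kmom psi l (v 1%N o) = kmom psi l eps}.
    apply: (continuous_version_const (mv 0%N) (mv 1%N) e01 line).
    + by move=> u u0 su su0 cu; apply: weak_cvg_kmom; exact: cont.
    + by move=> N mN PN; exact: (stick_null mv aegood mN inv0 PN).
    + exact: y1.
    by apply: kswap => //; exact: vcond.
  by exists (kmom psi l eps); apply: filterS2 ver hc => o ->.
Qed.

End first_step.

(** * Moment identities and the beta laws *)

Section pair_moments.
Local Open Scope ereal_scope.
Context {R : realType} d (T : measurableType d) (P : probability T R).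
Implicit Types (X Y : T -> R) (E : set T).

Definition mixmom E X i j : R := fine (\int[P]_o ((\1_E o)%:E * ((X o) ^+ i * (1 - X o) ^+ j)%R%:E)).

Section one_variable.
Variables (X : T -> R) (E : set T).
Hypotheses (mX : measurable_fun setT X) (X01 : forall o, (0 <= X o <= 1)%R) (mE : measurable E).

Lemma mix01 i j o : (0 <= (X o) ^+ i * (1 - X o) ^+ j <= 1)%R.
Proof.
have /andP[x0 x1] := X01 o.
rewrite mulr_ge0 ?exprn_ge0 ?subr_ge0//= mulr_ile1 ?exprn_ge0 ?exprn_ile1 ?subr_ge0//.
by rewrite lerBlDr lerDl.
Qed.

Lemma measurable_mix i j : measurable_fun setT (fun o => (X o) ^+ i * (1 - X o) ^+ j)%R.
Proof.
by apply: measurable_funM; apply: measurable_funX => //; exact: measurable_funB.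
Qed.

Let mEmix i j : measurable_fun setT (fun o => (\1_E o)%:E * ((X o) ^+ i * (1 - X o) ^+ j)%R%:E).
Proof.
by apply: emeasurable_funM; [exact: measurable_indicE|apply/measurable_EFinP; exact: measurable_mix].
Qed.

Let Emix0 i j o : 0 <= (\1_E o)%:E * ((X o) ^+ i * (1 - X o) ^+ j)%R%:E.
Proof. by rewrite mule_ge0// lee_fin; have /andP[] := mix01 i j o. Qed.

Lemma mixmomE i j : \int[P]_o ((\1_E o)%:E * ((X o) ^+ i * (1 - X o) ^+ j)%R%:E) = (mixmom E X i j)%:E.
Proof.
rewrite /mixmom fineK// ge0_fin_numE; last by apply: integral_ge0 => o ?; exact: Emix0.
apply: integral_le1_lty => // o; rewrite Emix0/= -EFinM lee_fin indicE.
by have /andP[_ h] := mix01 i j o; case: (o \in E); rewrite /= ?mul1r ?mul0r.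
Qed.

Lemma mixmom_ge0 i j : (0 <= mixmom E X i j)%R.
Proof. by rewrite -lee_fin -mixmomE; apply: integral_ge0 => o ?; exact: Emix0. Qed.

Lemma mixmom_split i j : (mixmom E X i j = mixmom E X i.+1 j + mixmom E X i j.+1)%R.
Proof.
apply: EFin_inj; rewrite EFinD -!mixmomE -ge0_integralD//.
apply: eq_integral => o _; rewrite -!EFinM -EFinD; congr EFin.
by rewrite !exprS; ring.
Qed.

Lemma mixmom_onem_pow l : (mixmom E X 0 l)%:E = \int[P]_o ((\1_E o)%:E * (onem_pow l (X o))%:E).
Proof.
by rewrite -mixmomE; apply: eq_integral => o _; rewrite expr0 mul1r /onem_pow clamp_id.
Qed.

Lemma mixmom_gt0 i j : 0 < P E -> {ae P, forall o, (0 < X o < 1)%R} -> (0 < mixmom E X i j)%R.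
Proof.
move=> PE aeX; rewrite lt_neqAle mixmom_ge0 andbT; apply/eqP => m0.
have := (ae_eq_integral_abs P (@measurableT _ T) (mEmix i j)).1.
rewrite (_ : \int[P]_o `|_| = 0); last first.
  transitivity ((mixmom E X i j)%:E); last by rewrite -m0.
  by rewrite -mixmomE; apply: eq_integral => o _; rewrite gee0_abs.
move=> /(_ erefl) h; move: PE; rewrite lt_neqAle => /andP[/eqP + _]; apply; apply/esym.
apply/(ae_null P mE); apply: filterS2 aeX h => o /andP[x0 x1] /(_ Logic.I) h Eo.
have : (0 < (X o) ^+ i * (1 - X o) ^+ j)%R by rewrite mulr_gt0 ?exprn_gt0// subr_gt0.
by move: h; rewrite indicE mem_set// mul1e => -[->]; rewrite ltxx.
Qed.

End one_variable.

(** The product rule is extended one variable at a time: first to functions of [X] with an indicator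
    in [Y], then to functions of [Y]. *)
Lemma product_integral X Y E : measurable_fun setT X -> measurable_fun setT Y -> measurable E ->
  (forall B D, measurable B -> measurable D ->
    P ((E `&` X @^-1` B) `&` Y @^-1` D) = P (E `&` X @^-1` B) * P (Y @^-1` D)) ->
  forall f h : R -> R, (forall x, 0 <= f x)%R -> (forall x, 0 <= h x)%R ->
  measurable_fun setT f -> measurable_fun setT h ->
  \int[P]_o ((\1_E o)%:E * (f (X o))%:E) < +oo ->
  \int[P]_o ((\1_E o)%:E * ((f (X o))%:E * (h (Y o))%:E)) =
  \int[P]_o ((\1_E o)%:E * (f (X o))%:E) * \int[P]_o (h (Y o))%:E.
Proof.
move=> mX mY mE ind f h f0 h0 mf mh fin.
have hI := posfun_integral P (@measurableT _ T).
have mXB B : measurable B -> measurable (X @^-1` B) by move=> mB; rewrite -[X in measurable X]setTI; exact: mX.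
have mYB B : measurable B -> measurable (Y @^-1` B) by move=> mB; rewrite -[X in measurable X]setTI; exact: mY.
pose q := fine (\int[P]_o ((\1_E o)%:E * (f (X o))%:E)).
have q0' : 0 <= \int[P]_o ((\1_E o)%:E * (f (X o))%:E).
  by apply: integral_ge0 => o ?; rewrite mule_ge0// lee_fin.
have q0 : (0 <= q)%R by rewrite fine_ge0.
have qE : q%:E = \int[P]_o ((\1_E o)%:E * (f (X o))%:E) by rewrite fineK// ge0_fin_numE.
have step D : measurable D -> \int[P]_o ((\1_E o)%:E * ((f (X o))%:E * (\1_D (Y o))%:E)) = q%:E * P (Y @^-1` D).
  move=> mD; rewrite qE.
  pose W := E `&` Y @^-1` D; have mW : measurable W by apply: measurableI => //; exact: mYB.
  pose c := fine (P (Y @^-1` D)); have c0 : (0 <= c)%R by rewrite fine_ge0.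
  have cE : c%:E = P (Y @^-1` D) by rewrite fineK ?fin_num_measure//; exact: mYB.
  have iW0 o : (0 <= \1_W o :> R)%R by [].
  have iE0 o : (0 <= \1_E o :> R)%R by [].
  have ce0 o : (0 <= c * \1_E o :> R)%R by rewrite mulr_ge0.
  have mce : measurable_fun setT (fun o => c * \1_E o)%R by apply: measurable_funM => //; exact: measurable_indic.
  have miW : measurable_fun setT (\1_W : T -> R) by exact: measurable_indic.
  have h1 := posfun_comp hI mX iW0 miW.
  have h2 := posfun_comp hI mX ce0 mce.
  transitivity (\int[P]_o ((\1_W o)%:E * (f (X o))%:E)).
    apply: eq_integral => o _; rewrite -!EFinM; congr EFin.
    rewrite /W indicI/= -mulrA; congr (_ * _)%R; exact: mulrC.
  rewrite (posfun_ext h1 h2 _ (f := fun x => (f x)%:E)); last 3 first.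
  - move=> B mB.
    transitivity (P ((E `&` X @^-1` B) `&` Y @^-1` D)).
      rewrite -integral_indic_prob; last first.
        by apply: measurableI; [apply: measurableI => //; exact: mXB|exact: mYB].
      apply: eq_integral => o _; rewrite -EFinM; congr EFin.
      rewrite /W !indicI/= -!mulrA; congr (_ * _)%R; exact: mulrC.
    rewrite ind// -cE muleC -integral_indic_prob; last by apply: measurableI => //; exact: mXB.
    rewrite -(posfunZ hI (f := fun o => (\1_(E `&` X @^-1` B) o)%:E))//; last first.
      by apply: measurable_indicE; apply: measurableI => //; exact: mXB.
    by apply: eq_integral => o _; rewrite -!EFinM; congr EFin; rewrite indicI/= mulrA.
  - by move=> x; rewrite lee_fin.
  - exact/measurable_EFinP.
  rewrite muleC -cE -(posfunZ hI (f := fun o => (\1_E o)%:E * (f (X o))%:E))//.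
  - by apply: eq_integral => o _; rewrite EFinM muleA.
  - by move=> o; rewrite mule_ge0// lee_fin.
  by apply: emeasurable_funM; [exact: measurable_indicE|apply/measurable_EFinP; exact: measurableT_comp].
pose F o := (\1_E o * f (X o))%R.
have F0 o : (0 <= F o)%R by rewrite mulr_ge0.
have mF : measurable_fun setT F by apply: measurable_funM; [exact: measurable_indic|exact: measurableT_comp].
have h1 := posfun_comp hI mY F0 mF.
have h2 := posfun_comp hI mY (fun=> q0) (measurable_cst q).
transitivity (\int[P]_o ((F o)%:E * (h (Y o))%:E)).
  by apply: eq_integral => o _; rewrite muleA EFinM.
rewrite (posfun_ext h1 h2 _ (f := fun x => (h x)%:E)); last 3 first.
- move=> D mD; transitivity (q%:E * P (Y @^-1` D)).
    by rewrite -step//; apply: eq_integral => o _; rewrite muleA EFinM.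
  rewrite -integral_indic_prob; last exact: mYB.
  by rewrite -(posfunZ hI (f := fun o => (\1_(Y @^-1` D) o)%:E))//; apply: measurable_indicE; exact: mYB.
- by move=> x; rewrite lee_fin.
- exact/measurable_EFinP.
rewrite -qE (posfunZ hI (f := fun o => (h (Y o))%:E))//.
  by move=> o; rewrite lee_fin.
by apply/measurable_EFinP; exact: measurableT_comp.
Qed.

Variable v : nat -> T -> R.
Hypothesis mv : forall j, measurable_fun setT (v j).
Hypothesis v01 : forall j o, (0 <= v j o <= 1)%R.
Hypothesis aegood : {ae P, forall o, good_sticks (path v o)}.

(* In the coordinates p = v_k and q = (1 - v_k) v_{k+1} the swap exchanges p and q,
   and the identity compares the expectations of p^i q^j (1 - p - q)^l and
   p^j q^i (1 - p - q)^l. *)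
Lemma pair_moments k (C : set (seqR R)) i j l : measurable C ->
  (forall y, C (stick_swap k y) <-> C y) ->
  let E := path v @^-1` C in
  (forall B D, measurable B -> measurable D ->
    P ((E `&` v k @^-1` B) `&` v k.+1 @^-1` D) = P (E `&` v k @^-1` B) * P (v k.+1 @^-1` D)) ->
  stick_invariant P v k ->
  (mixmom E (v k) i (j + l).+1 * mixmom setT (v k.+1) j l =
   mixmom E (v k) j (i + l).+1 * mixmom setT (v k.+1) i l)%R.
Proof.
move=> mC Cswap E ind inv.
have mE : measurable E by rewrite -[X in measurable X]setTI; exact: measurable_path.
have prod a b : \int[P]_o ((\1_E o)%:E * (((v k o) ^+ a * (1 - v k o) ^+ (b + l).+1)%R%:E *
      ((v k.+1 o) ^+ b * (1 - v k.+1 o) ^+ l)%R%:E)) =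
    (mixmom E (v k) a (b + l).+1 * mixmom setT (v k.+1) b l)%R%:E.
  pose f a b (x : R) : R := (clamp x ^+ a * onem_pow b x)%R.
  have f0 a' b' x : (0 <= f a' b' x)%R by rewrite mulr_ge0 ?onem_pow_ge0// exprn_ge0// clamp_ge0.
  have mf a' b' : measurable_fun setT (f a' b').
    by apply: measurable_funM; [apply: measurable_funX; exact: measurable_clamp|exact: measurable_onem_pow].
  have fE a' b' k' o : f a' b' (v k' o) = ((v k' o) ^+ a' * (1 - v k' o) ^+ b')%R.
    by rewrite /f /onem_pow clamp_id.
  have m1 : \int[P]_o ((\1_E o)%:E * (f a (b + l).+1 (v k o))%:E) = (mixmom E (v k) a (b + l).+1)%:E.
    by rewrite -mixmomE//; apply: eq_integral => o _; rewrite fE.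
  have m2 : \int[P]_o (f b l (v k.+1 o))%:E = (mixmom setT (v k.+1) b l)%:E.
    by rewrite -mixmomE//; apply: eq_integral => o _; rewrite fE indicT mul1e.
  have := product_integral (mv k) (mv k.+1) mE ind (f0 a (b + l).+1) (f0 b l) (mf _ _) (mf _ _).
  rewrite m1 m2 EFinM => /(_ (ltry _)) <-.
  by apply: eq_integral => o _; rewrite !fE.
apply: EFin_inj; rewrite -!prod.
(* Up to the indicator this is p^i q^j (1 - p - q)^l; the density 1 - v_k contributes the last
   factor of the exponent (j + l) + 1. *)
pose H (y : seqR R) : \bar R := (\1_C y)%:E *
  (`|y k ^+ i * (1 - y k) ^+ (j + l) * (y k.+1 ^+ j * (1 - y k.+1) ^+ l)|)%R%:E.
have mc n : measurable_fun setT (fun y : seqR R => y n) by exact: measurable_coord.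
have mo n : measurable_fun setT (fun y : seqR R => 1 - y n)%R by exact: measurable_funB.
have mH : measurable_fun setT H.
  apply: emeasurable_funM; first exact: measurable_indicE.
  apply/measurable_EFinP; apply: measurableT_comp => //.
  by apply: measurable_funM; apply: measurable_funM; exact: measurable_funX.
have H0 y : 0 <= H y by rewrite mule_ge0// lee_fin.
have mpath := measurable_path mv.
have mN : measurable_fun setT (fun o => (`|1 - v k o|)%R%:E : \bar R).
  by apply/measurable_EFinP; apply: measurableT_comp => //; exact: measurable_funB.
have mside a b : measurable_fun setT (fun o => (\1_E o)%:E * (((v k o) ^+ a * (1 - v k o) ^+ (b + l).+1)%R%:E *
      ((v k.+1 o) ^+ b * (1 - v k.+1 o) ^+ l)%R%:E)).
  apply: emeasurable_funM; first exact: measurable_indicE.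
  by apply: emeasurable_funM; apply/measurable_EFinP; exact: measurable_mix.
have side0 a b o : 0 <= (\1_E o)%:E * (((v k o) ^+ a * (1 - v k o) ^+ (b + l).+1)%R%:E *
      ((v k.+1 o) ^+ b * (1 - v k.+1 o) ^+ l)%R%:E).
  have /andP[h1 _] := mix01 (v01 k) a (b + l).+1 o.
  have /andP[h2 _] := mix01 (v01 k.+1) b l o.
  by rewrite !mule_ge0// lee_fin.
transitivity (\int[P]_o ((`|1 - v k o|)%:E * H (path v o))).
  apply: eq_integral => o _; rewrite /H -!EFinM; congr EFin.
  have /andP[h1 _] := mix01 (v01 k) i (j + l) o.
  have /andP[h2 _] := mix01 (v01 k.+1) j l o.
  rewrite [`|_ * _ * _|%R]ger0_norm; last by rewrite mulr_ge0.
  rewrite ger0_norm ?subr_ge0; last by have /andP[] := v01 k o.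
  by rewrite exprS /path; ring.
rewrite (inv H H0 mH); apply: (eq_integral_ae aegood).
- by move=> o; rewrite mule_ge0// lee_fin.
- by move=> o; exact: side0.
- apply: emeasurable_funM => //.
  exact: measurableT_comp mH (measurableT_comp (measurable_stick_swap k) mpath).
- exact: mside.
move=> o gy; have y0 := gy.1 k; have y1 := gy.1 k.+1.
have /andP[a0 a1] := y0; have /andP[b0 b1] := y1.
have onem := stick_swap_onem y0 y1.
have D := stick_swap_den y0 y1.
rewrite /H.
have -> : \1_C (stick_swap k (path v o)) = \1_E o :> R.
  rewrite !indicE; congr ((nat_of_bool _)%:R); apply/idP/idP; rewrite !inE.
    by move=> h; apply/(Cswap (path v o)).
  by move=> h; apply/(Cswap (path v o)).
rewrite -!EFinM; congr EFin.
have E1 : (stick_swap k (path v o) k ^+ i * (1 - stick_swap k (path v o) k) ^+ (j + l) *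
    (stick_swap k (path v o) k.+1 ^+ j * (1 - stick_swap k (path v o) k.+1) ^+ l) =
    ((1 - v k o) * v k.+1 o) ^+ i * v k o ^+ j * ((1 - v k o) * (1 - v k.+1 o)) ^+ l)%R.
  have -> : ((1 - v k o) * v k.+1 o = stick_swap k (path v o) k)%R by rewrite stick_swap_k.
  have -> : ((1 - v k o) * (1 - v k.+1 o) =
    (1 - stick_swap k (path v o) k) * (1 - stick_swap k (path v o) k.+1))%R by rewrite onem.
  have -> : (v k o = (1 - stick_swap k (path v o) k) * stick_swap k (path v o) k.+1)%R.
    by rewrite stick_swap_k stick_swap_k1 mulrC divfK// gt_eqF.
  by rewrite !exprMn exprD; ring.
rewrite E1 /path in a0 a1 b0 b1 *.
rewrite [`|1 - _|%R]ger0_norm ?subr_ge0 ?(ltW a1)//.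
rewrite ger0_norm; last first.
  by rewrite !mulr_ge0 ?exprn_ge0 ?mulr_ge0 ?subr_ge0 ?(ltW a0) ?(ltW a1) ?(ltW b0) ?(ltW b1).
by rewrite exprS !exprMn exprD; ring.
Qed.

End pair_moments.

(** * Recognising beta laws by their moments *)

Section beta_moments.
Local Open Scope ereal_scope.
Context {R : realType} d (T : measurableType d) (P : probability T R).
Local Notation mu := (@lebesgue_measure R).

Lemma bdens_Sr (a b x : R) : bdens a (b + 1) x = ((1 - x) * bdens a b x)%R.
Proof.
rewrite /bdens; case: ifP => [/andP[_ x1]|_]; first exact: beta_dens_Sr.
by rewrite mulr0.
Qed.

Lemma bdens_moment (a b : R) l :
  \int[mu]_x ((bdens a b x)%:E * (onem_pow l x)%:E) = beta_int a (b + l%:R).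
Proof.
rewrite integral_bdens; apply: eq_integral => x; rewrite inE/= in_itv/= => /andP[x0 x1].
rewrite -EFinM; congr EFin; rewrite /onem_pow clamp_id; last by rewrite !ltW.
elim: l => [|l IHl]; first by rewrite expr0 mulr1 addr0.
by rewrite -[l.+1%:R]natr1 addrA beta_dens_Sr// -IHl exprS; ring.
Qed.

(** The recursion is that of B(a, b + l), so it fixes the moments up to the first one. A density [w]
    is allowed because for [v 0] the recursion is available only after reweighting by 1 - v_0. *)
Lemma beta_of_moments (w X : T -> R) (m : nat -> R) (a b : R) :
  measurable_fun setT w -> measurable_fun setT X -> (forall o, 0 <= w o)%R ->
  (forall o, 0 <= X o <= 1)%R -> (0 < a)%R -> (0 < b)%R ->
  (forall l, \int[P]_o ((w o)%:E * (onem_pow l (X o))%:E) = (m l)%:E) ->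
  (forall l, (a + b + l%:R) * m l.+1 = (b + l%:R) * m l)%R ->
  forall f : R -> \bar R, (forall x, 0 <= f x) -> measurable_fun setT f ->
  \int[P]_o ((w o)%:E * f (X o)) = (m 0%N / betaR a b)%:E * \int[mu]_x ((bdens a b x)%:E * f x).
Proof.
move=> mw mX w0 X01 a0 b0 mom rec f f0 mf.
set K := (m 0%N / betaR a b)%R.
have B0 : (0 < betaR a b)%R by exact: betaR_gt0.
have m0 : (0 <= m 0%N)%R.
  rewrite -lee_fin -mom; apply: integral_ge0 => o ?.
  by rewrite mule_ge0// lee_fin// onem_pow_ge0.
have K0 : (0 <= K)%R by rewrite divr_ge0// ltW.
have bl (l : nat) : (0 < b + l%:R)%R by rewrite ltr_pwDl.
have mE l : (m l = K * betaR a (b + l%:R))%R.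
  elim: l => [|l IHl]; first by rewrite addr0 /K divfK// gt_eqF.
  have s0 : (a + b + l%:R != 0)%R by rewrite gt_eqF// -addrA addr_gt0.
  apply: (mulfI s0); rewrite rec IHl -[l.+1%:R]natr1 [(b + (_ + _))%R]addrA.
  by rewrite [LHS]mulrCA -(betaR_rec a0 (bl l)) [RHS]mulrCA addrA.
have hI := posfun_integral P (@measurableT _ T).
have h1 := posfun_comp hI mX w0 mw.
have h2 : posfun (fun f : R -> \bar R => \int[mu]_x ((bdens a b x)%:E * (K%:E * f x))).
  exact: (posfun_comp (posfun_bdens a b) (@measurable_id _ R _) (fun=> K0) (measurable_cst _)).
have KE (h : R -> \bar R) : (forall x, 0 <= h x) -> measurable_fun setT h ->
    \int[mu]_x ((bdens a b x)%:E * (K%:E * h x)) = K%:E * \int[mu]_x ((bdens a b x)%:E * h x).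
  by move=> hh mh; rewrite (posfunZ (posfun_bdens a b)).
have oE l : (fun x : R => (onem_pow l x)%:E) = (fun x : R => ((1 - clamp x) ^+ l)%:E) by [].
have fin : \int[P]_o ((w o)%:E * 1) < +oo.
  have := mom 0%N; under eq_integral do rewrite /onem_pow expr0; move=> ->; exact: ltry.
have momE l : \int[P]_o ((w o)%:E * (onem_pow l (X o))%:E) =
    \int[mu]_x ((bdens a b x)%:E * (K%:E * (onem_pow l x)%:E)).
  rewrite mom mE KE; first by rewrite bdens_moment betaRE// EFinM.
    by move=> x; rewrite lee_fin onem_pow_ge0.
  by apply/measurable_EFinP; exact: measurable_onem_pow.
have := moments_unique h1 h2 fin momE f0 mf.
have -> : \int[P]_o ((w o)%:E * f (clamp (X o))) = \int[P]_o ((w o)%:E * f (X o)).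
  by apply: eq_integral => o _; rewrite clamp_id.
move=> ->; rewrite -KE//; apply: eq_integral => x _.
rewrite /bdens; case: ifP => [/andP[x0 x1]|_]; last by rewrite !mul0e.
by rewrite clamp_id// !ltW.
Qed.

Lemma beta_law_of_integral (X : T -> R) (a b c : R) : (0 < a)%R -> (0 < b)%R ->
  measurable_fun setT X ->
  (forall f : R -> \bar R, (forall x, 0 <= f x) -> measurable_fun setT f ->
    \int[P]_o f (X o) = c%:E * \int[mu]_x ((bdens a b x)%:E * f x)) -> beta_law P X a b.
Proof.
move=> a0 b0 mX h; apply/beta_law_int => A mA.
have B0 : (0 < betaR a b)%R by exact: betaR_gt0.
have mXA : measurable (X @^-1` A) by rewrite -[X in measurable X]setTI; exact: mX.
have : (1 : \bar R) = c%:E * (betaR a b)%:E.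
  rewrite -betaRE// -[b in RHS]addr0 -(bdens_moment a b 0) -h.
  - transitivity (\int[P]_o (\1_(setT : set T) o)%:E).
      by rewrite integral_indic_prob// probability_setT.
    by apply: eq_integral => o _; rewrite indicT /onem_pow expr0.
  - by move=> x; rewrite lee_fin onem_pow_ge0.
  by apply/measurable_EFinP; exact: measurable_onem_pow.
rewrite -EFinM => -[cB]; rewrite betaRE// inver gt_eqF//.
have cE : (c = (betaR a b)^-1)%R by rewrite -[LHS](mulfK (lt0r_neq0 B0)) -cB mul1r.
rewrite cE in h.
rewrite muleC -h; last exact: measurable_indicE.
  by rewrite -integral_indic_prob.
by move=> x; rewrite lee_fin.
Qed.

End beta_moments.

(** The two hypotheses are [pair_moments] for (i, j) = (1, 0) and (2, 1). The first expresses the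
    differences of [b] through [a]; inserted in the second it leaves a relation between a_{l+1},
    ..., a_{l+4}, which clears to y_{l+1} + y_{l+3} = 2 y_{l+2}. The value y_0 never enters, so the
    progression starts at index 1. *)
Lemma moments_progression (R : realFieldType) (a b : nat -> R) :
  (forall l, 0 < a l) -> (forall l, a l.+1 < a l) -> (forall l, 0 < b l) ->
  (forall l, (a l.+1 - a l.+2) * b l = a l.+2 * (b l - b l.+1)) ->
  (forall l, (a l.+2 - 2 * a l.+3 + a l.+4) * (b l - b l.+1) =
             (a l.+3 - a l.+4) * (b l - 2 * b l.+1 + b l.+2)) ->
  let y l := a l / (a l - a l.+1) in
  forall l, y l.+1 = y 1%N + l%:R * (y 2%N - y 1%N).
Proof.
move=> a0 da b0 M1 M2 y.
have d0 l : 0 < a l - a l.+1 by rewrite subr_gt0.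
have second l : y l.+1 + y l.+3 = 2 * y l.+2.
  rewrite /y; have := M2 l; have := M1 l; have := M1 l.+1.
  have := d0 l.+1; have := d0 l.+2; have := d0 l.+3.
  have := a0 l.+2; have := a0 l.+3; have := b0 l.
  move: (a l.+1) (a l.+2) (a l.+3) (a l.+4) (b l) (b l.+1) (b l.+2).
  move=> x1 x2 x3 x4 u0 u1 u2 u00 x30 x20 e3 e2 e1 m1' m1 m2.
  have E1 : u0 - u1 = (x1 - x2) * u0 / x2 by rewrite m1 mulrAC divff ?mul1r// gt_eqF.
  have U1 : u1 = u0 - (x1 - x2) * u0 / x2 by rewrite -E1 subKr.
  have E2 : u1 - u2 = (x2 - x3) * u1 / x3 by rewrite m1' mulrAC divff ?mul1r// gt_eqF.
  have E3 : u0 - 2 * u1 + u2 = (u0 - u1) - (u1 - u2) by ring.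
  rewrite E3 E2 E1 U1 in m2.
  have m3 : (x2 - 2 * x3 + x4) * (x1 - x2) * x3 =
      (x3 - x4) * ((x1 - x2) * x3 - (x2 - x3) * (x2 - (x1 - x2))).
    have n0 : u0 != 0 by rewrite gt_eqF.
    apply: (mulfI n0); have := congr1 (fun z => z * (x2 * x3)) m2.
    have -> : (x2 - 2 * x3 + x4) * ((x1 - x2) * u0 / x2) * (x2 * x3) =
        u0 * ((x2 - 2 * x3 + x4) * (x1 - x2) * x3) by field; rewrite gt_eqF.
    move=> ->; field; apply/andP; split; by rewrite gt_eqF.
  have e1n : x1 - x2 != 0 by rewrite gt_eqF.
  have e2n : x2 - x3 != 0 by rewrite gt_eqF.
  have e3n : x3 - x4 != 0 by rewrite gt_eqF.
  apply/eqP; rewrite -subr_eq0; apply/eqP.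
  have -> : x1 / (x1 - x2) + x3 / (x3 - x4) - 2 * (x2 / (x2 - x3)) =
    (x1 * (x2 - x3) * (x3 - x4) + x3 * (x1 - x2) * (x2 - x3) - 2 * x2 * (x1 - x2) * (x3 - x4)) /
    ((x1 - x2) * (x2 - x3) * (x3 - x4)) by field; rewrite e1n e2n e3n.
  rewrite (_ : _ - _ = 0) ?mul0r//.
  have := congr1 (fun z => z - (x3 - x4) * ((x1 - x2) * x3 - (x2 - x3) * (x2 - (x1 - x2)))) m3.
  by rewrite subrr => <-; ring.
suff h l : y l.+1 = y 1%N + l%:R * (y 2%N - y 1%N) /\ y l.+2 = y 1%N + l.+1%:R * (y 2%N - y 1%N).
  by move=> l; have [] := h l.
elim: l => [|l [h1 h2]]; first by rewrite mul0r mul1r addr0 addrC subrK.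
split => //; have := second l; rewrite h1 h2 -!natr1 => h; lra.
Qed.

Section classification.
Local Open Scope ereal_scope.
Context {R : realType} d (T : measurableType d) (P : probability T R).
Local Notation mu := (@lebesgue_measure R).
Variable v : nat -> T -> R.
Hypothesis mv : forall j, measurable_fun setT (v j).
Hypothesis v01 : forall j o, (0 <= v j o <= 1)%R.
Hypothesis aegood : {ae P, forall o, good_sticks (path v o)}.

Let mvA j (A : set R) : measurable A -> measurable (v j @^-1` A).
Proof. by move=> mA; rewrite -[X in measurable X]setTI; exact: mv. Qed.

Let vae j : {ae P, forall o, (0 < v j o < 1)%R}.
Proof. by apply: filterS aegood => o [h _]; exact: h. Qed.

Let PT : 0 < P setT. Proof. by rewrite probability_setT. Qed.

Lemma mixmom_setT_gt0 j m l : (0 < mixmom P setT (v j) m l)%R.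
Proof. by apply: mixmom_gt0. Qed.

(** The case i = 1, j = 0 of [pair_moments], with each mixed moment rewritten as a difference of
    moments of 1 - v. *)
Lemma first_moment_identity k (C : set (seqR R)) l : measurable C ->
  (forall y, C (stick_swap k y) <-> C y) ->
  (forall B D, measurable B -> measurable D ->
    P ((path v @^-1` C `&` v k @^-1` B) `&` v k.+1 @^-1` D) =
    P (path v @^-1` C `&` v k @^-1` B) * P (v k.+1 @^-1` D)) ->
  stick_invariant P v k ->
  ((mixmom P (path v @^-1` C) (v k) 0 l.+1 - mixmom P (path v @^-1` C) (v k) 0 l.+2) *
    mixmom P setT (v k.+1) 0 l =
   mixmom P (path v @^-1` C) (v k) 0 l.+2 *
    (mixmom P setT (v k.+1) 0 l - mixmom P setT (v k.+1) 0 l.+1))%R.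
Proof.
move=> mC Cs ind inv.
have mE : measurable (path v @^-1` C) by rewrite -[X in measurable X]setTI; exact: measurable_path.
have := pair_moments mv v01 aegood 1 0 l mC Cs ind inv; rewrite add0n add1n.
rewrite (mixmom_split P (mv k) (v01 k) mE 0 l.+1) addrK.
by rewrite (mixmom_split P (mv k.+1) (v01 k.+1) measurableT 0 l) addrK.
Qed.

(* [first_moment_identity] is a recursion for E[1_A(v_0) (1 - v_1)^l], l >= 1, whose
   coefficients do not depend on [A]. *)
Lemma first_pair_independent :
  (forall A B D, measurable A -> measurable B -> measurable D ->
    P ((v 0%N @^-1` A `&` v 1%N @^-1` B) `&` v 2%N @^-1` D) =
    P (v 0%N @^-1` A `&` v 1%N @^-1` B) * P (v 2%N @^-1` D)) ->
  stick_invariant P v 1 ->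
  forall A B, measurable A -> measurable B ->
  P (v 0%N @^-1` A `&` v 1%N @^-1` B) = P (v 0%N @^-1` A) * P (v 1%N @^-1` B).
Proof.
move=> ind inv A B0 mA mB.
pose C (D : set R) : set (seqR R) := [set y | D (y 0%N)].
have mC D : measurable D -> measurable (C D).
  by move=> mD; rewrite -[X in measurable X]setTI; exact: measurable_coord.
have Cs D y : C D (stick_swap 1 y) <-> C D y by [].
pose E D := path v @^-1` C D.
pose al D l := mixmom P (E D) (v 1%N) 0 l.
pose be l := mixmom P setT (v 2%N) 0 l.
have mE D : measurable D -> measurable (E D) by exact: mvA.
have M1 D l : measurable D -> ((al D l.+1 - al D l.+2) * be l = al D l.+2 * (be l - be l.+1))%R.
  move=> mD; apply: first_moment_identity => //; first exact: mC.
  by move=> *; exact: ind.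
have be0 l : (0 < be l)%R by exact: mixmom_setT_gt0.
have bed l : (0 < be l - be l.+1)%R.
  rewrite /be (mixmom_split P (mv 2%N) (v01 2%N) measurableT 0 l) addrK.
  exact: mixmom_setT_gt0.
have ratio D l : measurable D -> (al D l.+1 * al setT 1%N = al setT l.+1 * al D 1%N)%R.
  move=> mD; elim: l => [|l IHl]; first by rewrite mulrC.
  have K0 : (be l + (be l - be l.+1) != 0)%R by rewrite gt_eqF// addr_gt0.
  have step F : measurable F -> (al F l.+2 * (be l + (be l - be l.+1)) = al F l.+1 * be l)%R.
    by move=> mF; rewrite mulrDr -M1//; ring.
  apply: (mulIf K0); rewrite mulrAC step// [RHS]mulrAC step//.
  by rewrite mulrAC IHl mulrAC.
(* The recursion controls only exponents l >= 1, so the comparison of moments is made under the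
   density 1 - v_1, which supplies the first power. *)
pose w1 D o : R := (\1_(E D) o * (1 - v 1%N o))%R.
have w0 D o : (0 <= w1 D o)%R by rewrite mulr_ge0// subr_ge0; have /andP[] := v01 1%N o.
have mw D : measurable D -> measurable_fun setT (w1 D).
  by move=> mD; apply: measurable_funM; [apply: measurable_indic; exact: mE|exact: measurable_funB].
have al0 D l : measurable D -> (0 <= al D l)%R by move=> mD; apply: mixmom_ge0 => //; exact: mE.
have wmom D l : measurable D -> \int[P]_o ((w1 D o)%:E * (onem_pow l (v 1%N o))%:E) = (al D l.+1)%:E.
  move=> mD; rewrite mixmom_onem_pow//; last exact: mE.
  apply: eq_integral => o _; rewrite -!EFinM; congr EFin.
  by rewrite /w1 /onem_pow clamp_id// exprS mulrA.
have hI := posfun_integral P (@measurableT _ T).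
have ET : E setT = setT by [].
have key (D B : set R) : measurable D -> measurable B -> (al setT 1%N)%:E * P (E D `&` v 1%N @^-1` B) = (al D 1%N)%:E * P (v 1%N @^-1` B).
  move=> mD {}mB.
  pose u1 o := (al setT 1%N * w1 D o)%R; pose u2 o := (al D 1%N * w1 setT o)%R.
  have mu1 : measurable_fun setT u1 by apply: measurable_funM => //; exact: mw.
  have mu2 : measurable_fun setT u2 by apply: measurable_funM => //; exact: mw.
  have u10 o : (0 <= u1 o)%R by rewrite mulr_ge0// al0.
  have u20 o : (0 <= u2 o)%R by rewrite mulr_ge0// al0.
  have umom (c : R) F l : (0 <= c)%R -> measurable F ->
      \int[P]_o ((c * w1 F o)%R%:E * (onem_pow l (v 1%N o))%:E) = (c * al F l.+1)%R%:E.
    move=> c0 mF; rewrite EFinM -wmom// -(posfunZ hI (f := fun o => (w1 F o)%:E * (onem_pow l (v 1%N o))%:E))//.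
    - by apply: eq_integral => o _; rewrite EFinM muleA.
    - by move=> o; rewrite mule_ge0// lee_fin// onem_pow_ge0.
    apply: emeasurable_funM; apply/measurable_EFinP; first exact: mw.
    exact: measurableT_comp (measurable_onem_pow l) (mv 1%N).
  (* This test function divides the density 1 - v_1 out again. *)
  pose f (x : R) : \bar R := (`|(1 - x)^-1| * \1_B x)%R%:E.
  have f0 x : 0 <= f x by rewrite lee_fin mulr_ge0.
  have mf : measurable_fun setT f.
    apply/measurable_EFinP; apply: measurable_funM; last exact: measurable_indic.
    apply: measurableT_comp => //; apply: (measurableT_comp (@measurable_invr R)).
    exact: measurable_funB.
  have fin : \int[P]_o (u1 o)%:E < +oo.
    have := umom (al setT 1%N) D 0%N (al0 _ _ measurableT) mD.
    rewrite /onem_pow; under eq_integral do rewrite expr0 mule1.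
    by move=> ->; exact: ltry.
  have mom l : \int[P]_o ((u1 o)%:E * (onem_pow l (v 1%N o))%:E) =
      \int[P]_o ((u2 o)%:E * (onem_pow l (v 1%N o))%:E).
    rewrite umom//; last exact: al0.
    rewrite umom//; last exact: al0.
    by congr EFin; rewrite mulrC ratio// mulrC.
  have := moments_weighted mu1 mu2 (mv 1%N) u10 u20 (v01 1%N) fin mom f0 mf.
  have side (c : R) F : (0 <= c)%R -> measurable F ->
      \int[P]_o ((c * w1 F o)%R%:E * f (v 1%N o)) = c%:E * P (E F `&` v 1%N @^-1` B).
    move=> c0 mF; have mEB : measurable (E F `&` v 1%N @^-1` B).
      by apply: measurableI; [exact: mE|exact: mvA].
    rewrite -integral_indic_prob// -(posfunZ hI (f := fun o => (\1_(E F `&` v 1%N @^-1` B) o)%:E))//; last exact: measurable_indicE.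
    apply: (eq_integral_ae (vae 1%N)).
    - by move=> o; rewrite mule_ge0// lee_fin mulr_ge0.
    - by move=> o; rewrite mule_ge0// lee_fin.
    - apply: emeasurable_funM; last exact: measurableT_comp mf (mv 1%N).
      by apply/measurable_EFinP; apply: measurable_funM => //; exact: mw.
    - by apply: emeasurable_funM; [exact: measurable_cst|exact: measurable_indicE].
    move=> o /andP[v0 v1]; rewrite /f -!EFinM; congr EFin.
    rewrite ger0_norm ?invr_ge0 ?subr_ge0 ?(ltW v1)// indicI/= /w1.
    have n0 : (1 - v 1%N o != 0)%R by rewrite subr_eq0 gt_eqF.
    rewrite (_ : \1_(v 1%N @^-1` B) o = \1_B (v 1%N o) :> R)%R//.
    by rewrite -!mulrA; congr (_ * (_ * _))%R; rewrite mulrA divff ?mul1r.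
  rewrite side ?al0// side ?al0//.
  by rewrite ET setTI.
have al1 : (0 < al setT 1%N)%R by exact: mixmom_setT_gt0.
have cancel x : ((al setT 1%N)^-1)%:E * ((al setT 1%N)%:E * x) = x.
  by rewrite muleA -EFinM mulVf ?mul1e// gt_eqF.
have e2 : (al setT 1%N)%:E * P (E A) = (al A 1%N)%:E.
  by have := key A setT mA measurableT; rewrite preimage_setT setIT probability_setT mule1.
by rewrite -[LHS]cancel key// -e2 -muleA cancel.
Qed.

(** Since w_0 = v_0, a constant v_0 would be passed on to every weight by the exchanges, but the
    weights are positive and summable. *)
Lemma not_const c : swap_invariant P (sb_weights v) -> ~ {ae P, forall o, v 0%N o = c}.
Proof.
move=> swap v0c.
have mw := measurable_sb_weights mv.
pose C j : set (seqR R) := [set x | x j != c].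
have mC j : measurable (C j).
  rewrite (_ : C j = setT `&` (fun x : seqR R => x j) @^-1` (~` [set c])); last first.
    by rewrite setTI; apply/seteqP; split => x /= /eqP.
  by apply: measurable_coord => //; exact: measurableC.
have mCw j : measurable [set o | C j (path (sb_weights v) o)].
  by rewrite -[X in measurable X]setTI; exact: (measurable_path mw).
have null j : P [set o | C j (path (sb_weights v) o)] = 0.
  elim: j => [|j IHj].
    apply/(ae_null P (mCw 0%N)); apply: filterS v0c => o vc.
    by rewrite /C/= /path sb_weights0 vc eqxx.
  have := swap_null mv aegood swap j (mC j) IHj.
  by move=> h; rewrite -[RHS]h; congr (P _); apply/seteqP; split => o /=; rewrite /C/= /transp eqxx.
have /ae_foralln h : forall j, {ae P, forall o, ~ C j (path (sb_weights v) o)}.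
  by move=> j; exact: ((ae_null P (mCw j)).2 (null j)).
have gd : {ae P, forall o, good (path (sb_weights v) o) /\ forall j, sb_weights v j o = c}.
  apply: filterS2 aegood h => o gy hj; split; first exact: gy.2.
  by move=> j; apply/eqP; apply: contrapT => /negP; exact: hj.
have [t [_ [gw wc]]] := ae_nonempty gd (@measurableT _ T) PT.
have c0 : (0 < c)%R by rewrite -(wc 0%N); exact: gw.1.
have [j] := good_small gw c0.
by rewrite /path wc ltxx.
Qed.
Let indT k : (forall B D, measurable B -> measurable D ->
    P (v k @^-1` B `&` v k.+1 @^-1` D) = P (v k @^-1` B) * P (v k.+1 @^-1` D)) ->
  forall B D, measurable B -> measurable D ->
    P ((path v @^-1` setT `&` v k @^-1` B) `&` v k.+1 @^-1` D) =
    P (path v @^-1` setT `&` v k @^-1` B) * P (v k.+1 @^-1` D).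
Proof. by move=> ind B D mB mD; rewrite preimage_setT setTI; exact: ind. Qed.

Lemma mixmomT_onem_pow j l :
  \int[P]_o (onem_pow l (v j o))%:E = (mixmom P setT (v j) 0 l)%:E.
Proof.
by rewrite mixmom_onem_pow//; apply: eq_integral => o _; rewrite indicT mul1e.
Qed.

(** Inserting the beta moments of [v k] into the first identity turns it into the beta recursion for
    the moments of [v k.+1], with second parameter b + 1 - a. *)
Lemma next_beta k (a b : R) : (0 < a)%R -> (0 < b)%R ->
  (forall B D, measurable B -> measurable D ->
    P (v k @^-1` B `&` v k.+1 @^-1` D) = P (v k @^-1` B) * P (v k.+1 @^-1` D)) ->
  stick_invariant P v k -> beta_law P (v k) a b ->
  (0 < b + 1 - a)%R /\ beta_law P (v k.+1) a (b + 1 - a).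
Proof.
move=> a0 b0 ind inv law.
pose al l := mixmom P setT (v k) 0 l; pose be l := mixmom P setT (v k.+1) 0 l.
have al0 l : (0 < al l)%R by exact: mixmom_setT_gt0.
have be0 l : (0 < be l)%R by exact: mixmom_setT_gt0.
have bl (l : nat) : (0 < b + l%:R)%R by rewrite ltr_pwDl.
have alE l : al l = ((betaR a b)^-1 * betaR a (b + l%:R))%R.
  apply: EFin_inj; rewrite -mixmomT_onem_pow.
  rewrite (beta_law_integral a0 b0 (mv k) law (f := fun x => (onem_pow l x)%:E)).
  - by rewrite bdens_moment betaRE// EFinM.
  - by move=> x; rewrite lee_fin onem_pow_ge0.
  by apply/measurable_EFinP; exact: measurable_onem_pow.
have alrec l : ((a + b + l%:R) * al l.+1 = (b + l%:R) * al l)%R.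
  rewrite !alE -[l.+1%:R]natr1 [(b + (_ + _))%R]addrA.
  by rewrite [RHS]mulrCA -(betaR_rec a0 (bl l)) [LHS]mulrCA addrA.
have M1 l : ((al l.+1 - al l.+2) * be l = al l.+2 * (be l - be l.+1))%R.
  exact: (first_moment_identity l (C := setT) measurableT (fun=> iff_refl _) (indT ind) inv).
set b' := (b + 1 - a)%R.
have berec l : ((a + b' + l%:R) * be l.+1 = (b' + l%:R) * be l)%R.
  have e1 := alrec l.+1; rewrite -[l.+1%:R]natr1 in e1.
  have e2 : (al l.+1 * be l = al l.+2 * (2 * be l - be l.+1))%R by have := M1 l; lra.
  have e3 : ((a + b + (l%:R + 1)) * (al l.+1 * be l) = (b + (l%:R + 1)) * al l.+1 * (2 * be l - be l.+1))%R.
    by rewrite e2 mulrA e1.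
  apply: (mulfI (lt0r_neq0 (al0 l.+1))); rewrite /b'; lra.
(* The recursion at l = 0 reads (a + b') be_1 = b' be_0, and its left side is positive because a +
   b' = b + 1. *)
have b'0 : (0 < b')%R.
  have := berec 0%N; rewrite !addr0 => e.
  have : (0 < b' * be 0%N)%R by rewrite -e mulr_gt0// /b'; lra.
  by rewrite pmulr_lgt0.
split => //.
have mom l : \int[P]_o ((1%R)%:E * (onem_pow l (v k.+1 o))%:E) = (be l)%:E.
  by rewrite -mixmomT_onem_pow; apply: eq_integral => o _; rewrite mul1e.
apply: (beta_law_of_integral (c := (be 0%N / betaR a b')%R)) => // f f0 mf.
rewrite -(beta_of_moments (w := fun=> 1%R) (measurable_cst _) (mv k.+1) (fun=> ler01) (v01 k.+1) a0 b'0 mom berec f0 mf).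
by apply: eq_integral => o _; rewrite mul1e.
Qed.

Lemma first_beta : swap_invariant P (sb_weights v) ->
  (forall B D, measurable B -> measurable D ->
    P (v 0%N @^-1` B `&` v 1%N @^-1` D) = P (v 0%N @^-1` B) * P (v 1%N @^-1` D)) ->
  exists a b : R, [/\ (0 < a)%R, (0 < b)%R & beta_law P (v 0%N) a b].
Proof.
move=> swap ind; have inv := swap_stick_invariant mv aegood swap 0.
have hI := posfun_integral P (@measurableT _ T).
pose al l := mixmom P setT (v 0%N) 0 l; pose be l := mixmom P setT (v 1%N) 0 l.
have al0 l : (0 < al l)%R by exact: mixmom_setT_gt0.
have be0 l : (0 < be l)%R by exact: mixmom_setT_gt0.
have s0 i l := mixmom_split P (mv 0%N) (v01 0%N) measurableT i l.
have s1 i l := mixmom_split P (mv 1%N) (v01 1%N) measurableT i l.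
have ald l : (al l.+1 < al l)%R.
  by rewrite -subr_gt0 /al (s0 0%N l) addrK; exact: mixmom_setT_gt0.
have M1 l : ((al l.+1 - al l.+2) * be l = al l.+2 * (be l - be l.+1))%R.
  exact: (first_moment_identity l (C := setT) measurableT (fun=> iff_refl _) (indT ind) inv).
have M2 l : ((al l.+2 - 2 * al l.+3 + al l.+4) * (be l - be l.+1) =
             (al l.+3 - al l.+4) * (be l - 2 * be l.+1 + be l.+2))%R.
  have := pair_moments mv v01 aegood 2 1 l (C := setT) measurableT (fun=> iff_refl _) (indT ind) inv.
  rewrite preimage_setT add1n add2n.
  have e1 i : mixmom P setT (v 0%N) 1 i = (al i - al i.+1)%R by rewrite /al (s0 0%N i) addrK.
  have e2 i : mixmom P setT (v 0%N) 2 i = (al i - 2 * al i.+1 + al i.+2)%R.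
    have := s0 1%N i; rewrite !e1 => h; lra.
  have f1 i : mixmom P setT (v 1%N) 1 i = (be i - be i.+1)%R by rewrite /be (s1 0%N i) addrK.
  have f2 i : mixmom P setT (v 1%N) 2 i = (be i - 2 * be i.+1 + be i.+2)%R.
    have := s1 1%N i; rewrite !f1 => h; lra.
  by rewrite e2 e1 f1 f2.
pose y l := (al l / (al l - al l.+1))%R.
have prog l : (y l.+1 = y 1%N + l%:R * (y 2%N - y 1%N))%R by exact: moments_progression M1 M2 l.
have d0 l : (0 < al l - al l.+1)%R by rewrite subr_gt0.
have y1 l : (1 < y l)%R by rewrite /y ltr_pdivlMr// mul1r gtrBl.
have yal l : (y l * al l.+1 = (y l - 1) * al l)%R.
  have : (y l * (al l - al l.+1) = al l)%R by rewrite /y divfK// gt_eqF.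
  by move=> h; rewrite mulrBl mul1r -[X in (_ - X)%R]h; ring.
set D := (y 2%N - y 1%N)%R in prog.
have w0 o : (0 <= 1 - v 0%N o)%R by rewrite subr_ge0; have /andP[] := v01 0%N o.
have mw : measurable_fun setT (fun o => 1 - v 0%N o)%R by exact: measurable_funB.
have wmom l : \int[P]_o ((1 - v 0%N o)%R%:E * (onem_pow l (v 0%N o))%:E) = (al l.+1)%:E.
  rewrite -mixmomT_onem_pow; apply: eq_integral => o _; rewrite -EFinM; congr EFin.
  by rewrite /onem_pow clamp_id// exprS.
(* A negative common difference would push some y_l below 1. A zero difference would make the
   moments geometric and hence v_0 constant. *)
have D0 : (0 < D)%R.
  rewrite lt_neqAle; apply/andP; split; last first.
    rewrite leNgt; apply/negP => Dneg.
    have := y1 (Num.truncn (y 1%N / - D)%R).+2; rewrite prog.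
    have := truncnS_gt (y 1%N / - D)%R; rewrite ltr_pdivrMr ?oppr_gt0//.
    by rewrite mulrN => h1 h2; lra.
  (* With y constant the ratios of consecutive moments are all 1 - t, so the law reweighted by 1 -
     v_0 is a multiple of the point mass at t. *)
  apply/eqP => DE; pose t := ((y 1%N)^-1)%R.
  have y10 : (0 < y 1%N)%R by rewrite (lt_trans _ (y1 1%N)).
  have t0 : (0 <= t)%R by rewrite invr_ge0 ltW.
  have t1 : (t <= 1)%R by rewrite invf_le1// ltW.
  have alt l : al l.+1 = (al 1%N * (1 - t) ^+ l)%R.
    elim: l => [|l IHl]; first by rewrite expr0 mulr1.
    have := yal l.+1; rewrite prog -DE mulr0 addr0 => h.
    apply: (mulfI (lt0r_neq0 y10)); rewrite h IHl exprS mulrCA [RHS]mulrCA; congr (_ * _)%R.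
    by rewrite mulrA mulrBr mulr1 /t divff// gt_eqF.
  have h1 := posfun_comp hI (mv 0%N) w0 mw.
  have h2 := posfun_comp hI (measurable_cst t : measurable_fun setT (fun _ : T => t)) (fun=> ltW (al0 1%N)) (measurable_cst _).
  have fin : \int[P]_o ((1 - v 0%N o)%R%:E * 1) < +oo.
    have := wmom 0%N; rewrite /onem_pow; under eq_integral do rewrite expr0; move=> ->; exact: ltry.
  have mom l : \int[P]_o ((1 - v 0%N o)%R%:E * ((1 - clamp (v 0%N o)) ^+ l)%R%:E) =
      \int[P]_o ((al 1%N)%:E * ((1 - clamp t) ^+ l)%R%:E).
    rewrite wmom clamp_id ?t0// alt -EFinM.
    rewrite (_ : \int[P]_o _ = \int[P]_o (cst (al 1%N * (1 - t) ^+ l)%R%:E o))//.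
    rewrite integral_cst//.
    by rewrite [X in _ = _ * X](probability_setT P) mule1.
  pose C := ~` [set t].
  have mC : measurable C by exact: measurableC.
  have C0 x : 0 <= (\1_C x)%:E :> \bar R by rewrite lee_fin.
  have := moments_unique h1 h2 fin mom C0 (measurable_indicE mC).
  rewrite clamp_id ?t0// [in X in _ = X](_ : \1_C t = 0%R); last by rewrite indicE memNset//; apply.
  under [X in _ = X]eq_integral do rewrite mule0.
  rewrite integral0 => I0.
  apply: (not_const (c := t) swap).
  have mB : measurable (v 0%N @^-1` C) by exact: mvA.
  have : P (v 0%N @^-1` C) = 0.
    have wgt0 : {ae P, forall o, (0 < 1 - v 0%N o)%R}.
      by apply: filterS (vae 0%N) => o /andP[_ h]; rewrite subr_gt0.
    apply: (null_transfer mw w0 wgt0 measurable0 mB); last exact: measure0.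
    under eq_integral do rewrite indic0 mule0.
    rewrite integral0 -I0; apply: eq_integral => o _; rewrite clamp_id//.
  move=> /(ae_null P mB); apply: filterS => o h; apply: contrapT => h'; exact: h.
(* For a beta law r_l = (b + l) / (a + b + l), so y_l = (a + b + l) / a: the common difference is 1
   / a and y_1 determines b. *)
pose a := (D^-1)%R; pose b := ((y 1%N - 1) / D - 1)%R.
have a0 : (0 < a)%R by rewrite invr_gt0.
have b10 : (0 < b + 1)%R by rewrite /b subrK divr_gt0// subr_gt0.
have rec l : ((a + (b + 1) + l%:R) * al l.+2 = ((b + 1) + l%:R) * al l.+1)%R.
  have := yal l.+1; rewrite prog => h; apply: (mulfI (lt0r_neq0 D0)).
  have -> : (D * ((a + (b + 1) + l%:R) * al l.+2) = (y 1%N + l%:R * D) * al l.+2)%R.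
    by rewrite /a /b; field; exact: lt0r_neq0.
  rewrite h /b; field; exact: lt0r_neq0.
pose K := (al 1%N / betaR a (b + 1))%R.
have K0 : (0 < K)%R by rewrite divr_gt0// betaR_gt0.
(* Reweighted by 1 - v_0, the law of [v 0] is proportional to the beta density with parameters a and
   b + 1; dividing by 1 - x lowers the second parameter to b. *)
have int (h : R -> \bar R) : (forall x, 0 <= h x) -> measurable_fun setT h ->
    \int[P]_o h (v 0%N o) = K%:E * \int[mu]_x ((bdens a b x)%:E * h x).
  move=> h0 mh; pose f x : \bar R := (`|(1 - x)^-1|)%R%:E * h x.
  have mf : measurable_fun setT f.
    apply: emeasurable_funM => //; apply/measurable_EFinP; apply: measurableT_comp => //.
    by apply: (measurableT_comp (@measurable_invr R)); exact: measurable_funB.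
  have f0 x : 0 <= f x by rewrite mule_ge0.
  have can (x : R) : (0 < x < 1)%R -> ((1 - x) * `|(1 - x)^-1| = 1)%R.
    move=> /andP[x0 x1]; rewrite ger0_norm ?invr_ge0 ?subr_ge0 ?(ltW x1)//.
    by rewrite divff// subr_eq0 gt_eqF.
  transitivity (\int[P]_o ((1 - v 0%N o)%R%:E * f (v 0%N o))).
    apply: (eq_integral_ae (vae 0%N)) => //.
    - by move=> o; rewrite mule_ge0// lee_fin.
    - exact: measurableT_comp.
    - apply: emeasurable_funM; first exact/measurable_EFinP.
      exact: measurableT_comp mf (mv 0%N).
    by move=> o vo; rewrite /f muleA -EFinM can// mul1e.
  rewrite (beta_of_moments mw (mv 0%N) w0 (v01 0%N) a0 b10 wmom rec f0 mf); congr (_ * _).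
  apply: eq_integral => x _; rewrite bdens_Sr /f muleA -EFinM.
  have [x01|x01] := boolP (0 < x < 1)%R; first by rewrite mulrAC can// mul1r.
  by rewrite /bdens (negbTE x01) mulr0 mul0r.
(* So far only b + 1 > 0 is known. If b <= 0 the beta integral diverges, while the total mass is
   1. *)
have b0 : (0 < b)%R.
  rewrite ltNge; apply/negP => bneg.
  have : (1 : \bar R) = K%:E * beta_int a b.
    rewrite -[b in RHS]addr0 -(bdens_moment a b 0) -int.
    - transitivity (\int[P]_o (\1_(setT : set T) o)%:E).
        by rewrite integral_indic_prob// probability_setT.
      by apply: eq_integral => o _; rewrite indicT /onem_pow expr0.
    - by move=> x; rewrite lee_fin onem_pow_ge0.
    by apply/measurable_EFinP; exact: measurable_onem_pow.
  by rewrite beta_int_oo// gt0_muley ?lte_fin.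
by exists a, b; split => //; exact: (beta_law_of_integral a0 b0 (mv 0%N) int).
Qed.

End classification.

(** * Induction on the length variables *)

Section induction_step.
Local Open Scope ereal_scope.
Context {R : realType} d (T : measurableType d) (P : probability T R).
Local Notation mu := (@lebesgue_measure R).
Local Notation RR := (measurableTypeR R * measurableTypeR R)%type.

Lemma beta_pair_integral (X Y : T -> R) (a b b' : R) :
  (0 < a)%R -> (0 < b)%R -> (0 < b')%R ->
  measurable_fun setT X -> measurable_fun setT Y ->
  beta_law P X a b -> beta_law P Y a b' ->
  (forall B D, measurable B -> measurable D ->
    P (X @^-1` B `&` Y @^-1` D) = P (X @^-1` B) * P (Y @^-1` D)) ->
  forall A : set RR, measurable A ->
  P [set o | A (X o, Y o)] = ((betaR a b)^-1 * (betaR a b')^-1)%R%:E *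
    \int[mu \x mu]_z ((bdens a b z.1 * bdens a b' z.2)%R%:E * (\1_A z)%:E).
Proof.
move=> a0 b0 b'0 mX mY lX lY ind A mA.
have mXY : measurable_fun setT (fun o => (X o, Y o) : RR) by exact: measurable_fun_pair.
have A0 z : 0 <= (\1_A z)%:E :> \bar R by rewrite lee_fin.
have mA1 : measurable_fun setT (fun z : RR => (\1_A z)%:E : \bar R) by exact: measurable_indicE.
have mAo : measurable [set o | A (X o, Y o)].
  by rewrite -[X in measurable X]setTI; exact: mXY.
rewrite -integral_indic_prob//.
transitivity (\int[P]_o ((\1_(setT : set T) o)%:E * (\1_A (X o, Y o))%:E)).
  by apply: eq_integral => o _; rewrite indicT mul1e.
have indT (B D : set (measurableTypeR R)) : measurable B -> measurable D ->
   P (setT `&` (X @^-1` B `&` Y @^-1` D)) = P setT * (P (X @^-1` B) * P (Y @^-1` D)).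
  by move=> mB mD; rewrite setTI probability_setT mul1e; exact: ind.
rewrite (independent_integral (S := measurableTypeR R) (U := measurableTypeR R) mX mY measurableT indT A0 mA1).
rewrite probability_setT mul1e.
set c := ((betaR a b)^-1)%R; set c' := ((betaR a b')^-1)%R.
have c0 : (0 <= c)%R by rewrite invr_ge0 ltW// betaR_gt0.
have c'0 : (0 <= c')%R by rewrite invr_ge0 ltW// betaR_gt0.
have md1 : measurable_fun setT (fun z : RR => bdens a b z.1).
  exact: measurableT_comp (measurable_bdens a b) measurable_fst_R.
have md2 : measurable_fun setT (fun z : RR => bdens a b' z.2).
  exact: measurableT_comp (measurable_bdens a b') measurable_snd_R.
have mF : measurable_fun setT (fun z : RR => (bdens a b z.1 * bdens a b' z.2)%R%:E * (\1_A z)%:E).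
  by apply: emeasurable_funM => //; apply/measurable_EFinP; exact: measurable_funM.
have F0 (z : RR) : 0 <= (bdens a b z.1 * bdens a b' z.2)%R%:E * (\1_A z)%:E.
  by rewrite mule_ge0// lee_fin mulr_ge0// bdens_ge0.
rewrite (@fubini_tonelli1 _ _ (measurableTypeR R) (measurableTypeR R) R mu mu _ mF F0).
have G0 (x : R) : 0 <= \int[P]_o (\1_A (x, Y o))%:E :> \bar R by apply: integral_ge0.
have mG : measurable_fun setT (fun x : R => \int[P]_o (\1_A (x, Y o))%:E : \bar R).
  exact: (measurable_partial (S := measurableTypeR R) (U := measurableTypeR R) P mY A0 mA1).
rewrite (beta_law_integral a0 b0 mX lX G0 mG) EFinM -muleA; congr (_ * _).
pose J (x : R) := \int[mu]_y ((bdens a b' y)%:E * (\1_A (x, y))%:E).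
have mAx (x : R) : measurable_fun setT (fun y : R => (\1_A (x, y))%:E : \bar R).
  exact: (measurableT_comp mA1 (pair1_measurable (T1 := measurableTypeR R) (T2 := measurableTypeR R) x)).
have GE x : \int[P]_o (\1_A (x, Y o))%:E = c'%:E * J x.
  by rewrite (beta_law_integral a0 b'0 mY lY (f := fun y => (\1_A (x, y))%:E)).
have J0 x : 0 <= J x by apply: integral_ge0 => y ?; rewrite mule_ge0// lee_fin bdens_ge0.
have B'0 : (0 < betaR a b')%R by exact: betaR_gt0.
have mJ : measurable_fun setT J.
  have -> : J = fun x => (betaR a b')%:E * \int[P]_o (\1_A (x, Y o))%:E.
    by apply/funext => x; rewrite GE muleA -EFinM divff ?mul1e// gt_eqF.
  by apply: emeasurable_funM.
transitivity (\int[mu]_x ((bdens a b x)%:E * (c'%:E * J x))).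
  by apply: eq_integral => x _; rewrite GE.
rewrite (posfunZ (posfun_bdens a b) (f := J))//; congr (_ * _).
apply: eq_integral => x _; rewrite /fubini_F /=.
have mm : measurable_fun setT (fun y : R => (bdens a b' y)%:E * (\1_A (x, y))%:E).
  by apply: emeasurable_funM => //; apply/measurable_EFinP; exact: measurable_bdens.
rewrite -(posfunZ (posfun_lebesgue (@measurableT _ R)) (f := fun y => (bdens a b' y)%:E * (\1_A (x, y))%:E))//.
- by apply: eq_integral => y _; rewrite EFinM muleA.
- exact: bdens_ge0.
- by move=> y; rewrite mule_ge0// lee_fin bdens_ge0.
Qed.

(** The product of the two densities is positive on the open unit square and zero outside it, so
    null sets agree with those of Lebesgue measure there. *)
Lemma beta_pair_ac (X Y : T -> R) (a b b' : R) :
  (0 < a)%R -> (0 < b)%R -> (0 < b')%R ->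
  measurable_fun setT X -> measurable_fun setT Y ->
  beta_law P X a b -> beta_law P Y a b' ->
  (forall B D, measurable B -> measurable D ->
    P (X @^-1` B `&` Y @^-1` D) = P (X @^-1` B) * P (Y @^-1` D)) ->
  ac_square P X Y.
Proof.
move=> a0 b0 b'0 mX mY lX lY ind A mA'.
have mA : measurable (A : set RR) by [].
rewrite (beta_pair_integral a0 b0 b'0 mX mY lX lY ind mA).
set c := (_ * _)%R.
have c0 : (0 < c)%R by rewrite mulr_gt0// invr_gt0 betaR_gt0.
pose F (z : RR) : \bar R := (bdens a b z.1 * bdens a b' z.2)%R%:E * (\1_A z)%:E.
have mF : measurable_fun setT F.
  apply: emeasurable_funM; last exact: measurable_indicE.
  apply/measurable_EFinP; apply: measurable_funM.
    exact: measurableT_comp (measurable_bdens a b) measurable_fst_R.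
  exact: measurableT_comp (measurable_bdens a b') measurable_snd_R.
have F0 z : 0 <= F z by rewrite mule_ge0// lee_fin mulr_ge0// bdens_ge0.
have Fpos z : A z -> (0 < z.1 < 1)%R -> (0 < z.2 < 1)%R -> F z <> 0.
  move=> Az z1 z2; rewrite /F indicE mem_set// mule1 /bdens z1 z2 => -[] /eqP.
  by rewrite gt_eqF// mulr_gt0// beta_dens_gt0.
have Fz z : F z <> 0 -> [/\ A z, (0 < z.1 < 1)%R & (0 < z.2 < 1)%R].
  move=> Fn; split; apply: contrapT => h; apply: Fn; rewrite /F.
  - by rewrite indicE memNset// mule0.
  - by rewrite /bdens (negbTE (introN idP h)) mul0r mul0e.
  - by rewrite /bdens [X in (_ * X)%R](ifF _ _ (negbTE (introN idP h))) mulr0 mul0e.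
have zeroP : \int[mu \x mu]_z F z = 0 <-> (mu \x mu).-negligible [set z | F z <> 0].
  have := ae_eq_integral_abs (mu \x mu) (@measurableT _ RR) mF.
  rewrite (_ : \int[_]_z `|F z| = \int[mu \x mu]_z F z); last first.
    by apply: eq_integral => z _; rewrite gee0_abs.
  move=> [h1 h2]; split.
    move=> /h1 h; apply: negligibleS h => z /= Fn h; apply: Fn; exact: h.
  move=> h; apply: h2; apply: negligibleS h => z /= nF F00; apply: nF => _; exact: F00.
have -> : c%:E * \int[mu \x mu]_z F z = 0 <-> \int[mu \x mu]_z F z = 0.
  split; last by move=> ->; rewrite mule0.
  by move=> /eqP; rewrite mule_eq0 eqe gt_eqF//= => /eqP.
rewrite zeroP.
have mI : measurable (`[0%R, 1%R]%classic : set (measurableTypeR R)) by exact: measurable_itv.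
have mS : measurable (A `&` (`[0%R, 1%R] `*` `[0%R, 1%R]) : set RR).
  by apply: measurableI => //; exact: measurableX.
rewrite -(negligibleP (mu \x mu) mS); split; last first.
  apply: negligibleS => z /= /Fz[Az /andP[z1 z2] /andP[z3 z4]]; split => //.
  by rewrite /= !in_itv/= !ltW.
move=> h.
(* The closed square exceeds the open one by its boundary, which is covered by null strips over 0
   and 1 in each coordinate. *)
pose B : set (measurableTypeR R) := [set 0%R] `|` [set 1%R].
have mB : measurable B by apply: measurableU.
have muB : mu B = 0.
  apply/negligibleP => //; apply: negligibleU; apply/negligibleP => //; exact: lebesgue_measure_set1.
have n1 : (mu \x mu).-negligible (B `*` setT).
  apply/(negligibleP (mu \x mu) (measurableX mB (@measurableT _ (measurableTypeR R)))).
  transitivity (mu B * mu setT); last by rewrite muB mul0e.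
  exact: (product_measure1E mu mu mB (@measurableT _ (measurableTypeR R))).
have n2 : (mu \x mu).-negligible (setT `*` B).
  apply/(negligibleP (mu \x mu) (measurableX (@measurableT _ (measurableTypeR R)) mB)).
  transitivity (mu setT * mu B); last by rewrite muB mule0.
  exact: (product_measure1E mu mu (@measurableT _ (measurableTypeR R)) mB).
apply: (negligibleS _ (negligibleU h (negligibleU n1 n2))).
have bd (x : R) : `[0%R, 1%R]%classic x -> B x \/ (0 < x < 1)%R.
  rewrite /= in_itv/= => /andP[x0 x1].
  have [->|xn0] := eqVneq x 0%R; first by left; left.
  have [->|xn1] := eqVneq x 1%R; first by left; right.
  by right; rewrite !lt_neqAle x0 x1 eq_sym xn0 xn1.
move=> z [Az [/bd [z1|z1] /bd [z2|z2]]].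
- by right; left.
- by right; left.
- by right; right.
- by left; apply: Fpos.
Qed.

Variable v : nat -> T -> R.
Hypothesis mv : forall j, measurable_fun setT (v j).
Hypothesis v01 : forall j o, (0 <= v j o <= 1)%R.
Hypothesis aegood : {ae P, forall o, good_sticks (path v o)}.

Definition past_independent n : Prop := forall (A : nat -> set R) (D : set R),
  (forall i, measurable (A i)) -> measurable D ->
  let E := [set o | forall i, (i <= n)%N -> A i (v i o)] in
  P (E `&` v n.+1 @^-1` D) = P E * P (v n.+1 @^-1` D).

Lemma measurable_past n (A : nat -> set R) : (forall i, measurable (A i)) ->
  measurable [set o | forall i, (i <= n)%N -> A i (v i o)].
Proof.
move=> mA; rewrite (_ : [set o | _] = setT `&` path v @^-1` cylinder n.+1 A).
  by apply: measurable_path => //; exact: measurable_cylinder.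
by rewrite setTI.
Qed.

Lemma past_setT n : [set o | forall i, (i <= n)%N -> (setT : set R) (v i o)] = setT.
Proof. by apply/seteqP; split. Qed.

Lemma past_last n (B : set R) :
  [set o | forall i, (i <= n)%N -> (if i == n then B else setT) (v i o)] = v n @^-1` B.
Proof.
apply/seteqP; split => o /=; first by move=> /(_ n (leqnn n)); rewrite eqxx.
by move=> Bo i _; case: eqP => // ->.
Qed.

Lemma past_last2 n (B D : set R) :
  [set o | forall i, (i <= n.+1)%N -> (if i == n then B else if i == n.+1 then D else setT) (v i o)] =
  v n @^-1` B `&` v n.+1 @^-1` D.
Proof.
apply/seteqP; split => o /=.
  move=> h; split; first by have := h n (leqnSn n); rewrite eqxx.
  by have := h n.+1 (leqnn _); rewrite eqxx ifF//; apply/eqP; lia.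
by move=> [Bo Do] i _; case: eqP => [->//|_]; case: eqP => // ->.
Qed.

Lemma past_pair_independent n : past_independent n ->
  forall B D, measurable B -> measurable D ->
  P (v n @^-1` B `&` v n.+1 @^-1` D) = P (v n @^-1` B) * P (v n.+1 @^-1` D).
Proof.
move=> ind B D mB mD.
have := ind (fun i => if i == n then B else setT) D; rewrite /= past_last; apply => //.
by move=> i; case: ifP.
Qed.

Lemma past_mutually_independent : (forall n, past_independent n) -> mutually_independent P v.
Proof.
move=> ind n A mA; elim: n => [|n IHn].
  rewrite big_ord0 -[RHS](probability_setT P); congr (P _).
  by apply/seteqP; split.
rewrite big_ord_recr/= -IHn; case: n {IHn} => [|n].
  rewrite [X in _ = P X * _](_ : _ = setT); last by apply/seteqP; split.
  rewrite probability_setT mul1e; congr (P _); apply/seteqP; split => o /=.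
    by move=> /(_ 0%N isT).
  by move=> Ao [|i].
rewrite -(ind n A _ mA (mA n.+1)); congr (P _); apply/seteqP; split => o /=.
  by move=> h; split; [move=> i ilt; apply: h; exact: leqW|exact: h].
by move=> [h1 h2] i; rewrite ltnS leq_eqVlt => /orP[/eqP ->|/h1].
Qed.

Lemma const_past_independent n (kappa : R -> probability R R) :
  (forall B : set R, measurable B -> measurable_fun setT (fun u : R => (kappa u B : \bar R))) ->
  (forall (A : nat -> set R) (B : set R), (forall i, measurable (A i)) -> measurable B ->
     let E := [set o | forall i, (i <= n)%N -> A i (v i o)] in
     P (E `&` v n.+1 @^-1` B) = \int[P]_(o in E) kappa (v n o) B) ->
  (forall l, exists c, {ae P, forall o, kmom kappa l (v n o) = c}) ->
  past_independent n.
Proof.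
move=> mk ker const A D mA mD /=.
apply: (const_kernel_independent mk (measurable_past n mA) (mv n) (mv n.+1) (v01 n.+1)) => //.
- by move=> C mC; exact: ker.
- move=> C mC; have := ker (fun=> setT) C (fun=> measurableT) mC.
  by rewrite /= past_setT setTI.
Qed.

Lemma kernel_pair n (kappa : R -> probability R R) :
  (forall (A : nat -> set R) (B : set R), (forall i, measurable (A i)) -> measurable B ->
     let E := [set o | forall i, (i <= n.+1)%N -> A i (v i o)] in
     P (E `&` v n.+2 @^-1` B) = \int[P]_(o in E) kappa (v n.+1 o) B) ->
  forall A B C, measurable A -> measurable B -> measurable C ->
    P ((v n @^-1` A `&` v n.+1 @^-1` B) `&` v n.+2 @^-1` C) =
    \int[P]_(o in v n @^-1` A `&` v n.+1 @^-1` B) kappa (v n.+1 o) C.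
Proof.
move=> ker A B C mA mB mC.
have := ker (fun i => if i == n then A else if i == n.+1 then B else setT) C.
rewrite /= past_last2; apply => //.
by move=> i; case: ifP => // _; case: ifP.
Qed.

(** Whichever of the three conditions was assumed at the start, the pair of independent beta
    variables (v_n, v_{n+1}) now satisfies condition (A), so the argument for (A) applies at every
    later index. *)
Lemma next_independent n (a b b' : R) : (0 < a)%R -> (0 < b)%R -> (0 < b')%R ->
  markov_chain P v -> stick_invariant P v n -> past_independent n ->
  beta_law P (v n) a b -> beta_law P (v n.+1) a b' -> past_independent n.+1.
Proof.
move=> a0 b0 b'0 markov inv ind ln ln1.
have [kappa [mk ker]] := markov n.+1.
apply: (const_past_independent mk ker) => l.
have ac := beta_pair_ac a0 b0 b'0 (mv n) (mv n.+1) ln ln1 (past_pair_independent ind).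
have y1 : {ae P, forall o, (0 < v n.+1 o < 1)%R} by apply: filterS aegood => o [h _]; exact: h.
apply: (ac_square_const (mv n) (mv n.+1) (measurable_kmom mk l) ac y1).
have cond : cond_version P v n (onem_pow l) (kmom kappa l).
  by apply: cond_version_kernel => //; exact: kernel_pair.
have k01 x : (0 <= kmom kappa l x <= 1)%R by rewrite kmom_ge0 kmom_le1.
apply: filterS (cond_version_swap mv v01 aegood (onem_pow_ge0 l) (measurable_onem_pow l) k01 (measurable_kmom mk l) inv cond) => o.
by rewrite stick_swap_k1.
Qed.

Lemma invariant_beta : markov_chain P v -> swap_invariant P (sb_weights v) ->
  condA P v \/ condB P v \/ condC P v ->
  exists a b : R, [/\ (0 < a)%R, (0 < b)%R, (forall n, past_independent n) &
    forall n, (0 < b + n%:R * (1 - a))%R /\ beta_law P (v n) a (b + n%:R * (1 - a))].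
Proof.
move=> markov swap cond.
have inv := swap_stick_invariant mv aegood swap.
have ind0 : past_independent 0.
  have [kappa [mk ker]] := markov 1%N.
  (* The independence of v_2 from (v_0, v_1) has to come first: that of v_0 and v_1 is deduced from
     it. *)
  have ind1 : past_independent 1.
    apply: (const_past_independent mk ker) => l.
    by apply: first_const => //; exact: kernel_pair.
  move=> A D mA mD /=.
  have -> : [set o | forall i, (i <= 0)%N -> A i (v i o)] = v 0%N @^-1` A 0%N.
    by apply/seteqP; split => o /=; [move=> /(_ 0%N isT)|move=> Ao [|i]].
  apply: first_pair_independent => // A' B' D' mA' mB' mD'.
  have := ind1 (fun i => if i == 0%N then A' else if i == 1%N then B' else setT) D'.
  rewrite /= past_last2; apply => //.
  by move=> i; case: ifP => // _; case: ifP.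
have [a [b [a0 b0 law0]]] := first_beta mv v01 aegood swap (past_pair_independent ind0).
have bS n : (b + n.+1%:R * (1 - a) = b + n%:R * (1 - a) + 1 - a)%R.
  by rewrite -natr1; ring.
have step n : past_independent n -> (0 < b + n%:R * (1 - a))%R ->
    beta_law P (v n) a (b + n%:R * (1 - a)) ->
    (0 < b + n.+1%:R * (1 - a))%R /\ beta_law P (v n.+1) a (b + n.+1%:R * (1 - a)).
  move=> ind bn ln; rewrite bS.
  exact: (next_beta mv v01 aegood a0 bn (past_pair_independent ind) (inv n) ln).
have main n : past_independent n /\ ((0 < b + n%:R * (1 - a))%R /\ beta_law P (v n) a (b + n%:R * (1 - a))).
  elim: n => [|n [ind [bn ln]]]; first by rewrite mul0r addr0.
  have [bn1 ln1] := step n ind bn ln.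
  split; last by [].
  exact: (next_independent a0 bn bn1 markov (inv n) ind ln ln1).
by exists a, b; split => // n; have [] := main n.
Qed.

End induction_step.

(** * From the parameters (a, b) to (sigma, theta), and the converse *)

Unset Implicit Arguments.
Set Strict Implicit.
Set Printing Implicit Defensive.

Theorem mainTheorem6 (R : realType) (d : measure_display) (T : measurableType d)
  (P : probability T R) (v : nat -> T -> R) :
  (forall j, measurable_fun setT (v j)) ->
  (forall j o, 0 <= v j o <= 1) ->
  markov_chain P v ->
  {ae P, forall o, (fun n => \sum_(j < n) sb_weights v j o) @ \oo --> (1 : R)
                   /\ (forall j, 0 < sb_weights v j o)} ->
  condA P v \/ condB P v \/ condC P v ->
  (sbp_invariant P (sb_weights v) <->
   exists sigma theta : R, 0 <= sigma < 1 /\ - sigma < theta /\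
     mutually_independent P v /\
     forall j : nat, beta_law P (v j) (1 - sigma) (theta + j.+1%:R * sigma)).
Proof.
move=> mv v01 markov aesum cond.
have aegood := good_sticks_ae v01 aesum.
have mw := measurable_sb_weights mv.
have aew : {ae P, forall o, good (path (sb_weights v) o)}.
  by apply: filterS aegood => o [].
split=> [inv|[sigma [theta [/andP[s0 s1] [st [ind law]]]]]].
  have swap := sbp_invariant_swap mw aew inv.
  have [a [b [a0 b0 ind law]]] := invariant_beta mv v01 aegood markov swap cond.
  (* For a > 1 the parameter b + n (1 - a) would become negative at n larger than b / (a - 1). *)
  have a1 : a <= 1.
    rewrite leNgt; apply/negP => a1.
    have [+ _] := law (Num.truncn (b / (a - 1))).+1.
    have := truncnS_gt (b / (a - 1)); rewrite ltr_pdivrMr ?subr_gt0// => h1 h2; lra.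
  (* The index of [v] starts at 0, so b is the parameter theta + sigma of the first length
     variable. *)
  exists (1 - a), (b - (1 - a)); split; first by apply/andP; split; lra.
  split; first lra.
  split; first exact: past_mutually_independent.
  move=> j; have [_] := law j; congr beta_law; first by ring.
  by rewrite -natr1; ring.
apply: (swap_sbp_invariant mw aew); apply: (stick_swap_invariant mv aegood) => k.
have pos j : 0 < theta + j.+1%:R * sigma.
  have : 0 <= j%:R * sigma by rewrite mulr_ge0.
  by rewrite -natr1 mulrDl mul1r; lra.
have next : theta + k.+2%:R * sigma = theta + k.+1%:R * sigma + 1 - (1 - sigma).
  by rewrite -[k.+2%:R]natr1; ring.
apply: (beta_stick_invariant mv v01 (a := 1 - sigma) (b := theta + k.+1%:R * sigma)) => //.
- by rewrite subr_gt0.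
- by rewrite -next.
- by rewrite -next.
Qed.
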